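(* Let $r\ge1$, $n\ge0$. For an $r$-tuple $\boldsymbol{\gamma}=(\gamma_0,\ldots,\gamma_{r-1})$ of 2D partitions define the vectors $$\mathsf{x}_i=\big(e_i^{-1}t_1^{(\gamma_i')_k}t_2^{k}\big)_{k>0},\qquad \mathsf{z}_i=\big(e_i\,t_1^{-k}t_2^{-(\gamma_i)_k}\big)_{k>0}\qquad(0\le i\le r-1),$$ with entries $\mathsf{x}_{i,k}$, $\mathsf{z}_{i,k}$. Then $$\mathrm{Ell}_{p,y}(\mathcal{M}(r,n);e_0,\ldots,e_{r-1},t_1,t_2)=\frac1{y^n}\prod_{0\le i<j\le r-1}\frac{M(y^{-1}e_ie_j^{-1}t_1;t_1^{-1},t_2)}{M(e_ie_j^{-1}t_1;t_1^{-1},t_2)}\,\frac{M(e_je_i^{-1}t_2^{-1};t_1^{-1},t_2)}{M(y\,e_je_i^{-1}t_2^{-1};t_1^{-1},t_2)}$$ $$\cdot\prod_{N>0}(1-p^N)\prod_{i,j=0}^{r-1}\frac{M(p^{N-1}y\,e_ie_j^{-1}t_2^{-1};t_1^{-1},t_2)}{M(p^{N-1}e_ie_j^{-1}t_2^{-1};t_1^{-1},t_2)}\,\frac{M(p^{N}y^{-1}e_ie_j^{-1}t_1;t_1^{-1},t_2)}{M(p^{N}e_ie_j^{-1}t_1;t_1^{-1},t_2)}$$ $$\cdot\sum_{\boldsymbol{\gamma}:\,|\boldsymbol{\gamma}|=n}\frac{\mathrm{tr}\Big(p^H\prod_{i=0}^{r-1}\Gamma'_-(\mathsf{z}_i)\,\Gamma'_+(t_2^{-1}\mathsf{x}_i)\,\Gamma_-(-y\,\mathsf{z}_i)\,\Gamma_+(-y^{-1}t_1\,\mathsf{x}_i)\Big)}{\prod_{i=0}^{r-1}\prod_{k,m>0}\big(1-t_2^{-1}\mathsf{x}_{i,k}\mathsf{z}_{i,m}\big)},$$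 where $|\boldsymbol{\gamma}|=\sum_i|\gamma_i|$ and $M(x;v_1,v_2)=\prod_{k,l>0}(1-x\,v_1^kv_2^l)^{-1}$.
   Context: **Elliptic genus.** $\mathcal{M}(r,N)$ is the nonsingular $2rN$-dimensional moduli scheme of pairs $(E,\Phi)$ with $E$ a rank $r$ torsion free sheaf on $\mathbb{P}^2$, $\langle c_2(E),[\mathbb{P}^2]\rangle=N$, locally free near $\ell_\infty=\{[0:z_1:z_2]\}$, and $\Phi:E|_{\ell_\infty}\cong\mathcal{O}_{\ell_\infty}^{\oplus r}$. It carries an action of a $(2+r)$-dimensional torus with characters $t_1,t_2,e_0,\ldots,e_{r-1}$. The fixed points are isolated, indexed by $r$-tuples of Young diagrams $\boldsymbol{Y}=(Y_0,\ldots,Y_{r-1})$ with $\sum|Y_i|=N$, with tangent character $$T|_{\boldsymbol{Y}}=\sum_{a,b=0}^{r-1}e_be_a^{-1}\Big(\sum_{s\in Y_a}t_1^{-l_{Y_b}(s)}t_2^{a_{Y_a}(s)+1}+\sum_{t\in Y_b}t_1^{l_{Y_a}(t)+1}t_2^{-a_{Y_b}(t)}\Big),$$ where $a_Y(i,j)=Y_i-j$, $l_Y(i,j)=(Y^T)_j-i$ ($1$-indexed; $Y_i=0$ beyond the length). The equivariant elliptic genus $\mathrm{Ell}_{p,y}$ is the equivariant integral of the multiplicative class of the tangent bundle given on a Chern root $L$ by $c_1(L)\,y^{-1/2}\,\Theta_{p,y}(e^{-c_1(L)})$, where $\Theta_{p,y}(t)=\prod_{n>0}\frac{(1-yp^{n-1}t)(1-y^{-1}p^nt^{-1})}{(1-p^{n-1}t)(1-p^nt^{-1})}$.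 By torus localisation, $\mathrm{Ell}_{p,y}(\mathcal{M}(r,N);e_0,\ldots,e_{r-1},t_1,t_2)=\sum_{\boldsymbol{Y}}\prod_wy^{-1/2}\Theta_{p,y}(w^{-1})$, with $w$ running over the $2rN$ monomials of $T|_{\boldsymbol{Y}}$. **Vertex operators.** On the space with basis $|\mu\rangle$ indexed by partitions, with $S_{\lambda/\mu}$ skew Schur functions and $\mathbf{x}$ a sequence of variables: $\Gamma_-(\mathbf{x})|\mu\rangle=\sum_{\lambda\supseteq\mu}S_{\lambda/\mu}(\mathbf{x})|\lambda\rangle$, $\Gamma_+(\mathbf{x})|\lambda\rangle=\sum_{\mu\subseteq\lambda}S_{\lambda/\mu}(\mathbf{x})|\mu\rangle$, $\Gamma'_-(\mathbf{x})|\mu\rangle=\sum_{\lambda\supseteq\mu}S_{\lambda'/\mu'}(\mathbf{x})|\lambda\rangle$, $\Gamma'_+(\mathbf{x})|\lambda\rangle=\sum_{\mu\subseteq\lambda}S_{\lambda'/\mu'}(\mathbf{x})|\mu\rangle$, $p^H|\mu\rangle=p^{|\mu|}|\mu\rangle$; $\mathrm{tr}$ is the trace. A prime on a partition denotes the transpose. A product of operators over $i=0,\ldots,r-1$ is ordered with $i$ increasing from left to right. Infinite products are formal products in positive powers of $t_1^{-1}$, $t_2$ (and $p$).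
   Formalization: The operator product is taken with i decreasing from left to right (with i increasing the formula fails for r=2, n=0); the identity is stated for generic parameters in a complete valued field where |t_1|>1>|t_2|>0, |e_i/e_j|<|t_2/t_1|^n for i<j, and |p e_j/e_i|<|t_2/t_1|^n. *)

(* Defs.v *)
From HB Require Import structures.
From mathcomp Require Import all_boot all_order all_algebra finmap.
From mathcomp Require Import all_classical all_reals all_analysis.
From mathcomp Require Import summability.

Set Implicit Arguments.
Unset Strict Implicit.
Unset Printing Implicit Defensive.

Import Order.TTheory GRing.Theory Num.Theory.
Local Open Scope classical_set_scope.
Local Open Scope ring_scope.

(* Fields complete for a multiplicative absolute value: the complex numbers, but
   also every field of formal Laurent series with c ^ order, 0 < c < 1. *)
Record completeValuedField (R : realType) := CompleteValuedField {
  valued_sort :> fieldType;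
  vnorm : valued_sort -> R;
  vnorm_ge0 : forall x, 0 <= vnorm x;
  vnorm_eq0 : forall x, vnorm x = 0 <-> x = 0;
  vnormM : forall x y, vnorm (x * y) = vnorm x * vnorm y;
  vnormD : forall x y, vnorm (x + y) <= vnorm x + vnorm y;
  vnorm_complete : forall u : nat -> valued_sort,
    (forall eps, 0 < eps -> exists N, forall m n,
       (N <= m)%N -> (N <= n)%N -> vnorm (u m - u n) < eps) ->
    exists l, forall eps, 0 < eps ->
      \forall n \near \oo, vnorm (u n - l) < eps
}.

Section Partitions.

Record part := Part {
  parts :> seq nat;
  _ : sorted geq parts && (0%N \notin parts)
}.

HB.instance Definition _ := [isSub for parts].
HB.instance Definition _ := [Choice of part by <:].

Definition psize (la : part) : nat := sumn la.

(* Rows are numbered from 1. *)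
Definition part_row (la : part) (i : nat) : nat := nth 0%N la i.-1.

Definition transpose_seq (s : seq nat) : seq nat :=
  mkseq (fun j => count (fun a => j < a)%N s) (head 0%N s).

Lemma transpose_subproof (la : part) :
  sorted geq (transpose_seq la) && (0%N \notin transpose_seq la).
Proof.
apply/andP; split.
  apply: (@homo_sorted _ _ (fun j => count (fun a => j < a)%N la) ltn geq).
    by move=> i j ij; apply: sub_count => a; apply: ltn_trans.
  exact: iota_ltn_sorted.
apply/negP => /mapP[j]; rewrite mem_iota add0n /= => jh /esym/eqP.
by rewrite -leqn0 leqNgt -has_count; case: (parts la) jh => [|a s] //= ->.
Qed.

Definition transpose (la : part) : part := Part (transpose_subproof la).

Definition cells (la : part) : seq (nat * nat) :=
  [seq (i, j) | i <- iota 1 (size la), j <- iota 1 (part_row la i)].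

Definition arm (Y : part) (s : nat * nat) : int :=
  (part_row Y s.1)%:Z - (s.2)%:Z.
Definition leg (Y : part) (s : nat * nat) : int :=
  (part_row (transpose Y) s.2)%:Z - (s.1)%:Z.

Definition subpart (mu la : part) : bool :=
  [forall i : 'I_(size mu), (part_row mu i.+1 <= part_row la i.+1)%N].

Definition skew_cells (la mu : part) : seq (nat * nat) :=
  [seq c <- cells la | c \notin cells mu].

Definition filling (la mu : part) := {ffun seq_sub (skew_cells la mu) -> nat}.

Definition semistandard (la mu : part) (T : filling la mu) : bool :=
  [forall c, (0 < T c)%N] &&
  [forall c, forall d,
     (((val c).1 == (val d).1) && ((val c).2 < (val d).2)%N
        ==> (T c <= T d)%N) &&
     (((val c).2 == (val d).2) && ((val c).1 < (val d).1)%N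
        ==> (T c < T d)%N)].

End Partitions.

Section InfiniteSumsAndProducts.
Variables (R : realType) (K : completeValuedField R).

(* The limit of f along the filter F, and 0 if there is none. *)
Definition vlim (T : Type) (f : T -> K) (F : set_system T) : K :=
  xget 0 [set l | forall eps, 0 < eps ->
                    \forall t \near F, vnorm (f t - l) < eps].

(* Unconditional sum: the limit of the net of finite partial sums. *)
Definition usum (I : choiceType) (F : I -> K) : K :=
  vlim (partial_sum F) totally.

Definition iprod (F : nat -> K) : K :=
  vlim (fun n => \prod_(1 <= k < n.+1) F k) \oo.

Definition iprod2 (F : nat -> nat -> K) : K :=
  vlim (fun n => \prod_(1 <= k < n.+1) \prod_(1 <= l < n.+1) F k l) \oo.

Definition M (x v1 v2 : K) : K :=
  iprod2 (fun k l => (1 - x * v1 ^+ k * v2 ^+ l)^-1).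

End InfiniteSumsAndProducts.

Section VertexOperators.
Variables (R : realType) (K : completeValuedField R).

(* An alphabet x_1, x_2, ... is a function on nat whose value at 0 is unused. *)
Definition skew_schur (la mu : part) (x : nat -> K) : K :=
  if subpart mu la then
    usum (fun T : filling la mu =>
            if semistandard T then \prod_c x (T c) else 0)
  else 0.

(* An operator A is given by its matrix: A la mu is the coefficient of |la> in
   A |mu>. *)
Definition operator := part -> part -> K.

Definition opmul (A B : operator) : operator :=
  fun la mu => usum (fun nu => A la nu * B nu mu).
Definition opid : operator := fun la mu => (la == mu)%:R.
Definition optrace (A : operator) : K := usum (fun mu => A mu mu).

Definition Gamma_minus (x : nat -> K) : operator :=
  fun la mu => skew_schur la mu x.
Definition Gamma_plus (x : nat -> K) : operator :=
  fun mu la => skew_schur la mu x.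
Definition Gamma'_minus (x : nat -> K) : operator :=
  fun la mu => skew_schur (transpose la) (transpose mu) x.
Definition Gamma'_plus (x : nat -> K) : operator :=
  fun mu la => skew_schur (transpose la) (transpose mu) x.
Definition powH (p : K) : operator :=
  fun la mu => if la == mu then p ^+ psize mu else 0.

End VertexOperators.

Notation "A ** B" := (opmul A B) (at level 40, left associativity).

(* The product of A_0, ..., A_(r-1), ordered as A_(r-1) ** ... ** A_0. The
   factors do not commute. At order 0 in p, the trace of this product yields
   cross factors in e_i / e_j for i < j, which are those that the quotients
   M(y^-1 e_i e_j^-1 t1) / M(e_i e_j^-1 t1), i < j, of the trace formula cancel.
   The opposite order yields them in e_j / e_i, and the formula then fails
   already for r = 2, n = 0. *)
Definition opprod (R : realType) (K : completeValuedField R) (r : nat)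
    (A : 'I_r -> operator K) : operator K :=
  \big[@opmul R K/opid K]_(i < r) A (rev_ord i).

Section EllipticGenus.
Variables (R : realType) (K : completeValuedField R).

Definition Theta (p y t : K) : K :=
  iprod (fun n =>
    ((1 - y * p ^+ n.-1 * t) * (1 - y^-1 * p ^+ n * t^-1)) /
    ((1 - p ^+ n.-1 * t) * (1 - p ^+ n * t^-1))).

Definition multipart (r : nat) := {ffun 'I_r -> part}.

Definition msize (r : nat) (Y : multipart r) : nat :=
  (\sum_(i < r) psize (Y i))%N.

(* The monomials, with multiplicity, of the tangent character at Y. *)
Definition tangent_weights (r : nat) (e : 'I_r -> K) (t1 t2 : K)
    (Y : multipart r) : seq K :=
  flatten [seq
    [seq e ab.2 * (e ab.1)^-1 *
         (t1 ^ (- leg (Y ab.2) s) * t2 ^ (arm (Y ab.1) s + 1))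
      | s <- cells (Y ab.1)] ++
    [seq e ab.2 * (e ab.1)^-1 *
         (t1 ^ (leg (Y ab.1) s + 1) * t2 ^ (- arm (Y ab.2) s))
      | s <- cells (Y ab.2)]
  | ab : 'I_r * 'I_r].

(* The equivariant elliptic genus of M(r, n), as the sum of the local
   contributions of the torus fixed points; sqrty is the chosen y^(1/2). *)
Definition Ell (p sqrty : K) (r n : nat) (e : 'I_r -> K) (t1 t2 : K) : K :=
  \sum_(Y \in [set Y : multipart r | msize Y = n])
    \prod_(w <- tangent_weights e t1 t2 Y)
      (sqrty^-1 * Theta p (sqrty ^+ 2) w^-1).

Definition xvec (t1 t2 ei : K) (ga : part) : nat -> K :=
  fun k => ei^-1 * t1 ^+ part_row (transpose ga) k * t2 ^+ k.

Definition zvec (t1 t2 ei : K) (ga : part) : nat -> K :=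
  fun k => ei * t1 ^- k * t2 ^- part_row ga k.

End EllipticGenus.

(* Main.v *)
(* The identity holds term by term, the summand of gamma being the contribution
   of the fixed point Y = gamma. The skew Schur functions of one variable satisfy
   Cauchy identities by row by row bijections; products and limits extend them to
   commutation relations between the vertex operators. These relations put a
   product of vertex operators in normal order, and by cyclicity of the trace
   tr (p^H L R) = c tr (p^H L R(p)) for a creation operator L, an annihilation
   operator R and the factor c of the exchange of R(p) and L, where R(p) denotes R
   with alphabet multiplied by p; iterating, tr (p^H L R) becomes the infinite
   product of the exchange factors times sum_mu p^|mu| = prod_N (1 - p^N)^-1.
   The trace is thus a product of factors
     Phi_ij(c) = prod_{k, m} (1 - c t2^-1 x_{i, k} z_{j, m}).
   The boundary of a pair of diagrams, read as a lattice path, yields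
     Phi_ij(c) = Vac_ij(c) prod_w (1 - c w^-1),
   with w running over the tangent weights in e_i / e_j and Vac_ij(c) the value of
   Phi_ij(c) for empty diagrams, that is the inverse of a function M. The latter
   cancel against the prefactors, and the remaining products over w are those
   of the theta functions, because w |-> t1 t2 / w exchanges the tangent weights in
   e_i / e_j and those in e_j / e_i. *)
Require Import Defs.
From mathcomp Require Import all_boot all_order all_algebra finmap.
From mathcomp Require Import all_classical all_reals all_analysis.
From mathcomp Require Import summability.
From mathcomp Require Import zify ring lra.

Set Implicit Arguments.
Unset Strict Implicit.
Unset Printing Implicit Defensive.

Import Order.TTheory GRing.Theory Num.Theory.
Local Open Scope classical_set_scope.
Local Open Scope ring_scope.

Section ValuedField.
Variables (R : realType) (K : completeValuedField R).
Implicit Types x y : K.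

Lemma vnorm0 : vnorm (0 : K) = 0.
Proof. exact/vnorm_eq0. Qed.

Lemma vnorm_gt0 x : (0 < vnorm x) = (x != 0).
Proof.
rewrite lt_neqAle vnorm_ge0 andbT eq_sym; congr (~~ _).
by apply/eqP/eqP => /vnorm_eq0.
Qed.

Lemma vnorm1 : vnorm (1 : K) = 1.
Proof.
have n0 : vnorm (1 : K) != 0 by rewrite gt_eqF// vnorm_gt0 oner_neq0.
by apply: (mulfI n0); rewrite -vnormM !mulr1.
Qed.

Lemma vnormN x : vnorm (- x) = vnorm x.
Proof.
apply/eqP; rewrite -(@eqrXn2 _ 2) ?vnorm_ge0//.
by rewrite !expr2 -!vnormM mulrNN.
Qed.

Lemma vnormX x n : vnorm (x ^+ n) = vnorm x ^+ n.
Proof. by elim: n => [|n IH]; rewrite ?expr0 ?vnorm1// !exprS vnormM IH. Qed.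

Lemma vnormV x : vnorm x^-1 = (vnorm x)^-1.
Proof.
have [->|x0] := eqVneq x 0; first by rewrite invr0 vnorm0 invr0.
have n0 : vnorm x != 0 by rewrite gt_eqF// vnorm_gt0.
by apply: (mulfI n0); rewrite -vnormM !divff// vnorm1.
Qed.

Lemma vnormXz x (a : int) : vnorm (x ^ a) = vnorm x ^ a.
Proof. by case: a => n; rewrite /exprz ?vnormV vnormX. Qed.

Lemma vnorm_distC x y : vnorm (x - y) = vnorm (y - x).
Proof. by rewrite -vnormN opprB. Qed.

Lemma vnormB_le x y z : vnorm (x - z) <= vnorm (x - y) + vnorm (y - z).
Proof. by rewrite -[x - z](subrKA y) vnormD. Qed.

Lemma vnorm_le_dist x y : vnorm x <= vnorm (x - y) + vnorm y.
Proof. by rewrite -{1}[x](subrK y) vnormD. Qed.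

Lemma vnorm_sum (I : Type) (s : seq I) (P : pred I) (F : I -> K) :
  vnorm (\sum_(i <- s | P i) F i) <= \sum_(i <- s | P i) vnorm (F i).
Proof.
elim/big_ind2 : _ => [|x a y b xa yb|//]; first by rewrite vnorm0.
by rewrite (le_trans (vnormD _ _))// lerD.
Qed.

Lemma vnorm_prod (I : Type) (s : seq I) (P : pred I) (F : I -> K) :
  vnorm (\prod_(i <- s | P i) F i) = \prod_(i <- s | P i) vnorm (F i).
Proof. by elim/big_ind2 : _ => [|x a y b <- <-|//]; rewrite ?vnorm1 ?vnormM. Qed.

Lemma vnorm_small x : (forall eps, 0 < eps -> vnorm x < eps) -> x = 0.
Proof.
move=> h; apply/eqP; apply: contraT; rewrite -vnorm_gt0 => /h.
by rewrite ltxx.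
Qed.

(** * Unconditional sums and products *)

Section Nets.
Variable I : choiceType.
Implicit Types (f g : {fset I} -> K) (A B : {fset I}).
Local Open Scope fset_scope.
Local Open Scope ring_scope.

Definition netlim f (l : K) := forall eps, 0 < eps ->
  exists A, forall B, A `<=` B -> vnorm (f B - l) < eps.

Lemma netlim_unique f l m : netlim f l -> netlim f m -> l = m.
Proof.
move=> fl fm; apply/eqP; rewrite -subr_eq0; apply/eqP/vnorm_small => e e0.
have e2 : 0 < e / 2 by rewrite divr_gt0.
have [A hA] := fl _ e2; have [B hB] := fm _ e2.
rewrite (le_lt_trans (vnormB_le _ (f (A `|` B)) _))// [ltRHS](splitr e).
by rewrite ltrD// ?hB ?fsubsetUr// vnorm_distC hA// fsubsetUl.
Qed.

Lemma vlim_netlim f l : netlim f l -> vlim f totally = l.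
Proof.
move=> fl; rewrite /vlim; apply: (@netlim_unique f) => //.
have : [set l | forall eps : R, 0 < eps ->
    \forall t \near totally, vnorm (f t - l) < eps] l.
  by move=> e /fl[A hA]; exists A.
move/(@xgetI _ 0) => h e /h[A _ hA]; exists A => B AB; exact: hA.
Qed.

Lemma netlim_cauchy f :
  (forall eps, 0 < eps -> exists A, forall B, A `<=` B ->
     vnorm (f B - f A) < eps) ->
  exists l, netlim f l.
Proof.
move=> h.
have /choice[a ha] : forall n : nat, exists A, forall B, A `<=` B ->
    vnorm (f B - f A) < n.+1%:R^-1.
  by move=> n; apply: h; rewrite invr_gt0.
pose b n := \big[fsetU/fset0]_(i < n.+1) a i.
have ab n m : (n <= m)%N -> a n `<=` b m.
  move=> nm; have := @bigfcup_sup _ _ (enum 'I_m.+1) (inord n) xpredT (fun i => a i).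
  by rewrite mem_enum inordK// big_enum => ->.
have inv_small e : 0 < e -> exists n, forall m, (n <= m)%N -> m.+1%:R^-1 < e :> R.
  move=> e0; exists (Num.truncn e^-1) => m nm.
  rewrite invf_plt ?posrE// (lt_le_trans (truncnS_gt _))// ler_nat ltnS//.
have cb n m k : (n <= m)%N -> (n <= k)%N -> vnorm (f (b m) - f (b k)) < n.+1%:R^-1 *+ 2.
  move=> nm nk; rewrite (le_lt_trans (vnormB_le _ (f (a n)) _))// mulr2n.
  by rewrite ltrD// ?ha ?ab// vnorm_distC ha// ab.
have [|l hl] := @vnorm_complete _ K (f \o b).
  move=> e e0; have [|N hN] := inv_small (e / 2); first by rewrite divr_gt0.
  exists N => m n Nm Nn /=; rewrite (lt_trans (cb N _ _ Nm Nn))//.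
  by rewrite mulr2n [ltRHS](splitr e) ltrD ?hN.
exists l => e e0.
have e3 : 0 < e / 3%:R by rewrite divr_gt0.
have [N hN] := inv_small _ e3; have [M _ hM] := hl _ e3.
pose k := maxn N M.
exists (a k) => B kB.
rewrite (le_lt_trans (vnormB_le _ (f (b k)) _))//.
rewrite (le_lt_trans (lerD (vnormB_le _ (f (a k)) _) (lexx _)))//.
have -> : e = e / 3%:R + e / 3%:R + e / 3%:R by field.
rewrite ltrD ?ltrD//.
- by rewrite (lt_trans (ha _ _ kB))// hN// leq_maxl.
- by rewrite vnorm_distC (lt_trans (ha _ _ _)) ?ab// hN// leq_maxl.
- by apply: hM; rewrite /= leq_maxr.
Qed.

End Nets.

Section Sequences.
Implicit Types (u v : nat -> K).

Definition kcvg u (l : K) := forall eps, 0 < eps ->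
  exists N, forall n, (N <= n)%N -> vnorm (u n - l) < eps.

Lemma kcvg_near u l :
  kcvg u l <-> (forall eps, 0 < eps -> \forall n \near \oo, vnorm (u n - l) < eps).
Proof.
split=> h e /h[]; first by move=> N hN; exists N.
by move=> N _ hN; exists N.
Qed.

Lemma kcvg_unique u l m : kcvg u l -> kcvg u m -> l = m.
Proof.
move=> ul um; apply/eqP; rewrite -subr_eq0; apply/eqP/vnorm_small => e e0.
have e2 : 0 < e / 2 by rewrite divr_gt0.
have [a ha] := ul _ e2; have [b hb] := um _ e2.
rewrite (le_lt_trans (vnormB_le _ (u (maxn a b)) _))// [ltRHS](splitr e).
by rewrite ltrD// ?hb ?leq_maxr// vnorm_distC ha// leq_maxl.
Qed.

Lemma vlim_kcvg u l : kcvg u l -> vlim u \oo = l.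
Proof.
move=> ul; rewrite /vlim; apply: (@kcvg_unique u) => //; apply/kcvg_near.
have : [set l | forall eps : R, 0 < eps ->
    \forall t \near \oo, vnorm (u t - l) < eps] l by apply/kcvg_near.
by move/(@xgetI _ 0).
Qed.

Lemma kcvg_cst (c : K) : kcvg (fun=> c) c.
Proof. by move=> e e0; exists 0%N => n _; rewrite subrr vnorm0. Qed.

Lemma eq_kcvg u v l : u =1 v -> kcvg u l -> kcvg v l.
Proof. by move=> /funext ->. Qed.

Lemma kcvg_shift u l : kcvg (fun n => u n.+1) l <-> kcvg u l.
Proof.
split=> h e /h[N hN].
  by exists N.+1 => -[//|n] /hN.
by exists N => n Nn; apply: hN; apply: leqW.
Qed.

Lemma kcvgD u v l m : kcvg u l -> kcvg v m -> kcvg (fun n => u n + v n) (l + m).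
Proof.
move=> ul vm e e0; have e2 : 0 < e / 2 by rewrite divr_gt0.
have [a ha] := ul _ e2; have [b hb] := vm _ e2; exists (maxn a b) => n.
rewrite geq_max => /andP[/ha an /hb bn].
by rewrite opprD addrACA (le_lt_trans (vnormD _ _))// [ltRHS](splitr e) ltrD.
Qed.

Lemma kcvg_bounded u l : kcvg u l ->
  exists N, forall n, (N <= n)%N -> vnorm (u n) <= vnorm l + 1.
Proof.
move=> /(_ 1 ltr01)[N hN]; exists N => n /hN h.
by rewrite (le_trans (vnorm_le_dist _ l))// addrC lerD// ltW.
Qed.

Lemma kcvgM0 u v m : kcvg u 0 -> kcvg v m -> kcvg (fun n => u n * v n) 0.
Proof.
move=> u0 /kcvg_bounded[b hb] e e0.
have m1 : 0 < vnorm m + 1 by rewrite ltr_wpDl// vnorm_ge0.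
have [a ha] := u0 _ (divr_gt0 e0 m1).
exists (maxn a b) => n; rewrite geq_max => /andP[/ha + /hb bn].
rewrite !subr0 ltr_pdivlMr// vnormM; apply: le_lt_trans.
by rewrite ler_wpM2l// vnorm_ge0.
Qed.

Lemma kcvg_sub0 u l : kcvg u l <-> kcvg (fun n => u n - l) 0.
Proof. by split=> h e /h[N hN]; exists N => n /hN; rewrite subr0. Qed.

Lemma kcvgM u v l m : kcvg u l -> kcvg v m -> kcvg (fun n => u n * v n) (l * m).
Proof.
move=> ul vm; apply/kcvg_sub0.
have h1 := kcvgM0 (proj1 (kcvg_sub0 _ _) ul) vm.
have h2 := kcvgM0 (proj1 (kcvg_sub0 _ _) vm) (kcvg_cst l).
by have := kcvgD h1 h2; rewrite addr0; apply: eq_kcvg => n; ring.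
Qed.

Lemma kcvgV u l : l != 0 -> kcvg u l -> kcvg (fun n => (u n)^-1) l^-1.
Proof.
move=> l0 ul; have nl : 0 < vnorm l by rewrite vnorm_gt0.
apply/kcvg_sub0 => e e0.
have l2 : 0 < vnorm l / 2 by rewrite divr_gt0.
have [a ha] := ul _ l2.
have [b hb] := ul _ (mulr_gt0 e0 (mulr_gt0 nl l2)).
exists (maxn a b) => n; rewrite geq_max => /andP[/ha an /hb bn].
have un : vnorm l / 2 < vnorm (u n).
  have := vnorm_le_dist l (u n); rewrite vnorm_distC; lra.
have un0 : u n != 0 by rewrite -vnorm_gt0 (lt_trans l2).
have -> : (u n)^-1 - l^-1 - 0 = - ((u n - l) * (l * u n)^-1) by rewrite subr0; field; rewrite l0 un0.
rewrite vnormN vnormM vnormV ltr_pdivrMr ?vnorm_gt0 ?mulf_neq0//.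
by rewrite (lt_trans bn)// ltr_pM2l// vnormM ltr_pM2l.
Qed.

Lemma kcvg_sum (T : Type) (r : seq T) (P : pred T) (u : T -> nat -> K) (l : T -> K) :
  (forall t, P t -> kcvg (u t) (l t)) ->
  kcvg (fun n => \sum_(t <- r | P t) u t n) (\sum_(t <- r | P t) l t).
Proof.
move=> h; elim: r => [|t r IH].
  by rewrite big_nil; apply: eq_kcvg (kcvg_cst 0) => n; rewrite big_nil.
rewrite big_cons; case: ifPn => Pt.
  by apply: eq_kcvg (kcvgD (h t Pt) IH) => n; rewrite big_cons Pt.
by apply: eq_kcvg IH => n; rewrite big_cons (negPf Pt).
Qed.

Lemma kcvg_prod (T : Type) (r : seq T) (P : pred T) (u : T -> nat -> K) (l : T -> K) :
  (forall t, P t -> kcvg (u t) (l t)) ->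
  kcvg (fun n => \prod_(t <- r | P t) u t n) (\prod_(t <- r | P t) l t).
Proof.
move=> h; elim: r => [|t r IH].
  by rewrite big_nil; apply: eq_kcvg (kcvg_cst 1) => n; rewrite big_nil.
rewrite big_cons; case: ifPn => Pt.
  by apply: eq_kcvg (kcvgM (h t Pt) IH) => n; rewrite big_cons Pt.
by apply: eq_kcvg IH => n; rewrite big_cons (negPf Pt).
Qed.

Lemma kcvg_geometric (q : K) : vnorm q < 1 -> kcvg (fun n => q ^+ n) 0.
Proof.
move=> q1 e e0.
have /cvgrPdist_lt : (GRing.exp (vnorm q) : R^o ^nat) @ \oo --> (0 : R^o).
  by apply: cvg_expr; rewrite ger0_norm// vnorm_ge0.
move=> /(_ e e0)[N _ hN]; exists N => n /hN.
by rewrite sub0r normrN ger0_norm ?exprn_ge0 ?vnorm_ge0// subr0 vnormX.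
Qed.

End Sequences.
End ValuedField.

Section BoundedSums.
Variable R : realType.

Definition sum_bdd (I : choiceType) (G : I -> R) (B : R) :=
  forall s : seq I, uniq s -> \sum_(i <- s) G i <= B.

Lemma sum_bdd_ge0 (I : choiceType) (G : I -> R) B : sum_bdd G B -> 0 <= B.
Proof. by move/(_ [::] isT); rewrite big_nil. Qed.

Lemma sum_bdd_le (I : choiceType) (G H : I -> R) B :
  (forall i, G i <= H i) -> sum_bdd H B -> sum_bdd G B.
Proof. by move=> GH hH s us; apply: le_trans (hH s us); apply: ler_sum. Qed.

Lemma sum_bddZ (I : choiceType) (G : I -> R) c B :
  0 <= c -> sum_bdd G B -> sum_bdd (fun i => c * G i) (c * B).
Proof. by move=> c0 h s us; rewrite -mulr_sumr ler_wpM2l// h. Qed.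

Lemma big_fset_split (T : Type) (idx : T) (op : Monoid.com_law idx)
    (I : choiceType) (A B : {fset I}) (F : I -> T) : (A `<=` B)%fset ->
  \big[op/idx]_(i <- B) F i =
  op (\big[op/idx]_(i <- A) F i) (\big[op/idx]_(i <- (B `\` A)%fset) F i).
Proof.
move=> AB; rewrite (big_fsetID _ (fun i => i \in A)); congr (op _ _).
  apply: eq_fbigl => i; rewrite !inE /= andbC.
  by case: (boolP (i \in A)) => //= /(fsubsetP AB) ->.
by apply: eq_fbigl => i; rewrite !inE /= andbC.
Qed.

Lemma sum_bdd_tail (I : choiceType) (G : I -> R) B :
  (forall i, 0 <= G i) -> sum_bdd G B ->
  forall eps, 0 < eps -> exists A : {fset I}, forall C : {fset I},
    [disjoint C & A]%fset -> \sum_(i <- C) G i < eps.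
Proof.
move=> G0 GB e e0.
pose S := [set x : R | exists A : {fset I}, x = \sum_(i <- A) G i].
have hS : has_sup S.
  split; first by exists (\sum_(i <- fset0 : {fset I}) G i); exists fset0.
  by exists B => _ [A ->]; apply: GB; rewrite fset_uniq.
have [x [A ->] hx] := sup_adherent e0 hS.
exists A => C CA.
have hAC : \sum_(i <- (A `|` C)%fset) G i <= sup S.
  by apply: sup_upper_bound => //; exists (A `|` C)%fset.
rewrite (big_fset_split _ (A := A)) ?fsubsetUl//= in hAC.
have E : ((A `|` C) `\` A = C)%fset.
  apply/fsetP => i; rewrite !inE; case: (boolP (i \in A)) => //= iA.
  by apply/esym/negP => iC; have := fdisjointP CA _ iC; rewrite iA.
rewrite E in hAC; lra.
Qed.

Lemma sum_bdd_pair (I J : choiceType) (G : I * J -> R) (B : I -> R) C :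
  (forall i, 0 <= G i) ->
  (forall i, sum_bdd (fun j => G (i, j)) (B i)) -> sum_bdd B C ->
  sum_bdd G C.
Proof.
move=> G0 GB BC s us.
pose s1 := undup (map fst s); pose s2 := undup (map snd s).
apply: (@le_trans _ _ (\sum_(i <- s1) \sum_(j <- s2) G (i, j))); last first.
  apply: le_trans (BC s1 (undup_uniq _)); apply: ler_sum => i _.
  exact: GB (undup_uniq _).
rewrite -big_allpairs.
set t := [seq _ | _ <- _, _ <- _].
have ut : uniq t by rewrite allpairs_uniq ?undup_uniq// => -[? ?] [? ?] _ _ [-> ->].
rewrite [leRHS](bigID (fun i => i \in s)) /= -[leLHS]addr0 lerD//; last by rewrite sumr_ge0.
rewrite -[leRHS]big_filter le_eqVlt; apply/orP; left; apply/eqP/perm_big.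
apply: uniq_perm; rewrite ?filter_uniq// => -[i j].
rewrite mem_filter /=; case: (boolP ((i, j) \in s)) => //= ijs.
symmetry; apply: allpairs_f; rewrite mem_undup.
  exact: (map_f fst ijs).
exact: (map_f snd ijs).
Qed.

End BoundedSums.

Section HasSum.
Variables (R : realType) (K : completeValuedField R).
Implicit Types I J : choiceType.

Definition has_usum I (F : I -> K) (s : K) :=
  netlim (fun A : {fset I} => \sum_(i <- A) F i) s.

Definition sumlim I (F : I -> K) B := sum_bdd (fun i => vnorm (F i)) B.

Lemma usum_has I (F : I -> K) s : has_usum F s -> usum F = s.
Proof.
move=> h; apply: vlim_netlim => e /h[A hA]; exists A => B /hA.
by rewrite /partial_sum big_seq_fsetE.
Qed.

Lemma has_usum_unique I (F : I -> K) s t : has_usum F s -> has_usum F t -> s = t.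
Proof. exact: netlim_unique. Qed.

Lemma eq_has_usum I (F G : I -> K) s : F =1 G -> has_usum F s -> has_usum G s.
Proof. by move=> /funext ->. Qed.

Lemma has_usum_ex I (F : I -> K) B : sumlim F B -> exists s, has_usum F s.
Proof.
move=> h; apply: netlim_cauchy => e e0.
have [A hA] := sum_bdd_tail (fun i => vnorm_ge0 (F i)) h e0.
exists A => C sAC; rewrite (big_fset_split _ _ sAC)/= addrAC subrr add0r.
rewrite (le_lt_trans (vnorm_sum _ _ _))// hA//.
by apply/fdisjointP => i; rewrite inE => /andP[].
Qed.

Lemma has_usum_le I (F : I -> K) B s : sumlim F B -> has_usum F s -> vnorm s <= B.
Proof.
move=> h hs; apply/ler_addgt0Pr => e e0; have [A hA] := hs _ e0.
have := hA A (fsubset_refl _).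
rewrite vnorm_distC => hs'; rewrite (le_trans (vnorm_le_dist _ (\sum_(i <- A) F i)))//.
rewrite addrC lerD ?(ltW hs')//.
by rewrite (le_trans (vnorm_sum _ _ _))// h// fset_uniq.
Qed.

Lemma has_usum_seq I (F : I -> K) l (s : nat -> seq I) :
  has_usum F l -> (forall n, uniq (s n)) ->
  (forall i, exists N, forall n, (N <= n)%N -> i \in s n) ->
  kcvg (fun n => \sum_(i <- s n) F i) l.
Proof.
move=> hl us hs e e0; have [A hA] := hl _ e0.
have [N hN] : exists N, forall n, (N <= n)%N -> forall i, i \in A -> i \in s n.
  have /choice[f hf] := hs; exists (\max_(i <- A) f i) => n hn i iA.
  by apply: hf; apply: leq_trans hn; apply: leq_bigmax_seq.
exists N => n /hN hn; have := hA [fset i in s n]%fset.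
rewrite (perm_big (s n)) /=; first apply.
  by apply/fsubsetP => i /hn; rewrite inE.
by apply: uniq_perm; rewrite ?fset_uniq// => i; rewrite !inE.
Qed.

Lemma has_usum_nat (F : nat -> K) s :
  has_usum F s -> kcvg (fun n => \sum_(0 <= k < n) F k) s.
Proof.
move=> h; apply: (has_usum_seq (s := fun n => index_iota 0 n) h) => [n|i].
  exact: iota_uniq.
by exists i.+1 => n; rewrite mem_index_iota.
Qed.

Lemma has_usumZ I (F : I -> K) s c :
  has_usum F s -> has_usum (fun i => c * F i) (c * s).
Proof.
move=> h e e0; have c1 : 0 < vnorm c + 1 by rewrite ltr_wpDl// vnorm_ge0.
have [A hA] := h (e / (vnorm c + 1)) (divr_gt0 e0 c1); exists A => B /hA.
rewrite ltr_pdivlMr// -mulr_sumr -mulrBr vnormM => h1.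
apply: le_lt_trans h1; rewrite mulrC ler_wpM2l ?vnorm_ge0//.
by rewrite lerDl.
Qed.

Lemma has_usumD I (F G : I -> K) s t :
  has_usum F s -> has_usum G t -> has_usum (fun i => F i + G i) (s + t).
Proof.
move=> hF hG e e0; have e2 : 0 < e / 2 by rewrite divr_gt0.
have [A hA] := hF _ e2; have [B hB] := hG _ e2; exists (A `|` B)%fset => C.
rewrite fsubUset => /andP[/hA sAC /hB BC].
rewrite big_split /= opprD addrACA (le_lt_trans (vnormD _ _))// [ltRHS](splitr e).
by rewrite ltrD.
Qed.

Lemma has_usum0 I : has_usum (fun _ : I => 0 : K) 0.
Proof. by move=> e e0; exists fset0 => B _; rewrite big1// subr0 vnorm0. Qed.

Lemma has_usum_sum I (T : Type) (r : seq T) (P : pred T) (F : T -> I -> K) (s : T -> K) :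
  (forall t, P t -> has_usum (F t) (s t)) ->
  has_usum (fun i => \sum_(t <- r | P t) F t i) (\sum_(t <- r | P t) s t).
Proof.
move=> h; elim: r => [|t r IH].
  rewrite big_nil; apply: eq_has_usum (@has_usum0 I) => i; by rewrite big_nil.
rewrite big_cons; case: ifPn => Pt.
  apply: eq_has_usum (has_usumD (h t Pt) IH) => i; by rewrite big_cons Pt.
by apply: eq_has_usum IH => i; rewrite big_cons (negPf Pt).
Qed.

Lemma has_usum_fin I (F : I -> K) (s : seq I) : uniq s ->
  (forall i, i \notin s -> F i = 0) -> has_usum F (\sum_(i <- s) F i).
Proof.
move=> us h e e0; exists [fset i in s]%fset => B sB.
rewrite -(big_fset_incl _ sB); last by move=> i _; rewrite inE => /h.
rewrite (perm_big s) ?subrr ?vnorm0//.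
by apply: uniq_perm => // i; rewrite !inE.
Qed.

Lemma has_usum1 I (F : I -> K) i0 :
  (forall i, i != i0 -> F i = 0) -> has_usum F (F i0).
Proof.
move=> h; have := @has_usum_fin _ F [:: i0] isT; rewrite big_seq1; apply => i.
by rewrite inE => /h.
Qed.

Lemma has_usum_reindex I J (P : pred I) (Q : pred J) (h : J -> I) (g : I -> J)
    (F : I -> K) s :
  (forall j, Q j -> P (h j) /\ g (h j) = j) ->
  (forall i, P i -> Q (g i) /\ h (g i) = i) ->
  has_usum (fun i => if P i then F i else 0) s ->
  has_usum (fun j => if Q j then F (h j) else 0) s.
Proof.
move=> hQ hP hs e e0; have [A hA] := hs e e0.
exists [fset g i | i in A]%fset => B AB.
pose C := ([fset h j | j in [fset j in B | Q j]] `|` A)%fset.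
have := hA C (fsubsetUr _ _); congr (vnorm (_ - _) < _).
rewrite -big_mkcond -[RHS]big_mkcond [LHS]big_fset_condE [RHS]big_fset_condE.
transitivity (\sum_(i <- [fset h j | j in [fset j in B | Q j]]%fset) F i).
  apply: eq_fbigl => i; rewrite !inE /=; apply/andP/idP => [[/orP[//|iA] Pi]|iB].
    apply/imfsetP; exists (g i); last by rewrite (hP _ Pi).2.
    rewrite !inE /= (hP _ Pi).1 andbT (fsubsetP AB)//.
    by apply/imfsetP; exists i.
  split; first by rewrite iB.
  by have /imfsetP[j /= + ->] := iB; rewrite !inE /= => /andP[_ /hQ[]].
rewrite big_imfset//= => j k; rewrite !inE /= => /andP[_ Qj] /andP[_ Qk] hjk.
by rewrite -(hQ _ Qj).2 -(hQ _ Qk).2 hjk.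
Qed.

Lemma has_usum_bij I J (h : J -> I) (g : I -> J) (F : I -> K) s :
  cancel h g -> cancel g h -> has_usum F s -> has_usum (F \o h) s.
Proof.
move=> hg gh.
exact: (@has_usum_reindex _ _ xpredT xpredT h g F s (fun j _ => conj isT (hg j))
  (fun i _ => conj isT (gh i))).
Qed.

Lemma has_usum_pair I J (F : I * J -> K) (f : I -> K) s :
  (forall i, has_usum (fun j => F (i, j)) (f i)) ->
  has_usum F s -> has_usum f s.
Proof.
move=> hf hs e e0; have e2 : 0 < e / 2 by rewrite divr_gt0.
have [A hA] := hs _ e2.
exists [fset p.1 | p in A]%fset => C sAC.
have [D hD] := @has_usum_sum J I C xpredT (fun i j => F (i, j)) f (fun i _ => hf i) _ e2.
pose D' := (D `|` [fset p.2 | p in A])%fset.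
have := hD D' (fsubsetUl _ _); rewrite exchange_big /= => h1.
pose E : seq (I * J) := [seq (i, j) | i <- C, j <- D'].
have uE : uniq E by rewrite allpairs_uniq ?fset_uniq// => -[? ?] [? ?] _ _ [-> ->].
have /hA : (A `<=` [fset p in E])%fset.
  apply/fsubsetP => -[i j] ijA; rewrite inE; apply: allpairs_f.
    by rewrite (fsubsetP sAC)//; apply/imfsetP; exists (i, j).
  by rewrite !inE /=; apply/orP; right; apply/imfsetP; exists (i, j).
rewrite (perm_big E) /=; last by apply: uniq_perm; rewrite ?fset_uniq// => p; rewrite !inE.
rewrite big_allpairs.
move=> h2; rewrite (le_lt_trans (vnormB_le _ (\sum_(i <- C) \sum_(j <- D') F (i, j)) _))//.
by rewrite [ltRHS](splitr e) ltrD// vnorm_distC.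
Qed.

Lemma has_usum_swap I J (F : I * J -> K) s :
  has_usum F s -> has_usum (fun p : J * I => F (p.2, p.1)) s.
Proof. by move=> h; apply: (has_usum_bij (g := fun p : I * J => (p.2, p.1)) _ _ h) => -[]. Qed.

Lemma has_usum_exchange I J (F : I -> J -> K) (f : I -> K) (g : J -> K) s B :
  sumlim (fun p => F p.1 p.2) B ->
  (forall i, has_usum (F i) (f i)) -> (forall j, has_usum (F^~ j) (g j)) ->
  has_usum f s -> has_usum g s.
Proof.
move=> hB hf hg hs; have [S hS] := has_usum_ex hB.
rewrite (has_usum_unique hs (has_usum_pair (F := fun p => F p.1 p.2) hf hS)).
exact: (has_usum_pair (F := fun p => F p.2 p.1) hg (has_usum_swap hS)).
Qed.

Lemma has_usum_dominated_cvg I (F : nat -> I -> K) (F0 : I -> K) (G : I -> R) B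
    (s : nat -> K) s0 :
  (forall i, 0 <= G i) -> sum_bdd G B -> (forall n i, vnorm (F n i) <= G i) ->
  (forall i, kcvg (F^~ i) (F0 i)) ->
  (forall n, has_usum (F n) (s n)) -> has_usum F0 s0 -> kcvg s s0.
Proof.
move=> G0 hB FG F0l hs hs0.
have F0G i : vnorm (F0 i) <= G i.
  apply/ler_addgt0Pr => e e0; have [N hN] := F0l i e e0.
  have := hN N (leqnn N); rewrite vnorm_distC => h.
  by rewrite (le_trans (vnorm_le_dist _ (F N i)))// addrC lerD// ltW.
move=> e e0; have e5 : 0 < e / 5%:R by rewrite divr_gt0.
have [A hA] := sum_bdd_tail G0 hB e5.
have tail (H : I -> K) u : (forall i, vnorm (H i) <= G i) -> has_usum H u ->
    vnorm (u - \sum_(i <- A) H i) < e / 5%:R + e / 5%:R.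
  move=> HG hu; have [D hD] := hu _ e5.
  have h1 := hD (A `|` D)%fset (fsubsetUr _ _).
  rewrite vnorm_distC in h1; apply: le_lt_trans (vnormB_le _ _ _) (ltrD h1 _).
  rewrite (big_fset_split _ _ (fsubsetUl A D))/= addrAC subrr add0r.
  rewrite (le_lt_trans (vnorm_sum _ _ _))// (le_lt_trans (ler_sum _ (fun i _ => HG i)))//.
  by rewrite hA//; apply/fdisjointP => i; rewrite inE => /andP[].
have [N hN] := kcvg_sum A (P := xpredT) (fun i _ => F0l i) e5.
exists N => n /hN h1.
have h2 := tail _ _ (FG n) (hs n); have h3 := tail _ _ F0G hs0.
have := vnormB_le (s n) (\sum_(i <- A) F n i) s0.
have := vnormB_le (\sum_(i <- A) F n i) (\sum_(i <- A) F0 i) s0.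
rewrite (vnorm_distC (\sum_(i <- A) F0 i) s0); lra.
Qed.

Lemma has_usum_dominated I (F : nat -> I -> K) (F0 : I -> K) (G : I -> R) B
    (s : nat -> K) s0 :
  (forall i, 0 <= G i) -> sum_bdd G B -> (forall n i, vnorm (F n i) <= G i) ->
  (forall i, kcvg (F^~ i) (F0 i)) ->
  (forall n, has_usum (F n) (s n)) -> kcvg s s0 -> has_usum F0 s0.
Proof.
move=> G0 hB FG F0l hs hs0.
have F0G i : vnorm (F0 i) <= G i.
  apply/ler_addgt0Pr => e e0; have [N hN] := F0l i e e0.
  have := hN N (leqnn N); rewrite vnorm_distC => h.
  by rewrite (le_trans (vnorm_le_dist _ (F N i)))// addrC lerD// ltW.
have [s1 hs1] := has_usum_ex (sum_bdd_le F0G hB).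
by rewrite (kcvg_unique hs0 (has_usum_dominated_cvg G0 hB FG F0l hs hs1)).
Qed.

End HasSum.

Section ProductBounds.
Variables (R : realType) (K : completeValuedField R).
Implicit Types I : choiceType.

Lemma prod_le_exp (T : Type) (s : seq T) (G : T -> R) : (forall t, 0 <= G t) ->
  \prod_(t <- s) (1 + G t) <= expR (\sum_(t <- s) G t).
Proof.
move=> G0; elim: s => [|t s IH]; first by rewrite !big_nil expR0.
rewrite !big_cons expRD ler_pM ?addr_ge0 ?expR_ge1Dx//.
by rewrite prodr_ge0// => i _; rewrite addr_ge0.
Qed.

Lemma expR_sub1_le (x : R) : expR x - 1 <= x * expR x.
Proof.
have := expR_ge1Dx (- x); rewrite expRN => h.
have e0 := expR_gt0 x.
have : (1 - x) * expR x <= (expR x)^-1 * expR x by rewrite ler_pM2r.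
rewrite mulVf ?gt_eqF//; lra.
Qed.

Lemma vnorm_prod_sub1 (T : Type) (s : seq T) (a : T -> K) :
  vnorm (\prod_(t <- s) (1 + a t) - 1) <= expR (\sum_(t <- s) vnorm (a t)) - 1.
Proof.
elim: s => [|t s IH]; first by rewrite !big_nil expR0 !subrr vnorm0.
rewrite !big_cons expRD.
set P := \prod_(_ <- _) _ in IH *; set E := expR (\sum_(_ <- _) _) in IH *.
have -> : (1 + a t) * P - 1 = (P - 1) + a t * P by ring.
rewrite (le_trans (vnormD _ _))// vnormM.
have PE : vnorm P <= E.
  by have := vnorm_le_dist P 1; rewrite vnorm1; lra.
have : vnorm (a t) * vnorm P <= (expR (vnorm (a t)) - 1) * E.
  rewrite ler_pM ?vnorm_ge0// lerBrDl; exact: expR_ge1Dx.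
lra.
Qed.

Definition has_uprod I (a : I -> K) (l : K) :=
  netlim (fun A : {fset I} => \prod_(i <- A) (1 + a i)) l.

Lemma uprod_cauchy I (a : I -> K) B : sumlim a B -> forall eps, 0 < eps ->
  exists A : {fset I}, forall C, (A `<=` C)%fset ->
    vnorm (\prod_(i <- C) (1 + a i) - \prod_(i <- A) (1 + a i)) <=
    eps * vnorm (\prod_(i <- A) (1 + a i)).
Proof.
move=> h e e0; pose d := Num.min 1 (e / expR 1).
have d0 : 0 < d by rewrite lt_min ltr01 divr_gt0 ?expR_gt0.
have [A hA] := sum_bdd_tail (fun i => vnorm_ge0 (a i)) h d0.
exists A => C sAC; rewrite (big_fset_split _ _ sAC)/=.
set P := \prod_(_ <- A) _; set Q := \prod_(_ <- _) _.
have -> : P * Q - P = (Q - 1) * P by ring.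
rewrite vnormM ler_wpM2r ?vnorm_ge0// (le_trans (vnorm_prod_sub1 _ _))//.
have : \sum_(i <- (C `\` A)%fset) vnorm (a i) < d.
  by rewrite hA//; apply/fdisjointP => i; rewrite inE => /andP[].
set S := \sum_(_ <- _) _ => Sd; rewrite (le_trans (expR_sub1_le _))//.
have S0 : 0 <= S by rewrite sumr_ge0// => i _; exact: vnorm_ge0.
move: Sd; rewrite lt_min => /andP[S1 Se].
apply: (@le_trans _ _ (S * expR 1)); first by rewrite ler_wpM2l// ler_expR ltW.
by rewrite -ler_pdivlMr ?expR_gt0// ltW.
Qed.

Lemma uprod_bound I (a : I -> K) B (A : {fset I}) : sumlim a B ->
  vnorm (\prod_(i <- A) (1 + a i)) <= expR B.
Proof.
move=> h; rewrite vnorm_prod; apply: (@le_trans _ _ (\prod_(i <- A) (1 + vnorm (a i)))).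
  by apply: ler_prod => i _; rewrite vnorm_ge0 -(vnorm1 K) vnormD.
rewrite (le_trans (prod_le_exp _ (fun i => vnorm_ge0 (a i))))// ler_expR h//.
Qed.

Lemma has_uprod_ex I (a : I -> K) B : sumlim a B -> exists l, has_uprod a l.
Proof.
move=> h; apply: netlim_cauchy => e e0.
have E0 : 0 < expR B + 1 by rewrite addr_gt0 ?expR_gt0.
have [A hA] := uprod_cauchy h (divr_gt0 e0 E0).
exists A => C /hA /le_lt_trans; apply.
have := uprod_bound A h => hb.
rewrite mulrAC ltr_pdivrMr// ltr_pM2l// (le_lt_trans hb)//; lra.
Qed.

Lemma has_uprod_neq0 I (a : I -> K) B l : sumlim a B ->
  (forall i, 1 + a i != 0) -> has_uprod a l -> l != 0.
Proof.
move=> h a0 hl; apply/eqP => l0; rewrite {l}l0 in hl.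
have [A hA] := uprod_cauchy h (divr_gt0 ltr01 (ltr0Sn R 1)).
set P := \prod_(i <- A) _ in hA.
have P0 : 0 < vnorm P by rewrite vnorm_gt0 prodf_seq_neq0; apply/allP => i _ /=.
have P4 : 0 < vnorm P / 4%:R by rewrite divr_gt0.
have [C hC] := hl _ P4.
have := hA (A `|` C)%fset (fsubsetUl _ _).
have := hC (A `|` C)%fset (fsubsetUr _ _); rewrite subr0.
set Q := \prod_(i <- _) _ => h1; rewrite vnorm_distC => h2.
have := vnorm_le_dist P Q; lra.
Qed.

Lemma has_uprod_sub1 I (a : I -> K) B l : sumlim a B -> has_uprod a l ->
  vnorm (l - 1) <= B * expR B.
Proof.
move=> h hl; apply: le_trans (expR_sub1_le B); apply/ler_addgt0Pr => e e0.
have [A hA] := hl _ e0; have h1 := hA A (fsubset_refl _).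
have h2 := vnorm_prod_sub1 A a.
have h3 : expR (\sum_(i <- A) vnorm (a i)) <= expR B by rewrite ler_expR h.
have := vnormB_le l (\prod_(i <- A) (1 + a i)) 1; rewrite vnorm_distC in h1; lra.
Qed.

Lemma has_uprod_seq I (a : I -> K) l (s : nat -> seq I) :
  has_uprod a l -> (forall n, uniq (s n)) ->
  (forall i, exists N, forall n, (N <= n)%N -> i \in s n) ->
  kcvg (fun n => \prod_(i <- s n) (1 + a i)) l.
Proof.
move=> hl us hs e e0; have [A hA] := hl _ e0.
have [N hN] : exists N, forall n, (N <= n)%N -> forall i, i \in A -> i \in s n.
  have /choice[f hf] := hs; exists (\max_(i <- A) f i) => n hn i iA.
  by apply: hf; apply: leq_trans hn; apply: leq_bigmax_seq.
exists N => n /hN hn; have := hA [fset i in s n]%fset.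
rewrite (perm_big (s n)) /=; first apply.
  by apply/fsubsetP => i /hn; rewrite inE.
by apply: uniq_perm; rewrite ?fset_uniq// => i; rewrite !inE.
Qed.

End ProductBounds.

Section DoubleProducts.
Variables (R : realType) (K : completeValuedField R).
Implicit Types (a : nat -> nat -> K) (p q : K).

Definition box n : seq (nat * nat) :=
  [seq (k, l) | k <- index_iota 0 n, l <- index_iota 0 n].

Lemma box_uniq n : uniq (box n).
Proof. by rewrite allpairs_uniq ?iota_uniq// => -[? ?] [? ?] _ _ [-> ->]. Qed.

Lemma mem_box n k l : ((k, l) \in box n) = (k < n)%N && (l < n)%N.
Proof.
apply/idP/andP => [/allpairsP[[i j] /= [+ + [-> ->]]]|[kn ln]].
  by rewrite !mem_index_iota.
by apply: allpairs_f; rewrite mem_index_iota.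
Qed.

Lemma box_exhausts (i : nat * nat) :
  exists N, forall n, (N <= n)%N -> i \in box n.
Proof.
case: i => k l; exists (maxn k l).+1 => n; by rewrite mem_box -gtn_max.
Qed.

Lemma big_box (T : Type) (idx : T) (op : Monoid.com_law idx) n (F : nat -> nat -> T) :
  \big[op/idx]_(1 <= k < n.+1) \big[op/idx]_(1 <= l < n.+1) F k l =
  \big[op/idx]_(i <- box n) F i.1.+1 i.2.+1.
Proof.
rewrite big_add1 big_allpairs /=.
by apply: eq_bigr => k _; rewrite big_add1.
Qed.

Definition dsummable a B := sumlim (fun i : nat * nat => a i.1.+1 i.2.+1) B.

Definition Phi a : K := iprod2 (fun k l => 1 - a k l).

Lemma dsummableN a B : dsummable a B ->
  sumlim (fun i : nat * nat => - a i.1.+1 i.2.+1) B.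
Proof. by apply: sum_bdd_le => i; rewrite vnormN. Qed.

Lemma dsummableZ a B q : dsummable a B ->
  dsummable (fun k l => q * a k l) (vnorm q * B).
Proof.
move=> h; apply: sum_bdd_le (sum_bddZ (vnorm_ge0 q) h) => i.
by rewrite vnormM.
Qed.

Lemma Phi_uprod a B : dsummable a B ->
  has_uprod (fun i : nat * nat => - a i.1.+1 i.2.+1) (Phi a).
Proof.
move=> h; have [l hl] := has_uprod_ex (dsummableN h).
rewrite (_ : Phi a = l)//; apply: vlim_kcvg.
apply: eq_kcvg (has_uprod_seq hl box_uniq box_exhausts) => n.
by rewrite big_box.
Qed.

Lemma Phi_cvg a B : dsummable a B ->
  kcvg (fun n => \prod_(1 <= k < n.+1) \prod_(1 <= l < n.+1) (1 - a k l)) (Phi a).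
Proof.
move/Phi_uprod => hl; apply: eq_kcvg (has_uprod_seq hl box_uniq box_exhausts) => n.
by rewrite big_box.
Qed.

Lemma Phi_neq0 a B : dsummable a B ->
  (forall k l, (0 < k)%N -> (0 < l)%N -> a k l != 1) -> Phi a != 0.
Proof.
move=> h a1; apply: has_uprod_neq0 (dsummableN h) _ (Phi_uprod h) => i.
by rewrite subr_eq0 eq_sym a1.
Qed.

Lemma Phi_sub1 a B : dsummable a B -> vnorm (Phi a - 1) <= B * expR B.
Proof. by move=> h; apply: has_uprod_sub1 (dsummableN h) (Phi_uprod h). Qed.

Lemma geometric_bdd (x : R) : 0 <= x < 1 -> sum_bdd (fun n => x ^+ n) (1 - x)^-1.
Proof.
move=> /andP[x0 x1] s us.
have [N hN] : exists N, forall n, n \in s -> (n < N)%N.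
  by exists (\max_(i <- s) i).+1 => n ns; rewrite ltnS (leq_bigmax_seq (F := id)).
apply: (@le_trans _ _ (\sum_(0 <= n < N) x ^+ n)).
  rewrite [leRHS](bigID (fun n => n \in s)) /= -[leLHS]addr0 lerD//; last first.
    by rewrite sumr_ge0// => n _; rewrite exprn_ge0.
  rewrite -[leRHS]big_filter le_eqVlt; apply/orP; left; apply/eqP/perm_big.
  apply: uniq_perm; rewrite ?filter_uniq ?iota_uniq// => n.
  by rewrite mem_filter mem_index_iota /=; case: (boolP (n \in s)) => //= /hN ->.
have h0 : 0 < 1 - x by rewrite subr_gt0.
rewrite -[leRHS]div1r ler_pdivlMr// mulrC big_mkord -[1 - x]opprB mulNr -subrX1 opprB.
by rewrite lerBlDr lerDl exprn_ge0.
Qed.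

Definition Gam p a : K := iprod (fun N => Phi (fun k l => p ^+ N * a k l)).

Section Gam.
Variables (p : K) (a : nat -> nat -> K) (B : R).
Hypotheses (p1 : vnorm p < 1) (aB : dsummable a B).

Let B0 : 0 <= B. Proof. exact: sum_bdd_ge0 aB. Qed.

Lemma Phi_pow_sub1 N : vnorm (Phi (fun k l => p ^+ N * a k l) - 1) <=
  vnorm p ^+ N * (B * expR B).
Proof.
have pN : vnorm (p ^+ N) <= 1 by rewrite vnormX exprn_ile1 ?vnorm_ge0// ltW.
rewrite (le_trans (Phi_sub1 (dsummableZ (p ^+ N) aB)))// -vnormX -mulrA.
rewrite ler_wpM2l ?vnorm_ge0// ler_wpM2l// ler_expR ler_piMl//.
Qed.

Let summ : sumlim (fun N => Phi (fun k l => p ^+ N.+1 * a k l) - 1)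
  ((1 - vnorm p)^-1 * (B * expR B)).
Proof.
have p01 : 0 <= vnorm p < 1 by rewrite vnorm_ge0.
rewrite mulrC; have BE : 0 <= B * expR B by rewrite mulr_ge0// expR_ge0.
apply: sum_bdd_le (sum_bddZ BE (geometric_bdd p01)) => N.
rewrite (le_trans (Phi_pow_sub1 N.+1))// mulrC ler_wpM2l// exprS.
by rewrite ler_piMl ?exprn_ge0 ?vnorm_ge0// ltW.
Qed.

Let lim_ex : exists2 l,
  has_uprod (fun N => Phi (fun k l => p ^+ N.+1 * a k l) - 1) l &
  kcvg (fun n => \prod_(1 <= N < n.+1) Phi (fun k l => p ^+ N * a k l)) l.
Proof.
have [l hl] := has_uprod_ex summ; exists l => //.
apply: eq_kcvg (has_uprod_seq (s := fun n => index_iota 0 n) hl _ _) => [n|n|n].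
- by rewrite big_add1; apply: eq_bigr => N _; rewrite addrC subrK.
- exact: iota_uniq.
- by exists n.+1 => m nm; rewrite mem_index_iota.
Qed.

Lemma Gam_cvg :
  kcvg (fun n => \prod_(1 <= N < n.+1) Phi (fun k l => p ^+ N * a k l)) (Gam p a).
Proof. by have [l _ hl] := lim_ex; rewrite /Gam /iprod (vlim_kcvg hl). Qed.

Lemma Gam_neq0 : (forall N k l, (0 < N)%N -> (0 < k)%N -> (0 < l)%N ->
  p ^+ N * a k l != 1) -> Gam p a != 0.
Proof.
move=> h; have [l hu hl] := lim_ex; rewrite /Gam /iprod (vlim_kcvg hl).
apply: has_uprod_neq0 summ _ hu => N; rewrite addrC subrK.
by apply: Phi_neq0 (dsummableZ _ aB) _ => k m k0 m0; apply: h.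
Qed.

End Gam.

Lemma Gam0_cvg p a B : vnorm p < 1 -> dsummable a B ->
  kcvg (fun n => \prod_(1 <= N < n.+1) Phi (fun k l => p ^+ N.-1 * a k l))
    (Phi a * Gam p a).
Proof.
move=> p1 aB; apply/kcvg_shift.
apply: eq_kcvg (kcvgM (kcvg_cst (Phi a)) (Gam_cvg p1 aB)) => n.
rewrite [RHS]big_ltn// [X in _ = _ * X]big_add1 big_add1 /=; congr (_ * _).
by congr Phi; apply/funext => k; apply/funext => l; rewrite expr0 mul1r.
Qed.

Lemma iprod_has (F : nat -> K) l :
  kcvg (fun n => \prod_(1 <= N < n.+1) F N) l -> iprod F = l.
Proof. exact: vlim_kcvg. Qed.

End DoubleProducts.

(** * Partitions and strips *)

Section PartitionRows.
Implicit Types (la mu nu : part) (i j n : nat).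

(* Rows numbered from 0, unlike those of part_row. *)
Definition prow la i := nth 0%N la i.

Lemma part_sorted la : sorted geq la.
Proof. by case: la => s /= /andP[]. Qed.

Lemma part_neq0 la : 0%N \notin (la : seq nat).
Proof. by case: la => s /= /andP[]. Qed.

Lemma prow_le la i j : (i <= j)%N -> (prow la j <= prow la i)%N.
Proof.
move=> ij; case: (ltnP j (size la)) => jl; last by rewrite /prow nth_default.
have geq_trans : transitive geq by move=> a b c /= ba ac; exact: leq_trans ac ba.
by have /(_ i j (leq_ltn_trans ij jl) jl ij) := sorted_leq_nth geq_trans leqnn 0%N (part_sorted la).
Qed.

Lemma prow_gt0 la i : (0 < prow la i)%N = (i < size la)%N.
Proof.
case: (ltnP i (size la)) => il; last by rewrite /prow nth_default.
by rewrite lt0n; apply: contraNneq (part_neq0 la) => <-; exact: mem_nth.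
Qed.

Lemma prow_eq0 la i : (size la <= i)%N -> prow la i = 0%N.
Proof. by rewrite leqNgt -prow_gt0 lt0n negbK => /eqP. Qed.

Lemma part_ext la mu : prow la =1 prow mu -> la = mu.
Proof.
move=> h; apply: val_inj => /=; apply: (@eq_from_nth _ 0%N) => [|i _]; last exact: h.
have H (a b : part) : prow a =1 prow b -> (size a <= size b)%N.
  by move=> ab; rewrite leqNgt -prow_gt0 ab prow_gt0 ltnn.
by apply/eqP; rewrite eqn_leq !H.
Qed.

Lemma mkpart_subproof n (f : nat -> nat) :
  let s := [seq x <- sort geq (mkseq f n) | x != 0%N] in
  sorted geq s && (0%N \notin s).
Proof.
apply/andP; split; last by rewrite mem_filter.
apply: sorted_filter; first by move=> a b c /= ba ac; exact: leq_trans ac ba.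
by apply: sort_sorted => a b; exact: leq_total.
Qed.

Definition mkpart n f : part := Part (mkpart_subproof n f).

Lemma prow_mkpart n (f : nat -> nat) i : (forall i, f i.+1 <= f i)%N ->
  (forall i, (n <= i)%N -> f i = 0%N) -> prow (mkpart n f) i = f i.
Proof.
move=> fd f0; rewrite /prow /=.
have fmono a b : (a <= b)%N -> (f b <= f a)%N.
  by move=> /subnK <-; elim: (b - a)%N => //= k IH; rewrite addSn (leq_trans (fd _)).
rewrite sorted_sort; last first.
- apply: (@homo_sorted _ _ f ltn geq) => [a b /ltnW|]; first exact: fmono.
  exact: iota_ltn_sorted.
- by move=> a b c /= ba ac; exact: leq_trans ac ba.
elim: n f fd f0 fmono i => [|n IH] f fd f0 fmono i; first by rewrite nth_nil f0.
rewrite /mkseq /= -[1%N]/(1 + 0)%N iotaDl -map_comp.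
case: ifPn => [fn0|/negPn/eqP fn0]; last first.
  have fz k : f k = 0%N by apply/eqP; rewrite -leqn0 -fn0 fmono.
  rewrite fz (eq_in_filter (a2 := pred0)) ?filter_pred0 ?nth_nil// => x.
  by move=> /mapP[k _ ->]; rewrite /= fz.
case: i => [//|i] /=; rewrite -(IH (fun k => f k.+1)) => //.
- by move=> k nk; exact: f0.
- by move=> a b ab; exact: fmono.
Qed.

Lemma psizeE la N : (size la <= N)%N -> psize la = (\sum_(i < N) prow la i)%N.
Proof.
move=> lN; rewrite /psize sumnE (big_nth 0%N) big_mkord.
rewrite (big_ord_widen N (fun i => nth 0%N la i))// big_mkcond /=.
by apply: eq_bigr => i _; case: ifPn => //; rewrite -leqNgt => /prow_eq0.
Qed.

Lemma prow_transpose la j : prow (transpose la) j = count (fun a => j < a)%N la.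
Proof.
rewrite /prow /= /transpose_seq; case: (ltnP j (head 0%N la)) => h.
  by rewrite nth_mkseq.
rewrite nth_default ?size_mkseq//; apply/esym/eqP; rewrite -leqn0 leqNgt -has_count.
apply/hasPn => a /(nthP 0%N)[i _ <-]; rewrite -leqNgt (leq_trans _ h)//.
by rewrite -nth0; exact: prow_le.
Qed.

Lemma lt_prow_transpose la i j : (i < prow (transpose la) j)%N = (j < prow la i)%N.
Proof.
rewrite prow_transpose /prow.
have := part_sorted la; elim: (parts la) i => [|a s IH] i /=; first by rewrite nth_nil.
move=> ps; have ss := path_sorted ps.
have all_s : all (fun b => b <= a)%N s.
  by apply: order_path_min ps => x y z /= yx xz; exact: leq_trans xz yx.
case: i => [|i] /=; last first.
  case: (ltnP j a) => ja; first by rewrite add1n ltnS IH.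
  have hj b : b \in s -> (j < b)%N = false.
    by move=> /(allP all_s) ba; apply/negbTE; rewrite -leqNgt (leq_trans ba).
  rewrite add0n (eq_in_count (a2 := pred0)) ?count_pred0// ltn0; apply/esym/negbTE.
  case: (ltnP i (size s)) => il; last by rewrite nth_default.
  by rewrite hj// mem_nth.
case: (ltnP j a) => ja //=; rewrite add0n -has_count; apply/negbTE/hasPn => b.
by move=> /(allP all_s) ba; rewrite -leqNgt (leq_trans ba).
Qed.

Lemma transposeK : involutive transpose.
Proof.
move=> la; apply: part_ext => i; apply/eqP; rewrite eqn_leq; apply/andP; split.
  rewrite leqNgt lt_prow_transpose lt_prow_transpose ltnn//.
by rewrite leqNgt -lt_prow_transpose -lt_prow_transpose ltnn.
Qed.

Lemma subpartP mu la : reflect (forall i, (prow mu i <= prow la i)%N) (subpart mu la).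
Proof.
apply: (iffP forallP) => [h i|h i]; last exact: h.
case: (ltnP i (size mu)) => im; last by rewrite prow_eq0.
exact: (h (Ordinal im)).
Qed.

Lemma subpart_refl la : subpart la la.
Proof. exact/subpartP. Qed.

Lemma subpart_trans nu mu la : subpart mu nu -> subpart nu la -> subpart mu la.
Proof. by move=> /subpartP h1 /subpartP h2; apply/subpartP => i; exact: leq_trans (h2 i). Qed.

Lemma subpart_anti mu la : subpart mu la -> subpart la mu -> mu = la.
Proof.
move=> /subpartP h1 /subpartP h2; apply: part_ext => i.
by apply/eqP; rewrite eqn_leq h1 h2.
Qed.

Lemma subpart_transpose mu la : subpart (transpose mu) (transpose la) = subpart mu la.
Proof.
have H x y : subpart x y -> subpart (transpose x) (transpose y).
  move=> /subpartP h; apply/subpartP => j; rewrite leqNgt lt_prow_transpose -leqNgt.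
  by rewrite (leq_trans (h _))// leqNgt -lt_prow_transpose ltnn.
by apply/idP/idP => /H //; rewrite !transposeK.
Qed.

Lemma subpart_size mu la : subpart mu la -> (size mu <= size la)%N.
Proof.
move=> /subpartP h; rewrite leqNgt; apply/negP; rewrite -prow_gt0 => /leq_trans.
by move=> /(_ _ (h _)); rewrite prow_gt0 ltnn.
Qed.

Lemma subpart_psize mu la : subpart mu la -> (psize mu <= psize la)%N.
Proof.
move=> h; rewrite (psizeE (subpart_size h)) (psizeE (leqnn _)).
by apply: leq_sum => i _; move/subpartP: h.
Qed.

Lemma psize_eq mu la : subpart mu la -> psize mu = psize la -> mu = la.
Proof.
move=> h; rewrite (psizeE (subpart_size h)) (psizeE (leqnn _)) => /eqP.
have /subpartP h' := h.
have [_ ->] := leqif_sum (P := xpredT) (fun (i : 'I_(size la)) _ => leqif_eq (h' i)).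
move=> /forallP hi; apply: part_ext => i; case: (ltnP i (size la)) => il.
  exact/eqP/(hi (Ordinal il)).
by rewrite !prow_eq0// (leq_trans (subpart_size h)).
Qed.

Lemma psize_transpose la : psize (transpose la) = psize la.
Proof.
have H (N M : nat) (mu : part) : (size mu <= N)%N -> (prow mu 0 <= M)%N ->
    psize mu = (\sum_(i < N) \sum_(j < M) (j < prow mu i)%N)%N.
  move=> hN hM; rewrite (psizeE hN); apply: eq_bigr => i _.
  rewrite -(big_mkord xpredT (fun j => (j < prow mu i)%N : nat)).
  rewrite (@big_cat_nat _ _ _ (prow mu i)) ?leq0n//=; last by rewrite (leq_trans _ hM)// prow_le.
  rewrite [X in (_ + X)%N](_ : _ = 0%N) ?addn0.
    rewrite big_nat (eq_bigr (fun=> 1%N)).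
      by rewrite -big_nat sum_nat_const_nat subn0 muln1.
    by move=> j /andP[_ ->].
  by rewrite big_nat big1// => j /andP[+ _]; rewrite leqNgt => /negbTE ->.
rewrite (H _ _ la (leqnn _) (leqnn _)) exchange_big.
rewrite (H (prow la 0) (size la)); last 2 first.
- by rewrite leqNgt -prow_gt0 lt_prow_transpose ltnn.
- by rewrite leqNgt lt_prow_transpose prow_gt0 ltnn.
by apply: eq_bigr => i _; apply: eq_bigr => j _; rewrite lt_prow_transpose.
Qed.

Definition parts_in n m : seq part :=
  undup [seq mkpart n (fun i => if insub i is Some k then f k : nat else 0%N) |
         f : {ffun 'I_n -> 'I_m.+1}].

Lemma mem_parts_in n m mu : (size mu <= n)%N -> (prow mu 0 <= m)%N ->
  mu \in parts_in n m.
Proof.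
move=> hn hm; rewrite mem_undup; apply/mapP.
have hlt i : (prow mu i < m.+1)%N by rewrite ltnS (leq_trans _ hm)// prow_le.
exists [ffun i : 'I_n => Ordinal (hlt i)]; first by rewrite mem_enum.
have E i : (if insub i is Some k then ([ffun i : 'I_n => Ordinal (hlt i)] k : nat) else 0%N) = prow mu i.
  case: insubP => [k _ ki|]; first by rewrite ffunE /= ki.
  by rewrite -leqNgt => ni; rewrite prow_eq0// (leq_trans hn).
apply: part_ext => i; rewrite prow_mkpart ?E// => j; rewrite ?E; first exact: prow_le.
by move=> nj; rewrite prow_eq0// (leq_trans hn).
Qed.

Definition subs la := [seq mu <- parts_in (size la) (prow la 0) | subpart mu la].

Lemma subs_uniq la : uniq (subs la).
Proof. by rewrite filter_uniq// undup_uniq. Qed.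

Lemma mem_subs mu la : (mu \in subs la) = subpart mu la.
Proof.
rewrite mem_filter; case: (boolP (subpart mu la)) => //= h.
by rewrite mem_parts_in// ?subpart_size//; move/subpartP: h.
Qed.

Lemma size_le_psize la : (size la <= psize la)%N.
Proof.
rewrite (psizeE (leqnn _)) -[leqLHS]card_ord -sum1_card; apply: leq_sum => i _.
by rewrite prow_gt0.
Qed.

Lemma prow_le_psize la i : (prow la i <= psize la)%N.
Proof.
case: (ltnP i (size la)) => il; last by rewrite prow_eq0.
by rewrite (psizeE (leqnn _)) (bigD1 (Ordinal il))//= leq_addr.
Qed.

Definition parts_upto D := [seq mu <- parts_in D D | (psize mu <= D)%N].

Lemma parts_upto_uniq D : uniq (parts_upto D).
Proof. by rewrite filter_uniq// undup_uniq. Qed.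

Lemma mem_parts_upto mu D : (mu \in parts_upto D) = (psize mu <= D)%N.
Proof.
rewrite mem_filter; case: leqP => //= h.
by rewrite mem_parts_in// (leq_trans _ h)// ?size_le_psize ?prow_le_psize.
Qed.

Definition hstrip la mu :=
  subpart mu la && all (fun i => prow la i.+1 <= prow mu i)%N (iota 0 (size la)).

Lemma hstripP la mu :
  reflect (forall i, (prow la i.+1 <= prow mu i <= prow la i)%N) (hstrip la mu).
Proof.
apply: (iffP andP) => [[/subpartP h1 /allP h2] i|h].
  rewrite h1 andbT; case: (ltnP i (size la)) => il; first by rewrite h2// mem_iota.
  by rewrite prow_eq0// leqW.
by split; [apply/subpartP => i|apply/allP => i _]; have /andP[] := h i.
Qed.

Lemma hstrip_sub la mu : hstrip la mu -> subpart mu la.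
Proof. by case/andP. Qed.

Definition vstrip la mu := hstrip (transpose la) (transpose mu).

Lemma vstripP la mu :
  reflect (forall i, (prow mu i <= prow la i <= (prow mu i).+1)%N) (vstrip la mu).
Proof.
apply: (iffP idP) => [h i|h].
  have /hstrip_sub := h; rewrite subpart_transpose => /subpartP -> /=.
  rewrite leqNgt -lt_prow_transpose -leqNgt.
  have /hstripP/(_ (prow mu i))/andP[h1 _] := h.
  by rewrite (leq_trans h1)// leqNgt lt_prow_transpose ltnn.
have hs : subpart mu la by apply/subpartP => i; have /andP[] := h i.
apply/hstripP => j; apply/andP; split; last first.
  by move: hs; rewrite -subpart_transpose => /subpartP.
rewrite leqNgt lt_prow_transpose -leqNgt.
have /andP[_ /leq_trans] := h (prow (transpose mu) j); apply.
by rewrite ltnS leqNgt -lt_prow_transpose ltnn.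
Qed.

Lemma hstrip_transpose la mu : hstrip (transpose la) (transpose mu) = vstrip la mu.
Proof. by []. Qed.

Lemma vstrip_sub la mu : vstrip la mu -> subpart mu la.
Proof. by move/hstrip_sub; rewrite subpart_transpose. Qed.

Lemma hstrip_refl la : hstrip la la.
Proof. by apply/hstripP => i; rewrite leqnn prow_le. Qed.

End PartitionRows.

Section IndependentRows.
Variables (T : comNzRingType) (lo hi : nat -> nat) (N : nat).
Hypothesis hilo : forall i, (hi i.+1 <= lo i)%N.

Definition rows_between (la : part) :=
  all (fun i => lo i <= prow la i <= hi i)%N (iota 0 N) && (size la <= N)%N.

(* Any choice of rows in the intervals [lo i, hi i] is a partition. *)
Lemma sum_rows_between (s : seq part) (w : nat -> nat -> T) :
  uniq s -> (forall la, rows_between la -> la \in s) ->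
  \sum_(la <- s | rows_between la) \prod_(i < N) w i (prow la i) =
  \prod_(i < N) \sum_(lo i <= k < (hi i).+1) w i k.
Proof.
move=> us hs; pose m := \max_(i < N) hi i.
have him i : (i < N)%N -> (hi i <= m)%N.
  by move=> iN; apply: (leq_bigmax (Ordinal iN)).
pose W i (k : 'I_m.+1) := if (lo i <= k <= hi i)%N then w i k else 0.
have -> : \prod_(i < N) \sum_(lo i <= k < (hi i).+1) w i k =
    \prod_(i < N) \sum_(k : 'I_m.+1) W i k.
  apply: eq_bigr => i _; rewrite (big_nat_widen _ _ m.+1) ?ltnS ?him//.
  rewrite big_geq_mkord [LHS]big_mkcond /=; apply: eq_bigr => k _.
  by rewrite /W ltnS andbC.
rewrite bigA_distr_bigA /=.
pose ok (f : {ffun 'I_N -> 'I_m.+1}) := [forall i : 'I_N, (lo i <= f i <= hi i)%N].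
rewrite (bigID ok) /= [X in _ + X]big1 ?addr0; last first.
  move=> f; rewrite negb_forall => /existsP[i hi_]; rewrite (bigD1 i)//=.
  by rewrite /W (negPf hi_) mul0r.
pose ext (f : {ffun 'I_N -> 'I_m.+1}) i := if insub i is Some k then f k : nat else 0%N.
have extE f (i : 'I_N) : ext f i = f i by rewrite /ext insubT //= => h; congr (f _ : nat); apply: val_inj.
pose phi f := mkpart N (ext f).
have phiE f : ok f -> prow (phi f) =1 ext f.
  move=> /forallP h i; apply: prow_mkpart => {}i; last first.
    by rewrite leqNgt => iN; rewrite /ext insubN.
  rewrite /ext; case: insubP => [k _ ki|//]; case: insubP => [j _ ji|].
    have /andP[_ h1] := h k; have /andP[h2 _] := h j.
    by rewrite (leq_trans h1)// (leq_trans _ h2)// ki ji hilo.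
  by rewrite -leqNgt => iN; have := ltn_ord k; rewrite ki ltnNge leqW.
rewrite -big_filter.
transitivity (\sum_(la <- [seq phi f | f <- enum ok]) \prod_(i < N) w i (prow la i)).
  apply: perm_big; apply: uniq_perm; first by rewrite filter_uniq.
    rewrite map_inj_in_uniq ?enum_uniq// => f g; rewrite !mem_enum => okf okg fg.
    apply/ffunP => i; apply: val_inj; rewrite /= -!extE -!phiE//.
    by rewrite fg.
  move=> la; rewrite mem_filter; apply/andP/mapP => [[bla _]|[f]].
    have /andP[/allP h hN] := bla.
    have hlt (i : 'I_N) : (prow la i < m.+1)%N.
      have /h /andP[_ hhi] : (i : nat) \in iota 0 N by rewrite mem_iota ltn_ord.
      by rewrite ltnS (leq_trans hhi)// him.
    have okl : ok [ffun i => Ordinal (hlt i)].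
      by apply/forallP => i; rewrite ffunE /=; apply: h; rewrite mem_iota ltn_ord.
    exists [ffun i => Ordinal (hlt i)]; first by rewrite mem_enum.
    apply: part_ext => i; rewrite phiE// /ext; case: insubP => [k _ <-|]; first by rewrite ffunE.
    by rewrite -leqNgt => iN; rewrite prow_eq0// (leq_trans hN).
  rewrite mem_enum => okf ->.
  have bl : rows_between (phi f).
    apply/andP; split; last first.
      rewrite leqNgt -prow_gt0 phiE// /ext insubN ?ltnn//.
    apply/allP => i; rewrite mem_iota add0n => /andP[_ iN].
    by rewrite phiE// (extE f (Ordinal iN)); have /forallP := okf; apply.
  by split => //; apply: hs.
rewrite big_map big_enum_cond /=.
apply: congr_big => [//|f|f /andP[okf _]]; first by rewrite andbT.
apply: eq_bigr => i _; rewrite phiE// extE /W.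
by have /forallP -> := okf.
Qed.

End IndependentRows.

Section OneVariable.
Variable T : comNzRingType.
Implicit Types (la mu nu ka : part) (a b x : T).

(* The skew Schur function of one variable. *)
Definition hk x la mu : T :=
  if hstrip la mu then x ^+ (psize la - psize mu) else 0.

Definition vk x la mu : T := hk x (transpose la) (transpose mu).

Lemma vkE x la mu : vk x la mu = if vstrip la mu then x ^+ (psize la - psize mu) else 0.
Proof. by rewrite /vk /hk hstrip_transpose !psize_transpose. Qed.

Lemma exp_psizeB x la mu N : subpart mu la -> (size la <= N)%N ->
  x ^+ (psize la - psize mu) = \prod_(i < N) x ^+ (prow la i - prow mu i).
Proof.
move=> s lN; rewrite prodrXr; congr (_ ^+ _).
rewrite (psizeE lN) (psizeE (leq_trans (subpart_size s) lN)) -sumnB// => i _.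
by move/subpartP: s.
Qed.

(** * Cauchy identities in one variable *)

Section Dual.
Variables (a b : T) (mu nu : part).
Let N := (size mu + size nu).+1.
Let m i := prow mu i.
Let n i := prow nu i.
Let lo i := maxn (m i) (n i).
Let hi i := if i is j.+1 then minn (n i).+1 (m j) else (n i).+1.
Let lo' i := maxn (m i).-1 (n i.+1).
Let hi' i := minn (m i) (n i).
Let m0 i : (size mu <= i)%N -> m i = 0%N. Proof. exact: prow_eq0. Qed.
Let n0 i : (size nu <= i)%N -> n i = 0%N. Proof. exact: prow_eq0. Qed.
Let md i : (m i.+1 <= m i)%N. Proof. exact: prow_le. Qed.
Let nd i : (n i.+1 <= n i)%N. Proof. exact: prow_le. Qed.

Lemma rows_between_up la :
  rows_between lo hi N la = hstrip la mu && vstrip la nu.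
Proof.
apply/andP/andP => [[/allP h hN]|[/hstripP h /vstripP v]].
  have {}h i : (lo i <= prow la i <= hi i)%N.
    case: (ltnP i N) => iN; first by rewrite h// mem_iota.
    rewrite prow_eq0 ?(leq_trans hN)// andbT /lo m0 ?n0 ?maxnn//; first lia.
    by rewrite /N in iN; lia.
  split.
    apply/hstripP => i; have := h i; have := h i.+1; rewrite /lo /hi /m /n.
    by case: i => [|i]; lia.
  by apply/vstripP => -[|i]; [have := h 0%N|have := h i.+1]; rewrite /lo /hi /n; lia.
have sN : (size la <= N)%N.
  rewrite leqNgt; apply/negP; rewrite -prow_gt0.
  have := h (size mu + size nu)%N; have := m0 (i := (size mu + size nu)%N) (leq_addr _ _).
  by rewrite /m /N; lia.
split => //; apply/allP => i _; rewrite /lo /hi /m /n.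
by case: i => [|i]; [have := h 0%N; have := v 0%N|have := h i; have := h i.+1; have := v i.+1]; lia.
Qed.

Lemma rows_between_down ka :
  rows_between lo' hi' N ka = vstrip mu ka && hstrip nu ka.
Proof.
apply/andP/andP => [[/allP h hN]|[/vstripP v /hstripP h]].
  have {}h i : (lo' i <= prow ka i <= hi' i)%N.
    case: (ltnP i N) => iN; first by rewrite h// mem_iota.
    rewrite prow_eq0 ?(leq_trans hN)// andbT /lo' m0 ?n0 ?maxnn//; rewrite /N in iN; lia.
  by split; [apply/vstripP|apply/hstripP] => j; have := h j; rewrite /lo' /hi' /m /n; lia.
split.
  by apply/allP => i _; rewrite /lo' /hi' /m /n; have := h i; have := v i; lia.
rewrite leqNgt; apply/negP; rewrite -prow_gt0; have := v N; have := m0 (i := N).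
by rewrite /m /N; lia.
Qed.

Let S i := \sum_(lo i <= k < (hi i).+1) a ^+ (k - m i) * b ^+ (k - n i).
Let S' i := \sum_(lo' i <= k < (hi' i).+1) b ^+ (m i - k) * a ^+ (n i - k).

Lemma dual_rows : \prod_(i < N) S i = (1 + a * b) * \prod_(i < N) S' i.
Proof.
have S0 i : (i < N)%N -> (hi i < lo i)%N -> \prod_(i < N) S i = 0.
  by move=> iN h; rewrite (bigD1 (Ordinal iN))//= /S big_geq ?mul0r.
have S'0 i : (i < N)%N -> (hi' i < lo' i)%N -> \prod_(i < N) S' i = 0.
  by move=> iN h; rewrite (bigD1 (Ordinal iN))//= /S' big_geq ?mul0r.
have hilt i : (hi i <= (n i).+1)%N by case: i => [|i]; rewrite /hi ?geq_minl.
have [H1|] := pselect (forall i, m i <= (n i).+1)%N; last first.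
  move=> /existsNP[i /negP]; rewrite -ltnNge => h1.
  have iN : (i < N)%N.
    rewrite ltnNge; apply/negP => iN; move: h1; rewrite m0 ?ltn0//.
    by rewrite (leq_trans _ iN)// /N leqW// leq_addr.
  rewrite (S0 i)// ?(S'0 i)// ?mulr0// /lo' /lo /hi'.
    by rewrite gtn_min leq_max; lia.
  by rewrite leq_max (leq_ltn_trans (hilt i)).
have [H2|] := pselect (forall i, n i.+1 <= m i)%N; last first.
  move=> /existsNP[i /negP]; rewrite -ltnNge => h1.
  have iN : (i.+1 < N)%N.
    rewrite ltnNge; apply/negP => iN; move: h1; rewrite n0 ?ltn0//.
    by rewrite (leq_trans _ iN)// /N leqW// leq_addl.
  rewrite (S0 i.+1)// ?(S'0 i)// ?mulr0 ?(ltnW iN)// /lo' /lo /hi' /hi.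
    by rewrite gtn_min (leq_trans h1)// leq_maxr.
  by rewrite gtn_min [X in _ || X](leq_trans h1) ?orbT// leq_maxr.
pose g i := if m i == (n i).+1 then b else a ^+ (n i - m i).
pose pm i := if i is j.+1 then m j else (n i).+1.
have hiE i : hi i = minn (n i).+1 (pm i) by case: i => [|i]; rewrite /hi /pm ?minnn.
have npm i : (n i <= pm i)%N by case: i => [|i]; rewrite /pm.
have mpm i : (m i <= pm i)%N by case: i => [|i]; rewrite /pm.
pose f i : nat := (m i <= n i)%N && (n i < pm i)%N.
pose f' i : nat := (m i <= n i)%N && (n i.+1 < m i)%N.
have SE i : S i = g i * (1 + a * b) ^+ f i.
  have hlo : lo i = if m i == (n i).+1 then (n i).+1 else n i.
    by rewrite /lo; case: eqP (H1 i) => [->|]; lia.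
  rewrite /S /g /f hlo; case: eqP => [mn|mn].
    have -> : hi i = (n i).+1 by rewrite hiE; have := mpm i; lia.
    by rewrite big_nat1 mn subnn subSn// subnn ltnn expr0 !mul1r mulr1.
  have mn' : (m i <= n i)%N by have := H1 i; lia.
  rewrite mn' /=; case: (ltnP (n i) (pm i)) => fi.
    have -> : hi i = (n i).+1 by rewrite hiE; lia.
    rewrite big_ltn ?leqnSn// big_nat1 subnn expr0 !subSn// subnn exprS expr1; ring.
  have -> : hi i = n i by rewrite hiE; have := npm i; lia.
  by rewrite big_nat1 subnn.
have S'E i : S' i = g i * (1 + a * b) ^+ f' i.
  rewrite /S' /g /f'; case: eqP => [mn|mn].
    have -> : hi' i = n i by rewrite /hi'; lia.
    have -> : lo' i = n i by rewrite /lo'; have := nd i; lia.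
    by rewrite big_nat1 mn subnn subSn// subnn ltnn expr0 !mulr1.
  have mn' : (m i <= n i)%N by have := H1 i; lia.
  have -> : hi' i = m i by rewrite /hi'; lia.
  rewrite mn' /=; case: (ltnP (n i.+1) (m i)) => fi.
    have [k mk] : exists k, m i = k.+1 by exists (m i).-1; lia.
    have -> : lo' i = k by rewrite /lo' mk; lia.
    rewrite mk in fi mn' *; rewrite big_ltn ?leqnSn// big_nat1 subnn expr0 subSnn.
    rewrite (_ : n i - k = (n i - k.+1).+1)%N ?exprS; last by lia.
    ring.
  have -> : lo' i = m i by rewrite /lo'; have := H2 i; lia.
  by rewrite big_nat1 subnn expr0 mul1r mulr1.
rewrite (eq_bigr _ (fun (i : 'I_N) _ => SE i)) (eq_bigr _ (fun (i : 'I_N) _ => S'E i)).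
rewrite !big_split /= mulrCA; congr (_ * _).
rewrite !prodrXr -exprS; congr (_ ^+ _).
pose Bm k : nat := if k is j.+1 then n k == m j else false.
suff H k : (\sum_(i < k) f i = \sum_(i < k) f' i + Bm k)%N.
  by rewrite H /Bm {2}/N /= m0 ?leq_addr// n0 ?addn1// ltnW// ltnS leq_addl.
elim: k => [|k IH]; first by rewrite !big_ord0.
rewrite !big_ord_recr /= IH /f /f' /Bm /pm.
rewrite -!addnA; congr (_ + _)%N; case: k {IH} => [|k] /=.
  have := H2 0%N; have := H1 0%N; have := nd 0%N.
  by case: (ltngtP (n 1) (m 0%N)); case: (leqP (m 0%N) (n 0%N)); lia.
have := H2 k; have := H2 k.+1; have := H1 k.+1; have := md k; have := nd k.+1.
case: (ltngtP (n k.+1) (m k)); case: (ltngtP (n k.+2) (m k.+1));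
  case: (leqP (m k.+1) (n k.+1)); lia.
Qed.

Lemma dual_cauchy_one (s : seq part) : uniq s ->
  (forall la, hstrip la mu -> vstrip la nu -> la \in s) ->
  \sum_(la <- s) hk a la mu * vk b la nu =
  (1 + a * b) * \sum_(ka <- subs mu) vk b mu ka * hk a nu ka.
Proof.
move=> us hs.
transitivity (\sum_(la <- s | rows_between lo hi N la)
   \prod_(i < N) (a ^+ (prow la i - m i) * b ^+ (prow la i - n i))).
  rewrite [RHS]big_mkcond; apply: eq_bigr => la _; rewrite vkE /hk.
  case: (boolP (rows_between lo hi N la)).
    move=> bt; have := bt; rewrite rows_between_up => /andP[h v]; rewrite h v.
    have /andP[_ sN] := bt.
    by rewrite big_split /= -(exp_psizeB _ (hstrip_sub h) sN) -(exp_psizeB _ (vstrip_sub v) sN).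
  by rewrite rows_between_up negb_and => /orP[] /negPf ->; rewrite ?mul0r ?mulr0.
rewrite (@sum_rows_between T lo hi N _ s (fun i k => a ^+ (k - m i) * b ^+ (k - n i)))//; first last.
- by move=> la; rewrite rows_between_up => /andP[]; exact: hs.
- by move=> i; rewrite /hi /lo; lia.
rewrite dual_rows; congr (_ * _).
transitivity (\sum_(ka <- subs mu | rows_between lo' hi' N ka)
   \prod_(i < N) (b ^+ (m i - prow ka i) * a ^+ (n i - prow ka i))).
  rewrite (@sum_rows_between T lo' hi' N _ (subs mu) (fun i k => b ^+ (m i - k) * a ^+ (n i - k))) ?subs_uniq//.
  - by move=> i; rewrite /hi' /lo'; lia.
  - by move=> ka; rewrite rows_between_down mem_subs => /andP[/vstrip_sub].
rewrite [LHS]big_mkcond; apply: eq_bigr => ka _; rewrite vkE /hk.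
case: (boolP (rows_between lo' hi' N ka)).
  rewrite rows_between_down => /andP[v h]; rewrite h v.
  have muN : (size mu <= N)%N by rewrite /N leqW// leq_addr.
  have nuN : (size nu <= N)%N by rewrite /N leqW// leq_addl.
  by rewrite big_split /= -(exp_psizeB _ (vstrip_sub v) muN) -(exp_psizeB _ (hstrip_sub h) nuN).
by rewrite rows_between_down negb_and => /orP[] /negPf ->; rewrite ?mul0r ?mulr0.
Qed.

End Dual.
End OneVariable.

Section InterlacingBijection.
Variables mu nu : part.
Implicit Types (la ka : part).
Let N := (size mu + size nu)%N.
Let m i := prow mu i.
Let n i := prow nu i.
Let mx i := maxn (m i) (n i).
Let mn i := minn (m i) (n i).
Let m0 i : (N <= i)%N -> m i = 0%N.
Proof. by move=> h; rewrite /m prow_eq0// (leq_trans _ h)// leq_addr. Qed.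
Let n0 i : (N <= i)%N -> n i = 0%N.
Proof. by move=> h; rewrite /n prow_eq0// (leq_trans _ h)// leq_addl. Qed.
Let md i : (m i.+1 <= m i)%N. Proof. exact: prow_le. Qed.
Let nd i : (n i.+1 <= n i)%N. Proof. exact: prow_le. Qed.

Definition above la := hstrip la mu && hstrip la nu.
Definition below (x : part * nat) := hstrip mu x.1 && hstrip nu x.1.

(* The row by row bijection of the Cauchy identity in one variable. *)
Definition go_up (x : part * nat) : part :=
  mkpart N.+1 (fun i => if i is j.+1 then mx i + mn j - prow x.1 j
                        else mx 0 + x.2)%N.
Definition go_down la : part * nat :=
  (mkpart N (fun i => mx i.+1 + mn i - prow la i.+1)%N, prow la 0 - mx 0)%N.

Lemma belowP x : below x -> forall i, (mx i.+1 <= prow x.1 i <= mn i)%N.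
Proof.
move=> /andP[/hstripP h1 /hstripP h2] i.
by rewrite /mx /mn geq_max leq_min; have /andP[-> ->] := h1 i; have /andP[-> ->] := h2 i.
Qed.

Lemma aboveP la : above la ->
  forall i, (mx i <= prow la i)%N /\ (prow la i.+1 <= mn i)%N.
Proof.
move=> /andP[/hstripP h1 /hstripP h2] i.
by rewrite /mx /mn geq_max leq_min; have /andP[-> ->] := h1 i; have /andP[-> ->] := h2 i.
Qed.

Lemma prow_up x : below x -> forall i, prow (go_up x) i =
  (if i is j.+1 then mx i + mn j - prow x.1 j else mx 0 + x.2)%N.
Proof.
move=> /belowP h i; rewrite prow_mkpart// => {}i.
  by case: i => [|i]; [have := h 0%N|have := h i; have := h i.+1]; rewrite /mx /mn; lia.
by case: i => [//|i] hi; rewrite /mx /mn !m0 ?n0// leqW.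
Qed.

Lemma prow_down la : above la ->
  forall i, prow (go_down la).1 i = (mx i.+1 + mn i - prow la i.+1)%N.
Proof.
move=> /aboveP h i; rewrite prow_mkpart// => {}i.
  by have [] := h i.+1; have [] := h i; have [] := h i.+2; rewrite /mx /mn; lia.
by move=> hi; rewrite /mx /mn !m0 ?n0// leqW.
Qed.

Lemma go_upP x : below x -> above (go_up x) /\ go_down (go_up x) = x.
Proof.
move=> bx; have h := belowP bx; have hr := prow_up bx.
have ab : above (go_up x).
  by apply/andP; split; apply/hstripP => i; rewrite !hr;
    (case: i => [|i]; [have := h 0%N|have := h i; have := h i.+1]); rewrite /mx /mn /m /n; lia.
split=> //; case: x bx h hr ab => ka d bx h hr ab; congr (_, _).
  by apply: part_ext => i; rewrite prow_down// hr /=; have := h i => /=; lia.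
by rewrite hr addKn.
Qed.

Lemma go_downP la : above la -> below (go_down la) /\ go_up (go_down la) = la.
Proof.
move=> al; have h := aboveP al; have hr := prow_down al.
have bl : below (go_down la).
  by apply/andP; split; apply/hstripP => i; rewrite hr; have [] := h i; have [] := h i.+1;
    rewrite /mx /mn /m /n; lia.
split=> //; apply: part_ext => i; rewrite prow_up//.
by case: i => [|i]; rewrite ?hr /=; [have [] := h 0%N|have [] := h i; have [] := h i.+1]; lia.
Qed.

Lemma psize_up x : below x ->
  (psize (go_up x) + psize x.1 = psize mu + psize nu + x.2)%N.
Proof.
move=> bx; have h := belowP bx.
have /andP[/hstrip_sub s1 _] := bx.
have sz : (size (go_up x) <= N.+1)%N.
  by rewrite leqNgt -prow_gt0 prow_up// /mx /mn !m0 ?n0.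
rewrite (psizeE sz) (@psizeE x.1 N); last by rewrite (leq_trans (subpart_size s1))// leq_addr.
rewrite (@psizeE mu N.+1) ?leqW ?leq_addr// (@psizeE nu N.+1) ?leqW ?leq_addl//.
rewrite -big_split /= big_ord_recl prow_up//.
have -> : (\sum_(i < N) prow (go_up x) (lift ord0 i) =
    \sum_(i < N) (mx i.+1 + mn i - prow x.1 i))%N.
  by apply: eq_bigr => i _; rewrite prow_up.
rewrite -addnA -big_split /=.
rewrite (eq_bigr (fun i : 'I_N => mx i.+1 + mn i)%N); last first.
  by move=> i _; have := h i; lia.
have E : (\sum_(i < N.+1) (prow mu i + prow nu i) = \sum_(i < N.+1) mx i + \sum_(i < N.+1) mn i)%N.
  by rewrite -big_split /=; apply: eq_bigr => i _; rewrite /mx /mn /m /n; lia.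
rewrite E [X in _ = (X + _ + _)%N]big_ord_recl [X in _ = (_ + X + _)%N]big_ord_recr /=.
rewrite {3}/mn m0// n0// minnn addn0 big_split /= /bump /=.
under [X in _ = (_ + X + _ + _)%N]eq_bigr do rewrite add1n.
lia.
Qed.

Section Weights.
Variable T : comNzRingType.
Variables a b : T.

Lemma weight_up x : below x ->
  hk a (go_up x) mu * hk b (go_up x) nu =
  (a * b) ^+ x.2 * (hk b mu x.1 * hk a nu x.1).
Proof.
move=> bx; have [/andP[u1 u2] _] := go_upP bx; have /andP[b1 b2] := bx.
rewrite /hk u1 u2 b1 b2; have := psize_up bx.
have := subpart_psize (hstrip_sub u1); have := subpart_psize (hstrip_sub u2).
have := subpart_psize (hstrip_sub b1); have := subpart_psize (hstrip_sub b2).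
move=> h1 h2 h3 h4 h.
have -> : (psize (go_up x) - psize mu = psize nu - psize x.1 + x.2)%N by lia.
have -> : (psize (go_up x) - psize nu = psize mu - psize x.1 + x.2)%N by lia.
rewrite !exprD exprMn; ring.
Qed.

Lemma weight_above la : ~~ above la -> hk a la mu * hk b la nu = 0.
Proof. by rewrite negb_and /hk => /orP[] /negPf ->; rewrite ?mul0r ?mulr0. Qed.

Lemma weight_below x : ~~ below x -> hk b mu x.1 * hk a nu x.1 = 0.
Proof. by rewrite negb_and /hk => /orP[] /negPf ->; rewrite ?mul0r ?mulr0. Qed.

Lemma weight_down_subs ka : ka \notin subs mu -> hk b mu ka * hk a nu ka = 0.
Proof.
rewrite mem_subs => h; rewrite /hk ifN ?mul0r//.
by apply: contraNN h => /hstrip_sub.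
Qed.

End Weights.

Section Sums.
Variable R : realType.

Lemma hk_ge0 (x : R) la ka : 0 <= x -> 0 <= hk x la ka.
Proof. by move=> x0; rewrite /hk; case: ifP => // _; rewrite exprn_ge0. Qed.

Let pair_bdd (a b : R) : 0 <= a -> 0 <= b -> a * b < 1 ->
  sum_bdd (fun x : part * nat => (a * b) ^+ x.2 * (hk b mu x.1 * hk a nu x.1))
    ((1 - a * b)^-1 * \sum_(ka <- subs mu) hk b mu ka * hk a nu ka).
Proof.
move=> a0 b0 ab1; have ab : 0 <= a * b < 1 by rewrite mulr_ge0.
have W0 ka : 0 <= hk b mu ka * hk a nu ka by rewrite mulr_ge0 ?hk_ge0.
apply: (sum_bdd_pair (B := fun ka => (1 - a * b)^-1 * (hk b mu ka * hk a nu ka))).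
- by move=> x; rewrite mulr_ge0// exprn_ge0// mulr_ge0.
- move=> ka s us; rewrite /= -mulr_suml ler_wpM2r// geometric_bdd//.
- move=> s us; rewrite -mulr_sumr ler_wpM2l ?invr_ge0 ?subr_ge0 ?(ltW ab1)//.
  rewrite (bigID (fun ka => ka \in subs mu)) /= [X in _ + X]big1 ?addr0; last first.
    by move=> ka /weight_down_subs ->.
  rewrite -big_filter [leRHS](bigID (fun ka => ka \in s)) /= -[leLHS]addr0 lerD//; last first.
    by rewrite sumr_ge0.
  rewrite -[leRHS]big_filter le_eqVlt; apply/orP; left; apply/eqP/perm_big.
  apply: uniq_perm; [by rewrite filter_uniq|by rewrite filter_uniq ?subs_uniq|move=> ka].
  by rewrite !mem_filter andbC.
Qed.

Lemma cauchy_one_bdd (a b : R) : 0 <= a -> 0 <= b -> a * b < 1 ->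
  sum_bdd (fun la => hk a la mu * hk b la nu)
    ((1 - a * b)^-1 * \sum_(ka <- subs mu) hk b mu ka * hk a nu ka).
Proof.
move=> a0 b0 ab1 s us; rewrite (bigID above) /= [X in _ + X]big1 ?addr0; last first.
  by move=> la; exact: weight_above.
have := pair_bdd a0 b0 ab1 (s := [seq go_down la | la <- s & above la]).
rewrite big_map map_inj_in_uniq ?filter_uniq//; last first.
  move=> x y; rewrite !mem_filter => /andP[ax _] /andP[ay _] e.
  by rewrite -(go_downP ax).2 -(go_downP ay).2 e.
move=> /(_ isT); apply: le_trans; rewrite big_filter.
rewrite le_eqVlt; apply/orP; left; apply/eqP; apply: eq_bigr => la al.
by have [bl] := go_downP al; rewrite -weight_up// => ->.
Qed.

Variable K : completeValuedField R.

Lemma vnorm_hk (x : K) la ka : vnorm (hk x la ka) = hk (vnorm x) la ka.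
Proof. by rewrite /hk; case: ifP; rewrite ?vnormX ?vnorm0. Qed.

Lemma has_usum_geometric (q : K) : vnorm q < 1 ->
  has_usum (fun d => q ^+ d) (1 - q)^-1.
Proof.
move=> q1; have q01 : 0 <= vnorm q < 1 by rewrite vnorm_ge0.
have [s hs] : exists s, has_usum (fun d => q ^+ d) s.
  by apply: (has_usum_ex (B := (1 - vnorm q)^-1)); apply: sum_bdd_le (geometric_bdd q01) => d; rewrite vnormX.
have q0 : 1 - q != 0.
  by rewrite subr_eq0; apply/eqP => e; move: q1; rewrite -e vnorm1 ltxx.
suff -> : (1 - q)^-1 = s by [].
apply: (mulfI q0); rewrite divff//.
apply: (@kcvg_unique _ _ (fun n => 1 - q ^+ n)).
  by have := kcvgD (kcvg_cst 1) (kcvgM (kcvg_cst (-1)) (kcvg_geometric q1));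
    rewrite mulr0 addr0; apply: eq_kcvg => k; rewrite mulN1r.
apply: eq_kcvg (kcvgM (kcvg_cst (1 - q)) (has_usum_nat hs)) => k.
by rewrite big_mkord -[1 - q]opprB mulNr -subrX1 opprB.
Qed.

Lemma cauchy_one (a b : K) : vnorm a * vnorm b < 1 ->
  has_usum (fun la => hk a la mu * hk b la nu)
    ((1 - a * b)^-1 * \sum_(ka <- subs mu) hk b mu ka * hk a nu ka).
Proof.
move=> ab1; have q1 : vnorm (a * b) < 1 by rewrite vnormM.
pose F (x : part * nat) := (a * b) ^+ x.2 * (hk b mu x.1 * hk a nu x.1).
have bF : sumlim F ((1 - vnorm a * vnorm b)^-1 *
    \sum_(ka <- subs mu) hk (vnorm b) mu ka * hk (vnorm a) nu ka).
  apply: sum_bdd_le (pair_bdd (vnorm_ge0 a) (vnorm_ge0 b) ab1) => x.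
  by rewrite /F !vnormM vnormX vnormM !vnorm_hk.
have [S hS] := has_usum_ex bF.
have hrow ka : has_usum (fun d => F (ka, d)) ((1 - a * b)^-1 * (hk b mu ka * hk a nu ka)).
  rewrite mulrC; apply: eq_has_usum (has_usumZ _ (has_usum_geometric q1)) => d.
  by rewrite mulrC.
have h1 := has_usum_pair hrow hS.
have h2 : has_usum (fun ka => (1 - a * b)^-1 * (hk b mu ka * hk a nu ka))
    (\sum_(ka <- subs mu) (1 - a * b)^-1 * (hk b mu ka * hk a nu ka)).
  apply: has_usum_fin (subs_uniq mu) _ => ka /weight_down_subs ->.
  by rewrite mulr0.
rewrite mulr_sumr (has_usum_unique h2 h1).
have hF : has_usum (fun x => if below x then F x else 0) S.
  apply: eq_has_usum hS => x; case: ifPn => // /weight_below h.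
  by rewrite /F h mulr0.
apply: eq_has_usum (has_usum_reindex (Q := above) go_downP go_upP hF) => la.
case: ifPn => [al|/weight_above ->//].
by have [bl] := go_downP al; rewrite /F -weight_up// => ->.
Qed.

End Sums.
End InterlacingBijection.

(** * Commutation relations and normal ordering *)

Section LowerKernels.
Variables (R : realType) (K : completeValuedField R).
Implicit Types (la mu nu ka : part).

Lemma sum_subs_wide (T : nmodType) ka mu (F : part -> T) : subpart ka mu ->
  (forall s, ~~ subpart s ka -> F s = 0) ->
  \sum_(s <- subs ka) F s = \sum_(s <- subs mu) F s.
Proof.
move=> km F0; rewrite [RHS](bigID (subpart^~ ka)) /= [X in _ + X]big1 ?addr0//.
rewrite -[RHS]big_filter; apply: perm_big; apply: uniq_perm => [||s].
- exact: subs_uniq.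
- by rewrite filter_uniq ?subs_uniq.
- rewrite mem_subs mem_filter mem_subs; case: (boolP (subpart s ka)) => //= h.
  by rewrite (subpart_trans h km).
Qed.

Lemma sum_subs_swap (T : nmodType) nu mu (F : part -> T) :
  (forall s, ~~ (subpart s nu && subpart s mu) -> F s = 0) ->
  \sum_(s <- subs nu) F s = \sum_(s <- subs mu) F s.
Proof.
move=> F0; rewrite (bigID (subpart^~ mu)) /= [X in _ + X]big1 ?addr0; last first.
  by move=> s h; rewrite F0// (negPf h) andbF.
rewrite [RHS](bigID (subpart^~ nu)) /= [X in _ = _ + X]big1 ?addr0; last first.
  by move=> s h; rewrite F0// (negPf h).
rewrite -[LHS]big_filter -[RHS]big_filter; apply: perm_big; apply: uniq_perm => [||s].
- by rewrite filter_uniq ?subs_uniq.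
- by rewrite filter_uniq ?subs_uniq.
- by rewrite [LHS]mem_filter [RHS]mem_filter !mem_subs andbC.
Qed.

(* A kernel A(la, mu), supported on mu contained in la, with a bound lb for
   its norm. *)
Record tker := TKer {
  lk : part -> part -> K;
  lb : part -> part -> R;
  lk_sub : forall la mu, ~~ subpart mu la -> lk la mu = 0;
  lb_sub : forall la mu, ~~ subpart mu la -> lb la mu = 0;
  lk_le : forall la mu, vnorm (lk la mu) <= lb la mu }.
Implicit Types A B L : tker.

Lemma lb_ge0 A la mu : 0 <= lb A la mu.
Proof. exact: le_trans (vnorm_ge0 _) (lk_le A la mu). Qed.

(* The commutation relation between the annihilation operator
   sum A(la, mu) |mu><la| and the creation operator sum B(la, mu) |la><mu|. *)
Definition comm A B (c : K) (cb : R) := forall mu nu,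
  sum_bdd (fun la => lb A la mu * lb B la nu)
    (cb * \sum_(ka <- subs mu) lb B mu ka * lb A nu ka) /\
  has_usum (fun la => lk A la mu * lk B la nu)
    (c * \sum_(ka <- subs mu) lk B mu ka * lk A nu ka).

Lemma comm_sym A B c cb : comm A B c cb -> comm B A c cb.
Proof.
move=> h mu nu; have [h1 h2] := h nu mu; split.
  rewrite (@sum_subs_swap _ mu nu); last first.
    by move=> s; rewrite negb_and => /orP[] /lb_sub ->; rewrite ?mul0r ?mulr0.
  under eq_bigr do rewrite mulrC.
  by apply: sum_bdd_le h1 => la; rewrite mulrC.
rewrite (@sum_subs_swap _ mu nu); last first.
  by move=> s; rewrite negb_and => /orP[] /lk_sub ->; rewrite ?mul0r ?mulr0.
under eq_bigr do rewrite mulrC.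
by apply: eq_has_usum h2 => la; rewrite mulrC.
Qed.

Definition keq A B := lk A =2 lk B /\ lb A =2 lb B.

Lemma keq_sym A B : keq A B -> keq B A.
Proof. by move=> [h1 h2]; split=> la mu; rewrite ?h1 ?h2. Qed.

Lemma keq_comm A A' B B' c cb : keq A A' -> keq B B' -> comm A B c cb -> comm A' B' c cb.
Proof.
move=> [a1 a2] [b1 b2] h mu nu; have [h1 h2] := h mu nu; split.
  under eq_bigr do rewrite -b2 -a2.
  by apply: sum_bdd_le h1 => la; rewrite a2 b2.
under eq_bigr do rewrite -b1 -a1.
by apply: eq_has_usum h2 => la; rewrite a1 b1.
Qed.

Section Mul.
Variables A B : tker.

Let mk la mu := \sum_(nu <- subs la) lk A la nu * lk B nu mu.
Let mb la mu := \sum_(nu <- subs la) lb A la nu * lb B nu mu.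

Let mk_sub la mu : ~~ subpart mu la -> mk la mu = 0.
Proof.
move=> h; rewrite /mk big_seq big1// => nu; rewrite mem_subs => nl.
by rewrite (@lk_sub B) ?mulr0//; apply: contraNN h => mn; exact: subpart_trans nl.
Qed.

Let mb_sub la mu : ~~ subpart mu la -> mb la mu = 0.
Proof.
move=> h; rewrite /mb big_seq big1// => nu; rewrite mem_subs => nl.
by rewrite (@lb_sub B) ?mulr0//; apply: contraNN h => mn; exact: subpart_trans nl.
Qed.

Let mk_le la mu : vnorm (mk la mu) <= mb la mu.
Proof.
rewrite (le_trans (vnorm_sum _ _ _))// ler_sum// => nu _.
by rewrite vnormM ler_pM ?vnorm_ge0 ?lk_le.
Qed.

Definition lmul : tker := TKer mk_sub mb_sub mk_le.
End Mul.

Lemma delta_sub (T : nzSemiRingType) la mu : ~~ subpart mu la -> (la == mu)%:R = 0 :> T.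
Proof. by case: eqP => // ->; rewrite subpart_refl. Qed.

Lemma delta_le la mu : vnorm ((la == mu)%:R : K) <= (la == mu)%:R.
Proof. by case: eqP => _; rewrite ?vnorm1 ?vnorm0. Qed.

Definition lone : tker := TKer (@delta_sub _) (@delta_sub _) delta_le.

Lemma comm_mulr A B B' c cb c' cb' : 0 <= cb ->
  comm A B c cb -> comm A B' c' cb' -> comm A (lmul B B') (c * c') (cb * cb').
Proof.
move=> cb0 h h' mu nu.
have Eb : cb * cb' * (\sum_(ka <- subs mu) lb (lmul B B') mu ka * lb A nu ka) =
   \sum_(ka <- subs mu) cb * lb B mu ka *
     (cb' * \sum_(s <- subs ka) lb B' ka s * lb A nu s).
  rewrite /= mulr_sumr; under [LHS]eq_bigr do rewrite mulr_suml mulr_sumr.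
  rewrite exchange_big /= [LHS]big_seq [RHS]big_seq; apply: eq_bigr => ka.
  rewrite mem_subs => km; rewrite (sum_subs_wide km); last first.
    by move=> s /lb_sub ->; rewrite mul0r.
  by rewrite !mulr_sumr; apply: eq_bigr => s _; ring.
have Ek : c * c' * (\sum_(ka <- subs mu) lk (lmul B B') mu ka * lk A nu ka) =
   \sum_(ka <- subs mu) c * lk B mu ka *
     (c' * \sum_(s <- subs ka) lk B' ka s * lk A nu s).
  rewrite /= mulr_sumr; under [LHS]eq_bigr do rewrite mulr_suml mulr_sumr.
  rewrite exchange_big /= [LHS]big_seq [RHS]big_seq; apply: eq_bigr => ka.
  rewrite mem_subs => km; rewrite (sum_subs_wide km); last first.
    by move=> s /lk_sub ->; rewrite mul0r.
  by rewrite !mulr_sumr; apply: eq_bigr => s _; ring.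
have bd : sum_bdd (fun p : part * part => lb A p.2 mu * lb B p.2 p.1 * lb B' p.1 nu)
    (cb * cb' * (\sum_(ka <- subs mu) lb (lmul B B') mu ka * lb A nu ka)).
  apply: (sum_bdd_pair (B := fun rho =>
     (cb * \sum_(ka <- subs mu) lb B mu ka * lb A rho ka) * lb B' rho nu)).
  - by move=> p; rewrite !mulr_ge0 ?lb_ge0.
  - move=> rho s us /=; rewrite -mulr_suml ler_wpM2r ?lb_ge0//.
    exact: (h mu rho).1 us.
  move=> s us; rewrite Eb.
  under eq_bigr do rewrite mulr_sumr mulr_suml.
  rewrite exchange_big /= ler_sum// => ka _.
  under eq_bigr do rewrite mulrA -mulrA.
  rewrite -mulr_sumr ler_wpM2l ?mulr_ge0 ?lb_ge0//.
  exact: (h' ka nu).1 us.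
have finb la : lb A la mu * lb (lmul B B') la nu =
    \sum_(rho <- subs la) lb A la mu * lb B la rho * lb B' rho nu.
  by rewrite /= mulr_sumr; apply: eq_bigr => rho _; rewrite mulrA.
split.
  move=> s us; apply: (@le_trans _ _
    (\sum_(p <- [seq (rho, la) | la <- s, rho <- subs la]) lb A p.2 mu * lb B p.2 p.1 * lb B' p.1 nu)).
    by rewrite big_allpairs_dep /= ler_sum// => la _; rewrite finb.
  apply: bd; apply: allpairs_uniq_dep => // [la _|[x y] [x' y'] _ _ /= [-> ->]//].
  exact: subs_uniq.
rewrite Ek.
apply: (@has_usum_exchange _ _ _ _
  (fun rho la => lk A la mu * lk B la rho * lk B' rho nu)
  (fun rho => (c * \sum_(ka <- subs mu) lk B mu ka * lk A rho ka) * lk B' rho nu) _ _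
  (cb * cb' * (\sum_(ka <- subs mu) lb (lmul B B') mu ka * lb A nu ka))).
- apply: sum_bdd_le bd => p; rewrite !vnormM.
  by rewrite ler_pM ?mulr_ge0 ?vnorm_ge0 ?lk_le// ler_pM ?vnorm_ge0 ?lk_le.
- move=> rho; rewrite mulrC; apply: eq_has_usum (has_usumZ _ (h mu rho).2) => la.
  by rewrite mulrC.
- move=> la; rewrite [X in has_usum _ X](_ : _ = \sum_(rho <- subs la) lk A la mu * lk B la rho * lk B' rho nu).
    apply: has_usum_fin (subs_uniq la) _ => rho; rewrite mem_subs => /lk_sub ->.
    by rewrite mulr0 mul0r.
  by rewrite /= mulr_sumr; apply: eq_bigr => rho _; rewrite mulrA.
apply: (eq_has_usum (F := fun rho => \sum_(ka <- subs mu)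
   c * lk B mu ka * (lk A rho ka * lk B' rho nu))).
  move=> rho; rewrite mulr_sumr mulr_suml; apply: eq_bigr => ka _; ring.
apply: has_usum_sum => ka _; apply: has_usumZ; exact: (h' ka nu).2.
Qed.

Lemma comm_mull A A' B c cb c' cb' : 0 <= cb ->
  comm A B c cb -> comm A' B c' cb' -> comm (lmul A A') B (c * c') (cb * cb').
Proof. by move=> cb0 h h'; apply: comm_sym; apply: comm_mulr => //; exact: comm_sym. Qed.

Lemma comm_loner A : comm A lone 1 1.
Proof.
move=> mu nu.
have Ek : 1 * \sum_(ka <- subs mu) lk lone mu ka * lk A nu ka = lk A nu mu.
  rewrite mul1r (big_rem mu) ?mem_subs ?subpart_refl//= eqxx mul1r big_seq big1 ?addr0// => ka.
  by rewrite rem_filter ?subs_uniq// mem_filter => /andP[/= /negPf]; rewrite eq_sym => ->; rewrite mul0r.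
have Eb : 1 * \sum_(ka <- subs mu) lb lone mu ka * lb A nu ka = lb A nu mu.
  rewrite mul1r (big_rem mu) ?mem_subs ?subpart_refl//= eqxx mul1r big_seq big1 ?addr0// => ka.
  by rewrite rem_filter ?subs_uniq// mem_filter => /andP[/= /negPf]; rewrite eq_sym => ->; rewrite mul0r.
split.
  rewrite Eb => s us; case: (boolP (nu \in s)) => ns.
    rewrite (big_rem nu)//= eqxx mulr1 big_seq big1 ?addr0// => ka.
    by rewrite rem_filter// mem_filter => /andP[/= /negPf ->]; rewrite mulr0.
  rewrite big_seq big1 ?lb_ge0// => la ls /=; case: eqP => [e|_]; last by rewrite mulr0.
  by rewrite -e ls in ns.
rewrite Ek; have := @has_usum1 _ _ _ (fun la => lk A la mu * lk lone la nu) nu.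
rewrite /= eqxx mulr1; apply => la /negPf ->; by rewrite mulr0.
Qed.

Definition lprod (s : seq tker) : tker := foldr lmul lone s.

Lemma comm_lprod (T U : eqType) (fA : T -> tker) (fB : U -> tker) (s : seq T) (t : seq U)
    (c : T -> U -> K) (cb : T -> U -> R) :
  (forall x y, 0 <= cb x y) ->
  (forall x y, x \in s -> y \in t -> comm (fA x) (fB y) (c x y) (cb x y)) ->
  comm (lprod (map fA s)) (lprod (map fB t))
    (\prod_(x <- s) \prod_(y <- t) c x y) (\prod_(x <- s) \prod_(y <- t) cb x y).
Proof.
move=> cb0; elim: s => [|x s IH] h.
  by rewrite !big_nil; apply: comm_sym; exact: comm_loner.
rewrite !big_cons; apply: comm_mull.
- by apply: prodr_ge0.
- elim: t {IH} h => [|y t IH] h; first by rewrite !big_nil; exact: comm_loner.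
  rewrite !big_cons; apply: comm_mulr => //.
    by apply: h; rewrite mem_head.
  by apply: IH => x' y' xs yt; apply: h => //; rewrite inE yt orbT.
by apply: IH => x' y' xs yt; apply: h => //; rewrite inE xs orbT.
Qed.

Definition lsum A B la mu := \sum_(ka <- subs la) lk A la ka * lk B mu ka.

(* Normal ordering X = c A B^T: creation to the left of annihilation. *)
Definition normal (X : operator K) c A B := forall la mu, X la mu = c * lsum A B la mu.

Lemma lsum_loner A la mu : lsum A lone la mu = lk A la mu.
Proof.
rewrite /lsum; case: (boolP (subpart mu la)) => h; last first.
  rewrite lk_sub// big_seq big1// => ka; rewrite mem_subs /=.
  by case: eqP => [<-|_]; [rewrite (negPf h)|rewrite mulr0].
rewrite (big_rem mu) ?mem_subs//= eqxx mulr1 big_seq big1 ?addr0// => ka.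
by rewrite rem_filter ?subs_uniq// mem_filter => /andP[/= /negPf]; rewrite eq_sym => ->; rewrite mulr0.
Qed.

Lemma lsum_sym A B la mu : lsum A B la mu = lsum B A mu la.
Proof.
rewrite /lsum (@sum_subs_swap _ la mu).
  by apply: eq_bigr => ka _; rewrite mulrC.
by move=> s; rewrite negb_and => /orP[] /lk_sub ->; rewrite ?mul0r ?mulr0.
Qed.

Lemma normal_minus A : normal (lk A) 1 A lone.
Proof. by move=> la mu; rewrite lsum_loner mul1r. Qed.

Lemma normal_plus A : normal (fun mu la => lk A la mu) 1 lone A.
Proof. by move=> la mu; rewrite lsum_sym lsum_loner mul1r. Qed.

Lemma normal_id : normal (@opid R K) 1 lone lone.
Proof. exact: (normal_minus lone). Qed.

Lemma normal_mul X cX LX RX Y cY LY RY c cb :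
  normal X cX LX RX -> normal Y cY LY RY -> comm RX LY c cb ->
  normal (X ** Y) (c * cX * cY) (lmul LX LY) (lmul RY RX).
Proof.
move=> hX hY h la mu; rewrite /opmul; apply: usum_has.
have E nu : X la nu * Y nu mu = \sum_(ka <- subs la) \sum_(tau <- subs mu)
    cX * cY * lk LX la ka * lk RY mu tau * (lk RX nu ka * lk LY nu tau).
  rewrite hX hY lsum_sym [lsum LY RY nu mu]lsum_sym -/(lsum _ _ _ _).
  rewrite (lsum_sym RX LX) /lsum mulrACA mulr_suml mulr_sumr; apply: eq_bigr => ka _.
  by rewrite !mulr_sumr; apply: eq_bigr => tau _; ring.
apply: (eq_has_usum (fun nu => esym (E nu))).
rewrite [X in has_usum _ X](_ : _ = \sum_(ka <- subs la) \sum_(tau <- subs mu)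
    cX * cY * lk LX la ka * lk RY mu tau *
    (c * \sum_(s <- subs ka) lk LY ka s * lk RX tau s)); last first.
  rewrite /lsum /= mulr_sumr.
  transitivity (\sum_(s <- subs la) \sum_(ka <- subs la) \sum_(tau <- subs mu)
     cX * cY * lk LX la ka * lk RY mu tau * (c * (lk LY ka s * lk RX tau s))).
    apply: eq_bigr => s _; rewrite mulr_suml mulr_sumr; apply: eq_bigr => ka _.
    by rewrite !mulr_sumr; apply: eq_bigr => tau _; ring.
  rewrite exchange_big /= [LHS]big_seq [RHS]big_seq; apply: eq_bigr => ka.
  rewrite mem_subs => kl; rewrite exchange_big /=; apply: eq_bigr => tau _.
  rewrite !mulr_sumr (sum_subs_wide kl)//.
  by move=> s /lk_sub ->; rewrite mul0r !mulr0.
apply: has_usum_sum => ka _; apply: has_usum_sum => tau _; apply: has_usumZ.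
exact: (h ka tau).2.
Qed.

Section Scale.
Variables (q : K) (A : tker).
Let sk la mu := q ^+ (psize la - psize mu) * lk A la mu.
Let sb la mu := vnorm q ^+ (psize la - psize mu) * lb A la mu.
Let sk_sub la mu : ~~ subpart mu la -> sk la mu = 0.
Proof. by move=> h; rewrite /sk lk_sub// mulr0. Qed.
Let sb_sub la mu : ~~ subpart mu la -> sb la mu = 0.
Proof. by move=> h; rewrite /sb lb_sub// mulr0. Qed.
Let sk_le la mu : vnorm (sk la mu) <= sb la mu.
Proof. by rewrite /sk vnormM vnormX ler_wpM2l ?exprn_ge0 ?vnorm_ge0 ?lk_le. Qed.
Definition lscale : tker := TKer sk_sub sb_sub sk_le.
End Scale.

Lemma keq_lmul A A' B B' : keq A A' -> keq B B' -> keq (lmul A B) (lmul A' B').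
Proof.
by move=> [a1 a2] [b1 b2]; split=> la mu /=; apply: eq_bigr => nu _; rewrite ?a1 ?b1 ?a2 ?b2.
Qed.

Lemma lscale_mul q A B : keq (lscale q (lmul A B)) (lmul (lscale q A) (lscale q B)).
Proof.
split=> la mu /=; rewrite mulr_sumr [LHS]big_seq [RHS]big_seq; apply: eq_bigr => nu;
  rewrite mem_subs => nl; case: (boolP (subpart mu nu)) => mn.
- rewrite mulrACA -exprD; congr (_ ^+ _ * _).
  by have := subpart_psize nl; have := subpart_psize mn; lia.
- by rewrite (lk_sub _ mn) !mulr0.
- rewrite mulrACA -exprD; congr (_ ^+ _ * _).
  by have := subpart_psize nl; have := subpart_psize mn; lia.
- by rewrite (lb_sub _ mn) !mulr0.
Qed.

Lemma lscale_one q : keq (lscale q lone) lone.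
Proof.
by split=> la mu /=; case: eqP => [->|_]; rewrite ?mulr0// subnn expr0 mul1r.
Qed.

Lemma keq_trans A B C : keq A B -> keq B C -> keq A C.
Proof. by move=> [a1 a2] [b1 b2]; split=> la mu; rewrite ?a1 ?a2 ?b1 ?b2. Qed.

Lemma lscale_prod q s : keq (lscale q (lprod s)) (lprod (map (lscale q) s)).
Proof.
elim: s => [|A s IH] /=; first exact: lscale_one.
by apply: keq_trans (lscale_mul _ _ _) _; apply: keq_lmul.
Qed.

End LowerKernels.

(** * Traces *)

Section PartitionSeries.
Implicit Types (mu : part) (n : nat).

Definition add_row n mu : part :=
  mkpart (size mu).+1 (fun i => if i is j.+1 then prow mu j else n).

Definition del_row mu : part := mkpart (size mu) (fun i => prow mu i.+1).

Lemma prow_add n mu : (prow mu 0 <= n)%N ->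
  forall i, prow (add_row n mu) i = if i is j.+1 then prow mu j else n.
Proof.
move=> h i; rewrite prow_mkpart// => -[|j] //; first exact: prow_le.
by move=> hj; rewrite prow_eq0.
Qed.

Lemma prow_del mu i : prow (del_row mu) i = prow mu i.+1.
Proof.
rewrite prow_mkpart// => j; first exact: prow_le.
by move=> hj; rewrite prow_eq0// leqW.
Qed.

Lemma psize_add n mu : (prow mu 0 <= n)%N -> psize (add_row n mu) = (n + psize mu)%N.
Proof.
move=> h; rewrite (@psizeE _ (size mu).+1); last first.
  by rewrite leqNgt -prow_gt0 prow_add// prow_eq0.
rewrite big_ord_recl prow_add// (psizeE (leqnn _)); congr (_ + _)%N.
by apply: eq_bigr => i _; rewrite prow_add.
Qed.

Lemma add_rowK n mu : (prow mu 0 <= n)%N -> del_row (add_row n mu) = mu.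
Proof. by move=> h; apply: part_ext => i; rewrite prow_del prow_add. Qed.

Lemma del_rowK mu : add_row (prow mu 0) (del_row mu) = mu.
Proof.
apply: part_ext => i; rewrite prow_add ?prow_del ?prow_le//.
by case: i => // i; rewrite prow_del.
Qed.

Section RealBound.
Variables (R : realType) (x : R).
Hypothesis x01 : 0 <= x < 1.

Let x0 : 0 <= x. Proof. by case/andP: x01. Qed.
Let x1 : x < 1. Proof. by case/andP: x01. Qed.

Let S D n := \sum_(mu <- parts_upto D | (prow mu 0 <= n)%N) x ^+ psize mu.

Let xn1 n : (0 < n)%N -> x ^+ n < 1.
Proof. by move=> n0; rewrite exprn_ilt1// -lt0n. Qed.

Let S_rec D n : S D n.+1 <= S D n + x ^+ n.+1 * S D n.+1.
Proof.
rewrite {1}/S (bigID (fun mu => (prow mu 0 <= n)%N)) /=.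
rewrite (eq_bigl (fun mu => (prow mu 0 <= n)%N)) ?lerD2l; last first.
  by move=> mu; case: (leqP (prow mu 0) n) => h; rewrite ?andbT ?andbF// leqW.
have E mu : (prow mu 0 <= n.+1)%N && ~~ (prow mu 0 <= n)%N -> prow mu 0 = n.+1 by lia.
rewrite mulr_sumr.
apply: (@le_trans _ _ (\sum_(mu <- [seq del_row mu | mu <- parts_upto D & prow mu 0 == n.+1])
   x ^+ n.+1 * x ^+ psize mu)).
  rewrite big_map big_filter le_eqVlt; apply/orP; left; apply/eqP.
  apply: eq_big => mu; first by apply/idP/eqP; lia.
  by move=> /E e; rewrite -exprD -{1}(del_rowK mu) psize_add ?prow_del ?prow_le// e.
set s := [seq _ | _ <- _].
have us : uniq s.
  rewrite map_inj_in_uniq ?(filter_uniq _ (parts_upto_uniq D))// => a b.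
  rewrite !mem_filter => /andP[/eqP ea _] /andP[/eqP eb _] e.
  by rewrite -(del_rowK a) -(del_rowK b) ea eb e.
rewrite [leRHS](bigID (fun mu => mu \in s)) /= -[leLHS]addr0 lerD//; last first.
  by rewrite sumr_ge0// => mu _; rewrite mulr_ge0// exprn_ge0.
rewrite -[leRHS]big_filter le_eqVlt; apply/orP; left; apply/eqP/perm_big.
apply: uniq_perm => // [|mu]; first exact: filter_uniq (parts_upto_uniq D).
rewrite [RHS]mem_filter mem_parts_upto.
case: (boolP (mu \in s)) => [|_]; last by rewrite andbF.
move=> /mapP[la]; rewrite mem_filter mem_parts_upto => /andP[/eqP e lD] ->.
rewrite prow_del andbT -e prow_le//=; apply/esym.
by rewrite (leq_trans _ lD)// -{2}(del_rowK la) psize_add ?leq_addl// prow_del prow_le.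
Qed.

Let S0 D : S D 0 <= 1.
Proof.
rewrite /S -big_filter.
have : {subset [seq mu <- parts_upto D | (prow mu 0 <= 0)%N] <= [:: mkpart 0 (fun=> 0%N)]}.
  move=> mu; rewrite mem_filter inE leqn0 => /andP[/eqP m0 _]; apply/eqP/part_ext => i.
  by rewrite prow_mkpart//; apply/eqP; rewrite -leqn0 -m0 prow_le.
have := parts_upto_uniq D => /(filter_uniq (fun mu => (prow mu 0 <= 0)%N)).
case: [seq _ <- _ | _] => [|a [|b s]] /=; rewrite ?big_nil// ?big_seq1.
  by move=> _ _; rewrite exprn_ile1// ltW.
move=> /andP[+ _] h; have := h a; have := h b; rewrite !inE !eqxx orbT.
by move=> /(_ isT)/eqP -> /(_ isT)/eqP ->; rewrite eqxx.
Qed.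

Let S_bound D n : S D n <= expR (\sum_(0 <= k < n) x ^+ k * (1 - x)^-1).
Proof.
elim: n => [|n IH]; first by rewrite big_nil expR0 S0.
have h := S_rec D n; have xn := xn1 (ltn0Sn n).
have q0 : 0 < 1 - x ^+ n.+1 by rewrite subr_gt0.
have : S D n.+1 <= (1 - x ^+ n.+1)^-1 * S D n.
  by rewrite -[leRHS]mulrC ler_pdivlMr//; lra.
move=> /le_trans; apply; rewrite big_nat_recr//= expRD mulrC.
rewrite ler_pM ?invr_ge0 ?(ltW q0)//.
  by rewrite /S sumr_ge0// => mu _; rewrite exprn_ge0.
apply: le_trans (expR_ge1Dx _).
have xx : x ^+ n.+1 <= x by rewrite exprS ler_piMr// exprn_ile1// ltW.
have r0 : 0 < 1 - x by rewrite subr_gt0.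
rewrite -[leLHS]div1r ler_pdivrMr//.
have xn0 : 0 <= x ^+ n by rewrite exprn_ge0.
have -> : (1 + x ^+ n * (1 - x)^-1) * (1 - x ^+ n.+1) =
   1 + x ^+ n * ((1 - x ^+ n.+1) * (1 - x)^-1 - x) by rewrite exprS; ring.
rewrite lerDl mulr_ge0// subr_ge0 ler_pdivlMr//.
have : x * (1 - x) <= 1 * (1 - x) by rewrite ler_wpM2r ?ltW.
lra.
Qed.

Lemma part_series_bdd : exists B, sum_bdd (fun mu => x ^+ psize mu) B.
Proof.
exists (expR ((1 - x)^-1 * (1 - x)^-1)) => s us.
pose D := \max_(mu <- s) psize mu.
have sD mu : mu \in s -> mu \in parts_upto D.
  by move=> ms; rewrite mem_parts_upto; apply: leq_bigmax_seq.
apply: (@le_trans _ _ (S D D)).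
  rewrite /S [leRHS](bigID (fun mu => mu \in s)) /= -[leLHS]addr0 lerD//; last first.
    by rewrite sumr_ge0// => mu _; rewrite exprn_ge0.
  rewrite -[leRHS]big_filter le_eqVlt; apply/orP; left; apply/eqP/perm_big.
  apply: uniq_perm => // [|mu]; first exact: filter_uniq (parts_upto_uniq D).
  rewrite [RHS]mem_filter; case: (boolP (mu \in s)) => [/sD h|_]; last by rewrite andbF.
  rewrite h !andbT; apply/esym; move: h; rewrite mem_parts_upto.
  exact: leq_trans (prow_le_psize _ _).
apply: le_trans (S_bound D D) _; rewrite ler_expR -mulr_suml ler_wpM2r//.
  by rewrite invr_ge0 subr_ge0 ltW.
by apply: geometric_bdd => //; rewrite iota_uniq.
Qed.

End RealBound.

Section Euler.
Variables (R : realType) (K : completeValuedField R) (p : K).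
Hypothesis p1 : vnorm p < 1.

Let np01 : 0 <= vnorm p < 1. Proof. by rewrite vnorm_ge0. Qed.

Let pn1 n : (0 < n)%N -> 1 - p ^+ n != 0.
Proof.
move=> n0; rewrite subr_eq0; apply/eqP => e.
have : vnorm (p ^+ n) < 1 by rewrite vnormX exprn_ilt1 ?vnorm_ge0// -lt0n.
by rewrite -e vnorm1 ltxx.
Qed.

Lemma euler_prod_ex : exists2 P, P != 0 &
  kcvg (fun n => \prod_(1 <= N < n.+1) (1 - p ^+ N)) P.
Proof.
have hB : sumlim (fun N => - p ^+ N.+1) (1 - vnorm p)^-1.
  apply: sum_bdd_le (geometric_bdd np01) => N.
  by rewrite vnormN vnormX exprS ler_piMl ?exprn_ge0 ?vnorm_ge0 ?ltW.
have [P hP] := has_uprod_ex hB; exists P.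
  by apply: has_uprod_neq0 hB _ hP => N; exact: pn1.
apply: eq_kcvg (has_uprod_seq (s := fun n => index_iota 0 n) hP _ _) => [n|n|n].
- by rewrite big_add1.
- exact: iota_uniq.
- by exists n.+1 => m nm; rewrite mem_index_iota.
Qed.

Let F n mu := if (prow mu 0 <= n)%N then p ^+ psize mu else 0.

Let F_le n mu : vnorm (F n mu) <= vnorm p ^+ psize mu.
Proof. by rewrite /F; case: ifP; rewrite ?vnorm0 ?exprn_ge0 ?vnorm_ge0// vnormX. Qed.

Let F_sum n : has_usum (F n) (\prod_(1 <= N < n.+1) (1 - p ^+ N))^-1.
Proof.
elim: n => [|n IH].
  have E0 : F 0 (mkpart 0 (fun=> 0%N)) = 1.
    by rewrite /F prow_mkpart//= (@psizeE _ 0%N)//= big_ord0 expr0.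
  rewrite big_geq// invr1 -E0; apply: has_usum1 => mu /eqP h.
  rewrite /F leqn0; case: eqP => // m0; case: h; apply: part_ext => i.
  by rewrite prow_mkpart//; apply/eqP; rewrite -leqn0 -m0 prow_le.
have [B hB] := part_series_bdd np01.
have [E hE] := has_usum_ex (sum_bdd_le (F_le n.+1) hB).
have h2 : has_usum (fun mu => if prow mu 0 == n.+1 then p ^+ psize mu else 0) (p ^+ n.+1 * E).
  pose G mu := p ^+ n.+1 * p ^+ psize (del_row mu).
  have hG : has_usum (fun mu => if prow mu 0 == n.+1 then G mu else 0) (p ^+ n.+1 * E).
    apply: (@has_usum_reindex _ _ _ _ (fun mu => prow mu 0 <= n.+1)%N
      (fun mu => prow mu 0 == n.+1) del_row (add_row n.+1) (fun mu => p ^+ n.+1 * p ^+ psize mu)).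
    - move=> mu /eqP e; split; first by rewrite prow_del -e prow_le.
      by rewrite -e del_rowK.
    - by move=> mu h; rewrite prow_add// eqxx add_rowK.
    by apply: eq_has_usum (has_usumZ (p ^+ n.+1) hE) => mu; rewrite /F; case: ifP; rewrite ?mulr0.
  apply: eq_has_usum hG => mu; case: eqP => // e.
  by rewrite /G -exprD -{2}(del_rowK mu) psize_add ?prow_del ?prow_le// e.
have h3 := has_usumD IH h2.
have : has_usum (F n.+1) ((\prod_(1 <= N < n.+1) (1 - p ^+ N))^-1 + p ^+ n.+1 * E).
  apply: eq_has_usum h3 => mu; rewrite /F.
  case: (ltngtP (prow mu 0) n.+1) => h.
  - by rewrite -ltnS h addr0.
  - by rewrite leqNgt (ltnW h) addr0.
  - by rewrite h ltnn add0r.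
move=> /(has_usum_unique hE) e.
rewrite (_ : _^-1 = E)//; have q0 := pn1 (ltn0Sn n).
rewrite big_nat_recr//= invfM; apply: (mulIf q0); rewrite mulfVK//.
by rewrite mulrBr mulr1 {1}e (mulrC E) addrK.
Qed.

Lemma euler_has_usum P : kcvg (fun n => \prod_(1 <= N < n.+1) (1 - p ^+ N)) P -> P != 0 ->
  has_usum (fun mu => p ^+ psize mu) P^-1.
Proof.
move=> hP P0; have [B hB] := part_series_bdd np01.
apply: (has_usum_dominated _ hB F_le _ F_sum (kcvgV P0 hP)).
  by move=> mu; rewrite exprn_ge0// vnorm_ge0.
move=> mu e e0; exists (prow mu 0) => n hn.
by rewrite /F hn subrr vnorm0.
Qed.

End Euler.
End PartitionSeries.

Section Trace.
Variables (R : realType) (K : completeValuedField R) (p : K).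
Variables (A B : tker K) (c : nat -> K) (cb : nat -> R) (CB : R).
Hypotheses (p1 : vnorm p < 1)
  (A1 : forall mu, lk A mu mu = 1) (B1 : forall mu, lk B mu mu = 1)
  (bA1 : forall mu, lb A mu mu = 1) (bB1 : forall mu, lb B mu mu = 1)
  (cb_ge0 : forall k, 0 <= cb k)
  (cb_bdd : forall n, \prod_(1 <= k < n.+1) cb k <= CB)
  (hcomm : forall k, (0 < k)%N -> comm (lscale (p ^+ k) B) A (c k) (cb k)).

Let x := vnorm p.
Let x01 : 0 <= x < 1. Proof. by rewrite vnorm_ge0. Qed.
Let x0 : 0 <= x. Proof. exact: vnorm_ge0. Qed.

Let lbs k mu := \sum_(ka <- subs mu) lb A mu ka * lb (lscale (p ^+ k) B) mu ka.

Let T D k := \sum_(mu <- parts_upto D) x ^+ psize mu * lbs k mu.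

Let T_rec D k : T D k <= cb k.+1 * T D k.+1.
Proof.
have -> : T D k = \sum_(ka <- parts_upto D) x ^+ psize ka *
    \sum_(mu <- parts_upto D) lb (lscale (p ^+ k.+1) B) mu ka * lb A mu ka.
  under [RHS]eq_bigr do rewrite mulr_sumr.
  rewrite exchange_big /= /T [LHS]big_seq [RHS]big_seq; apply: eq_bigr => mu.
  rewrite mem_parts_upto => mD; rewrite mulr_sumr.
  transitivity (\sum_(ka <- subs mu)
      x ^+ psize ka * (vnorm (p ^+ k.+1) ^+ (psize mu - psize ka) * lb B mu ka * lb A mu ka)).
    rewrite [LHS]big_seq [RHS]big_seq; apply: eq_bigr => ka; rewrite mem_subs => /subpart_psize h.
    rewrite /= !vnormX -{1}(subnKC h) exprD exprS exprMn -/x; ring.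
  rewrite [RHS](bigID (subpart^~ mu)) /= [X in _ + X]big1 ?addr0; last first.
    by move=> ka /lb_sub ->; rewrite !(mulr0, mul0r).
  rewrite -[RHS]big_filter; apply: perm_big; apply: uniq_perm => [||ka].
  - exact: subs_uniq.
  - exact: filter_uniq (parts_upto_uniq D).
  - rewrite mem_subs [RHS]mem_filter mem_parts_upto.
    by case: (boolP (subpart ka mu)) => //= /subpart_psize h; rewrite (leq_trans h).
rewrite /T mulr_sumr ler_sum// => ka _.
rewrite mulrCA ler_wpM2l ?exprn_ge0//.
exact: (hcomm (ltn0Sn k) ka ka).1 (parts_upto_uniq D).
Qed.

Let T_iter D n : T D 0 <= \prod_(1 <= k < n.+1) cb k * T D n.
Proof.
elim: n => [|n IH]; first by rewrite big_geq// mul1r.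
apply: (le_trans IH); rewrite [in leRHS]big_nat_recr//= -mulrA ler_wpM2l ?T_rec//.
by rewrite big_nat prodr_ge0.
Qed.

Let lbs_ge0 k mu : 0 <= lbs k mu.
Proof. by rewrite sumr_ge0// => ka _; rewrite mulr_ge0 ?lb_ge0. Qed.

Let lbs_le k mu : lbs k mu <= 1 + x ^+ k * lbs 0 mu.
Proof.
rewrite /lbs (big_rem mu) ?mem_subs ?subpart_refl//= subnn expr0 mul1r bA1 bB1 mulr1 lerD2l.
rewrite [X in _ <= _ * X](big_rem mu) ?mem_subs ?subpart_refl//=.
rewrite mulrDr -[leLHS]add0r lerD ?mulr_ge0 ?exprn_ge0 ?invr_ge0 ?vnorm_ge0 ?lb_ge0//.
rewrite mulr_sumr big_seq [leRHS]big_seq ler_sum// => ka.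
rewrite rem_filter ?subs_uniq// mem_filter mem_subs => /andP[/= kn ks].
have lt : (0 < psize mu - psize ka)%N.
  rewrite subn_gt0 ltn_neqAle subpart_psize// andbT.
  by apply: contraNN kn => /eqP /(psize_eq ks) ->.
rewrite expr0 vnorm1 expr1n mul1r mulrCA ler_wpM2r ?mulr_ge0 ?lb_ge0//.
rewrite vnormX -/x -(prednK lt) exprS ler_piMr ?exprn_ge0// exprn_ile1 ?exprn_ge0//.
by rewrite exprn_ile1// ltW.
Qed.

Let CB0 : 0 <= CB. Proof. by apply: le_trans (cb_bdd 0); rewrite big_geq. Qed.

Let bdd_lbs : exists M, sum_bdd (fun mu => x ^+ psize mu * lbs 0 mu) M.
Proof.
have [E hE] := part_series_bdd x01; exists (CB * E) => s us.
pose D := \max_(mu <- s) psize mu.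
have sD mu : mu \in s -> mu \in parts_upto D.
  by move=> ms; rewrite mem_parts_upto; apply: leq_bigmax_seq.
apply: (@le_trans _ _ (T D 0)).
  rewrite /T [leRHS](bigID (fun mu => mu \in s)) /= -[leLHS]addr0 lerD//; last first.
    by rewrite sumr_ge0// => mu _; rewrite mulr_ge0 ?exprn_ge0.
  rewrite -[leRHS]big_filter le_eqVlt; apply/orP; left; apply/eqP/perm_big.
  apply: uniq_perm => // [|mu]; first exact: filter_uniq (parts_upto_uniq D).
  rewrite [RHS]mem_filter; case: (boolP (mu \in s)) => [/sD h|_]; last by [].
  by rewrite h.
have h n : T D 0 <= CB * E + x ^+ n * (CB * T D 0).
  apply: (le_trans (T_iter D n)).
  apply: (@le_trans _ _ (CB * T D n)).
    rewrite ler_wpM2r// /T sumr_ge0// => mu _; by rewrite mulr_ge0 ?exprn_ge0.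
  rewrite mulrCA -mulrDr ler_wpM2l//.
  apply: (@le_trans _ _ (\sum_(mu <- parts_upto D) x ^+ psize mu * (1 + x ^+ n * lbs 0 mu))).
    by rewrite ler_sum// => mu _; rewrite ler_wpM2l ?exprn_ge0.
  under eq_bigr do rewrite mulrDr mulr1 mulrCA.
  by rewrite big_split /= -mulr_sumr lerD2r hE ?parts_upto_uniq.
apply/ler_addgt0Pr => e e0.
have Z0 : 0 <= CB * T D 0.
  by rewrite mulr_ge0// /T sumr_ge0// => mu _; rewrite mulr_ge0 ?exprn_ge0.
have Z1 : 0 < CB * T D 0 + 1 by rewrite ltr_wpDl.
have [N hN] := kcvg_geometric p1 (divr_gt0 e0 Z1).
have := hN N (leqnn N); rewrite subr0 vnormX -/x => hx.
apply: (le_trans (h N)); rewrite lerD2l.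
move: hx; rewrite ltr_pdivlMr// => /ltW; apply: le_trans.
by rewrite ler_wpM2l ?exprn_ge0// lerDl.
Qed.

Let G k mu := p ^+ psize mu * lsum A (lscale (p ^+ k) B) mu mu.

Let lsum_le k mu : vnorm (lsum A (lscale (p ^+ k) B) mu mu) <= lbs k mu.
Proof.
rewrite (le_trans (vnorm_sum _ _ _))// ler_sum// => ka _.
by rewrite vnormM ler_pM ?vnorm_ge0 ?lk_le.
Qed.

Let lbs_mono k mu : lbs k mu <= lbs 0 mu.
Proof.
rewrite ler_sum// => ka _; rewrite ler_wpM2l ?lb_ge0//= ler_wpM2r ?lb_ge0//.
by rewrite expr0 vnorm1 expr1n exprn_ile1 ?vnorm_ge0// vnormX exprn_ile1// ltW.
Qed.

Let G_bdd M k : sum_bdd (fun mu => x ^+ psize mu * lbs 0 mu) M -> sumlim (G k) M.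
Proof.
apply: sum_bdd_le => mu; rewrite vnormM vnormX ler_wpM2l ?exprn_ge0//.
exact: le_trans (lsum_le _ _) (lbs_mono _ _).
Qed.

Let G_step M k s t : sum_bdd (fun mu => x ^+ psize mu * lbs 0 mu) M ->
  has_usum (G k) s -> has_usum (G k.+1) t -> s = c k.+1 * t.
Proof.
move=> hM hs ht.
pose F mu ka := p ^+ psize mu * (lk A mu ka * lk (lscale (p ^+ k) B) mu ka).
have FE mu ka : F mu ka = p ^+ psize ka * (lk (lscale (p ^+ k.+1) B) mu ka * lk A mu ka).
  rewrite /F; case: (boolP (subpart ka mu)) => [/subpart_psize h|/lk_sub ->]; last by rewrite !(mul0r, mulr0).
  by rewrite /= -{1}(subnKC h) exprD exprS exprMn; ring.
have h1 : has_usum (fun ka => p ^+ psize ka * (c k.+1 * lsum A (lscale (p ^+ k.+1) B) ka ka)) s.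
  apply: (@has_usum_exchange _ _ _ _ F (G k) _ s M) hs.
  - apply: (sum_bdd_pair (B := fun mu => x ^+ psize mu * lbs 0 mu)) => //.
      by move=> i; exact: vnorm_ge0.
    move=> mu s' us; apply: (@le_trans _ _ (x ^+ psize mu * lbs k mu)); last first.
      by rewrite ler_wpM2l ?exprn_ge0.
    rewrite /= (bigID (subpart^~ mu)) /= [X in _ + X]big1 ?addr0; last first.
      by move=> ka /lk_sub h; rewrite /F h mul0r mulr0 vnorm0.
    rewrite /lbs mulr_sumr -big_filter.
    apply: (@le_trans _ _ (\sum_(ka <- [seq ka <- s' | subpart ka mu])
       x ^+ psize mu * (lb A mu ka * lb (lscale (p ^+ k) B) mu ka))).
      by rewrite ler_sum// => ka _; rewrite /F vnormM vnormX ler_wpM2l ?exprn_ge0// vnormM; apply: ler_pM; rewrite ?vnorm_ge0//; exact: lk_le.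
    rewrite [leRHS](bigID (fun ka => ka \in s')) /= -[leLHS]addr0 lerD//; last first.
      by rewrite sumr_ge0// => ka _; rewrite mulr_ge0 ?exprn_ge0// mulr_ge0 ?lb_ge0// (lb_ge0 (lscale _ _)).
    rewrite -[leRHS]big_filter le_eqVlt; apply/orP; left; apply/eqP/perm_big.
    apply: uniq_perm => [||ka]; [exact: filter_uniq|exact: filter_uniq (subs_uniq _)|].
    by rewrite [LHS]mem_filter [RHS]mem_filter mem_subs andbC.
  - move=> mu; rewrite /G /lsum mulr_sumr; apply: has_usum_fin (subs_uniq mu) _ => ka.
    by rewrite mem_subs => /lk_sub h; rewrite /F h mul0r mulr0.
  - move=> ka; apply: (eq_has_usum (fun mu => esym (FE mu ka))).
    exact: has_usumZ (hcomm (ltn0Sn k) ka ka).2.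
apply: (has_usum_unique h1); apply: eq_has_usum (has_usumZ (c k.+1) ht) => ka.
by rewrite /G mulrCA.
Qed.

Lemma trace_formula C E :
  kcvg (fun n => \prod_(1 <= k < n.+1) c k) C ->
  has_usum (fun mu => p ^+ psize mu) E ->
  has_usum (fun mu => p ^+ psize mu * lsum A B mu mu) (C * E).
Proof.
move=> hC hE; have [M hM] := bdd_lbs.
have /choice[s hs] : forall k, exists s, has_usum (G k) s.
  by move=> k; exact: has_usum_ex (G_bdd k hM).
have sn n : s 0 = \prod_(1 <= k < n.+1) c k * s n.
  elim: n => [|n ->]; first by rewrite big_geq// mul1r.
  by rewrite (G_step hM (hs n) (hs n.+1)) [in RHS]big_nat_recr//= mulrA.
have sE : kcvg s E.
  apply/kcvg_sub0 => e e0.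
  have M0 : 0 <= M by exact: sum_bdd_ge0 hM.
  have M1 : 0 < M + 1 by rewrite ltr_wpDl.
  have [N hN] := kcvg_geometric p1 (divr_gt0 e0 M1).
  exists N => n /hN; rewrite !subr0 vnormX -/x => hx.
  have hd := has_usumD (hs n) (has_usumZ (-1) hE).
  have : vnorm (s n + -1 * E) <= x ^+ n * M.
    apply: has_usum_le hd; apply: sum_bdd_le (sum_bddZ (exprn_ge0 n x0) hM) => mu.
    rewrite /G mulN1r -[X in _ - X]mulr1 -mulrBr vnormM vnormX mulrCA ler_wpM2l ?exprn_ge0//.
    rewrite /lsum (big_rem mu) ?mem_subs ?subpart_refl//= A1 B1 subnn expr0 !mulr1 addrAC subrr add0r.
    rewrite (le_trans (vnorm_sum _ _ _))//.
    have := lbs_le n mu; rewrite /lbs (big_rem mu) ?mem_subs ?subpart_refl//=.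
    rewrite bA1 bB1 subnn expr0 !mulr1 lerD2l; apply: le_trans; rewrite ler_sum// => ka _.
    rewrite !vnormM vnormX ler_pM ?mulr_ge0 ?exprn_ge0 ?vnorm_ge0 ?lk_le//.
    by rewrite ler_wpM2l ?exprn_ge0 ?vnorm_ge0 ?lk_le.
  rewrite mulN1r; move/le_lt_trans; apply; move: hx; rewrite ltr_pdivlMr//.
  by apply: le_lt_trans; rewrite ler_wpM2l ?exprn_ge0// lerDl.
have -> : C * E = s 0.
  by apply: (kcvg_unique (kcvgM hC sE)); apply: eq_kcvg (kcvg_cst (s 0)) => n.
apply: eq_has_usum (hs 0) => mu; rewrite /G /lsum; congr (_ * _).
by apply: eq_bigr => ka _; rewrite /= expr0 expr1n mul1r.
Qed.

End Trace.

(** * Skew Schur functions *)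

Section Cells.
Implicit Types (la mu nu : part) (c d : nat * nat) (t : nat * nat -> nat).

Lemma mem_cells la c : (c \in cells la) =
  [&& (0 < c.1)%N, (0 < c.2)%N & (c.2 <= prow la c.1.-1)%N].
Proof.
case: c => i j; apply/allpairsPdep/and3P => /= [[i' [j' [+ + [-> ->]]]]|[i0 j0 jl]].
  by rewrite !mem_iota /part_row -/(prow la _) => /andP[? _] /andP[? ?]; split=> //; lia.
exists i, j; rewrite !mem_iota /part_row -/(prow la _); split=> //; last by lia.
have : (0 < prow la i.-1)%N by lia.
by rewrite prow_gt0; lia.
Qed.

Lemma cells_uniq la : uniq (cells la).
Proof.
apply: allpairs_uniq_dep => [|i _|[x y] [x' y'] _ _ /= [-> ->]//]; exact: iota_uniq.
Qed.

Lemma size_cells la : size (cells la) = psize la.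
Proof.
rewrite size_allpairs_dep (psizeE (leqnn _)) sumnE big_map.
rewrite -[X in iota X _]/(1 + 0)%N iotaDl big_map.
rewrite (_ : iota 0 (size la) = index_iota 0 (size la)) ?big_mkord /index_iota ?subn0//.
by apply: eq_bigr => i _; rewrite size_iota /part_row -/(prow la _).
Qed.

Lemma cells_sub mu la : subpart mu la -> {subset cells mu <= cells la}.
Proof.
move=> /subpartP h c; rewrite !mem_cells => /and3P[-> -> /=] /leq_trans; exact.
Qed.

Lemma mem_skew la mu c : (c \in skew_cells la mu) = (c \in cells la) && (c \notin cells mu).
Proof. by rewrite mem_filter andbC. Qed.

Lemma skew_uniq la mu : uniq (skew_cells la mu).
Proof. exact: filter_uniq (cells_uniq la). Qed.

Lemma skew_split la nu mu : subpart mu nu -> subpart nu la ->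
  perm_eq (skew_cells la mu) (skew_cells la nu ++ skew_cells nu mu).
Proof.
move=> /cells_sub mn /cells_sub nl; apply: uniq_perm; first exact: skew_uniq.
  rewrite cat_uniq !skew_uniq andbT /=; apply/hasPn => c.
  by rewrite /= !mem_skew => /andP[-> _]; rewrite andbF.
move=> c; rewrite mem_cat !mem_skew.
case: (boolP (c \in cells nu)) => [cn|cn]; first by rewrite (nl _ cn).
by rewrite andbT andFb orbF; case: (c \in cells la) => //=; apply: contraNN cn; exact: mn.
Qed.

Lemma size_skew la mu : subpart mu la -> size (skew_cells la mu) = (psize la - psize mu)%N.
Proof.
move=> /cells_sub ml; rewrite -!size_cells size_filter -(count_predC (mem (cells mu)) (cells la)).
rewrite [X in (X + _ - _)%N](_ : _ = size (cells mu)) ?addKn//.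
rewrite -size_filter; apply: perm_size; apply: uniq_perm.
- exact: filter_uniq (cells_uniq la).
- exact: cells_uniq.
by move=> c; rewrite mem_filter /=; case: (boolP (c \in cells mu)) => // /ml ->.
Qed.

(* Semistandard fillings with entries <= n, extended by 0 outside the shape. *)
Definition tableau n la mu t :=
  [/\ subpart mu la, forall c, (c \in skew_cells la mu) = (0 < t c)%N,
      forall c, (t c <= n)%N &
      forall c d, c \in skew_cells la mu -> d \in skew_cells la mu ->
        (c.1 = d.1 -> (c.2 < d.2)%N -> (t c <= t d)%N) /\
        (c.2 = d.2 -> (c.1 < d.1)%N -> (t c < t d)%N)].

Lemma count_initial (P : pred nat) L :
  (forall j k, (0 < j)%N -> (j <= k)%N -> (k <= L)%N -> P k -> P j) ->
  forall j, (0 < j)%N -> (j <= count P (iota 1 L))%N = (j <= L)%N && P j.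
Proof.
elim: L => [|L IH] hP j j0; first by case: j j0.
rewrite -[L.+1]addn1 iotaD count_cat /= addn0 add1n addn1.
case: (boolP (P L.+1)) => PL.
  have -> : count P (iota 1 L) = L.
    rewrite -{2}(size_iota 1 L); apply/eqP; rewrite -all_count; apply/allP => k.
    by rewrite mem_iota => /andP[k0 kL]; apply: (hP k L.+1) => //; lia.
  rewrite addn1; case: leqP => //= jL; apply/esym; exact: (hP j L.+1).
rewrite addn0 IH//; last by move=> a b a0 ab bL; apply: hP => //; lia.
case: (ltngtP j L.+1) => jL; first by rewrite -ltnS jL.
  by rewrite leqNgt (ltn_trans _ jL).
by rewrite jL (negPf PL) andbF.
Qed.

Definition tab_level n la t : part :=
  mkpart (size la) (fun i => count (fun j => t (i.+1, j) <= n)%N (iota 1 (prow la i))).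
Definition tab_cut n t : nat * nat -> nat := fun c => if (t c <= n)%N then t c else 0%N.
Definition tab_fill n la nu t : nat * nat -> nat :=
  fun c => if c \in skew_cells la nu then n.+1 else t c.

Section Down.
Variables (n : nat) (la mu : part) (t : nat * nat -> nat).
Hypothesis ht : tableau n.+1 la mu t.

Let tsub : subpart mu la. Proof. by case: ht. Qed.
Let tpos c : (c \in skew_cells la mu) = (0 < t c)%N. Proof. by case: ht. Qed.
Let tle c : (t c <= n.+1)%N. Proof. by case: ht. Qed.

Let t_row i j k : (0 < j)%N -> (j <= k)%N -> (k <= prow la i)%N ->
  (t (i.+1, j) <= t (i.+1, k))%N.
Proof.
move=> j0 jk kl; case: (posnP (t (i.+1, j))) => [->//|]; rewrite -tpos => js.
move: jk; rewrite leq_eqVlt => /orP[/eqP ->//|jk].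
have ks : (i.+1, k) \in skew_cells la mu.
  move: js; rewrite !mem_skew !mem_cells /= => /andP[/andP[_ _] h].
  by rewrite kl (leq_ltn_trans _ jk)//=; apply: contraNN h => /(leq_trans (ltnW jk)) ->; rewrite j0.
by have [_ _ _ /(_ _ _ js ks)[h _]] := ht; apply: h.
Qed.

Let t_col i k j : (0 < j)%N -> (i < k)%N -> (j <= prow la k)%N ->
  (t (i.+1, j) <= (t (k.+1, j)).-1)%N.
Proof.
move=> j0 ik jl; case: (posnP (t (i.+1, j))) => [->//|]; rewrite -tpos => js.
have ks : (k.+1, j) \in skew_cells la mu.
  move: js; rewrite !mem_skew !mem_cells /= => /andP[/andP[_ _] h].
  by rewrite jl j0 /=; move: h; rewrite j0 /= -!ltnNge; apply: leq_ltn_trans; exact: prow_le (ltnW ik).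
have [_ _ _ /(_ _ _ js ks)[_ h]] := ht.
by have := h erefl ik; lia.
Qed.

Lemma mem_tab_level_count i j : (0 < j)%N ->
  (j <= count (fun j => t (i.+1, j) <= n)%N (iota 1 (prow la i)))%N =
  (j <= prow la i)%N && (t (i.+1, j) <= n)%N.
Proof.
apply: (count_initial (P := fun j => t (i.+1, j) <= n)%N) => a b a0 ab bL.
exact: leq_trans (t_row a0 ab bL).
Qed.

Lemma prow_tab_level i : prow (tab_level n la t) i =
  count (fun j => t (i.+1, j) <= n)%N (iota 1 (prow la i)).
Proof.
rewrite prow_mkpart// => {}i; last by move=> h; rewrite prow_eq0.
set a := count _ _; case: (posnP a) => [->//|a0].
have := mem_tab_level_count i.+1 a0; rewrite -/a leqnn => /esym/andP[h1 h2].
rewrite mem_tab_level_count// (leq_trans h1) ?prow_le//=.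
by rewrite (leq_trans (t_col a0 (ltnSn i) h1))//; lia.
Qed.

Lemma mem_tab_level c : (c \in cells (tab_level n la t)) = (c \in cells la) && (t c <= n)%N.
Proof.
case: c => [[|i] j]; rewrite !mem_cells//= prow_tab_level.
by case: (posnP j) => [->|j0] //=; rewrite mem_tab_level_count.
Qed.

Lemma tab_level_hstrip : hstrip la (tab_level n la t).
Proof.
apply/hstripP => i; apply/andP; split; last first.
  rewrite prow_tab_level -[leqRHS](size_iota 1); exact: count_size.
case: (posnP (prow la i.+1)) => [->//|l0].
rewrite prow_tab_level mem_tab_level_count// prow_le//=.
have := t_col l0 (ltnSn i) (leqnn _); have := tle (i.+2, prow la i.+1); lia.
Qed.

Lemma tab_level_sub : subpart mu (tab_level n la t).
Proof.
apply/subpartP => i; case: (posnP (prow mu i)) => [->//|m0].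
rewrite prow_tab_level mem_tab_level_count//; move/subpartP: (tsub) => -> /=.
case: (posnP (t (i.+1, prow mu i))) => [->//|].
by rewrite -tpos mem_skew !mem_cells /= m0 leqnn andbF.
Qed.

Lemma tab_cut_tableau : tableau n (tab_level n la t) mu (tab_cut n t).
Proof.
have E c : (c \in skew_cells (tab_level n la t) mu) = (c \in skew_cells la mu) && (t c <= n)%N.
  by rewrite !mem_skew mem_tab_level andbAC.
split.
- exact: tab_level_sub.
- by move=> c; rewrite E /tab_cut tpos; case: ifP; rewrite ?andbT ?andbF.
- by move=> c; rewrite /tab_cut; case: ifP.
- move=> c d; rewrite !E => /andP[cs cn] /andP[ds dn]; rewrite /tab_cut cn dn.
  by have [_ _ _] := ht; exact.
Qed.

Lemma tab_fill_cut : tab_fill n la (tab_level n la t) (tab_cut n t) = t.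
Proof.
apply/funext => c; rewrite /tab_fill /tab_cut mem_skew mem_tab_level.
case: (boolP (c \in cells la)) => cl /=; last first.
  have : ~~ (0 < t c)%N by rewrite -tpos mem_skew (negPf cl).
  by rewrite -eqn0Ngt => /eqP ->.
by case: leqP => // h; apply/eqP; rewrite eqn_leq h tle.
Qed.

End Down.

Section Up.
Variables (n : nat) (la nu mu : part) (t : nat * nat -> nat).
Hypotheses (hs : hstrip la nu) (ht : tableau n nu mu t).

Let tsub : subpart mu nu. Proof. by case: ht. Qed.
Let tpos c : (c \in skew_cells nu mu) = (0 < t c)%N. Proof. by case: ht. Qed.
Let tle c : (t c <= n)%N. Proof. by case: ht. Qed.

Let mem_ext c : (c \in skew_cells la mu) =
  (c \in skew_cells la nu) || (c \in skew_cells nu mu).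
Proof. by rewrite (perm_mem (skew_split tsub (hstrip_sub hs))) mem_cat. Qed.

Let disj c : c \in skew_cells nu mu -> (c \in skew_cells la nu) = false.
Proof. by rewrite !mem_skew => /andP[-> _]; rewrite andbF. Qed.

Lemma tab_fill_tableau : tableau n.+1 la mu (tab_fill n la nu t).
Proof.
split.
- exact: subpart_trans tsub (hstrip_sub hs).
- by move=> c; rewrite /tab_fill mem_ext tpos; case: (c \in skew_cells la nu).
- by move=> c; rewrite /tab_fill; case: ifP => // _; rewrite leqW.
move=> c d; rewrite !mem_ext /tab_fill => /orP[cs|cs] /orP[ds|ds]; rewrite ?cs ?ds ?(disj cs) ?(disj ds).
- split=> // e2 e1; exfalso; move: cs ds; rewrite !mem_skew !mem_cells.
  case: c d e2 e1 => [[|i] j] [[|k] j'] //= -> ik /andP[/andP[j0 _] h] /andP[/andP[_ h'] _].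
  move: h; rewrite j0 /= -ltnNge ltnNge.
  have /hstripP/(_ i)/andP[h1 _] := hs; rewrite (leq_trans _ h1)//.
  by rewrite (leq_trans h')// prow_le.
- split=> [e1 e2|e2 e1]; exfalso; move: cs ds; rewrite !mem_skew !mem_cells.
    case: c d e1 e2 => [[|i] j] [[|k] j'] //= [<-] jj /andP[/andP[j0 _] h] /andP[/andP[_ h'] _].
    by move: h; rewrite j0 /= (leq_trans (ltnW jj) h').
  case: c d e2 e1 => [[|i] j] [[|k] j'] //= -> ik /andP[/andP[j0 _] h] /andP[/andP[_ h'] _].
  move: h; rewrite j0 /= (leq_trans h')// prow_le//; lia.
- by split=> *; [rewrite leqW|rewrite ltnS].
- by have [_ _ _] := ht; exact.
Qed.

Lemma tab_level_fill : tab_level n la (tab_fill n la nu t) = nu.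
Proof.
apply: part_ext => i; rewrite (prow_tab_level tab_fill_tableau).
have E j : (0 < j)%N -> (j <= count (fun j => tab_fill n la nu t (i.+1, j) <= n)%N (iota 1 (prow la i)))%N
   = (j <= prow nu i)%N.
  move=> j0; rewrite (mem_tab_level_count tab_fill_tableau)// /tab_fill mem_skew !mem_cells /= j0 /=.
  case: (leqP j (prow la i)) => jl /=; last first.
    apply/esym/negbTE; rewrite -ltnNge (leq_ltn_trans _ jl)//.
    by have /subpartP := hstrip_sub hs.
  by case: (leqP j (prow nu i)) => h /=; [rewrite tle|rewrite ltnn].
set a := count _ _ in E *; apply/eqP; rewrite eqn_leq; apply/andP; split.
  by case: (posnP a) => [->//|a0]; rewrite -E.
by case: (posnP (prow nu i)) => [->//|n0]; rewrite E.
Qed.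

Lemma tab_cut_fill : tab_cut n (tab_fill n la nu t) = t.
Proof.
apply/funext => c; rewrite /tab_cut /tab_fill; case: (boolP (c \in skew_cells la nu)) => cs; last by rewrite tle.
rewrite ltnn; apply/esym/eqP; rewrite eqn0Ngt -tpos.
by apply/negP => /disj; rewrite cs.
Qed.

End Up.
End Cells.

Section SkewSchur.
Variables (R : realType) (K : completeValuedField R).
Implicit Types (la mu nu : part) (x : nat -> K).
Local Notation cellfun := (nat * nat -> nat).

Lemma hk_sub (T : comNzRingType) (a : T) la mu : ~~ subpart mu la -> hk a la mu = 0.
Proof. by move=> h; rewrite /hk ifN//; apply: contraNN h => /hstrip_sub. Qed.

Lemma hk_le (a : K) la mu : vnorm (hk a la mu) <= hk (vnorm a) la mu.
Proof. by rewrite vnorm_hk. Qed.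

Definition onek (a : K) : tker K :=
  TKer (@hk_sub _ a) (@hk_sub _ (vnorm a)) (hk_le a).

(* The skew Schur function of x 1, ..., x n. *)
Definition schurn n x : tker K := lprod [seq onek (x k) | k <- rev (iota 1 n)].

Lemma schurnS n x : schurn n.+1 x = lmul (onek (x n.+1)) (schurn n x).
Proof. by rewrite /schurn -[n.+1]addn1 iotaD rev_cat map_cat /= add1n addn1. Qed.

Definition tabterm n x la mu (t : cellfun) : K :=
  if `[< tableau n la mu t >] then \prod_(c <- skew_cells la mu) x (t c) else 0.

Lemma tabterm_step n x la mu nu t : hstrip la nu -> tableau n nu mu t ->
  \prod_(c <- skew_cells la mu) x (tab_fill n la nu t c) =
  x n.+1 ^+ (psize la - psize nu) * \prod_(c <- skew_cells nu mu) x (t c).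
Proof.
move=> hs ht; have sub : subpart mu nu by case: ht.
rewrite (perm_big _ (skew_split sub (hstrip_sub hs))) big_cat /=; congr (_ * _).
  rewrite -size_skew ?hstrip_sub// -iter_mulr_1 -(count_predT (skew_cells la nu)).
  rewrite -big_const_seq [LHS]big_seq [RHS]big_seq.
  by apply: eq_bigr => c cs; rewrite /tab_fill cs.
rewrite [LHS]big_seq [RHS]big_seq; apply: eq_bigr => c.
by rewrite /tab_fill !mem_skew => /andP[-> _]; rewrite andbF.
Qed.

Lemma tabterm_sum x n la mu :
  (exists B, sumlim (tabterm n x la mu) B) /\
  has_usum (tabterm n x la mu) (lk (schurn n x) la mu).
Proof.
elim: n la mu => [|n IH] la mu.
  have z t : t != (fun=> 0%N) -> tabterm 0 x la mu t = 0.
    rewrite /tabterm; case: asboolP => // -[_ _ h _] /eqP[]; apply/funext => c.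
    by apply/eqP; rewrite -leqn0.
  have E : tabterm 0 x la mu (fun=> 0%N) = (la == mu)%:R.
    rewrite /tabterm; case: asboolP => [[sub h _ _]|h]; case: eqP => [e|e] //.
    - by rewrite /skew_cells e big_filter big1_seq// => c /andP[/negPf ->].
    - exfalso; apply: e; apply/esym/psize_eq => //; apply/eqP.
      rewrite eqn_leq subpart_psize//= -subn_eq0 -size_skew// size_eq0.
      by case: (skew_cells la mu) h => // c s /(_ c); rewrite mem_head.
    - case: h; rewrite e; split=> // [|c|c d]; first exact: subpart_refl.
        by rewrite mem_skew andbN.
      by rewrite mem_skew andbN.
  have hu := @has_usum1 _ K _ (tabterm 0 x la mu) (fun=> 0%N) z.
  rewrite E in hu; split=> //; exists 1 => s us.
  case: (boolP ((fun=> 0%N) \in s)) => hs.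
    rewrite (big_rem _ hs) /= big_seq big1 ?addr0; first by rewrite E; case: eqP; rewrite ?vnorm1 ?vnorm0.
    by move=> t; rewrite rem_filter// mem_filter => /andP[/= /z ->]; rewrite vnorm0.
  rewrite big_seq big1// => t ts; rewrite z ?vnorm0//.
  by apply: contraNneq hs => <-.
pose F (q : part * cellfun) := x n.+1 ^+ (psize la - psize q.1) * \prod_(c <- skew_cells q.1 mu) x (q.2 c).
pose P (q : part * cellfun) := hstrip la q.1 && `[< tableau n q.1 mu q.2 >].
pose FP q := if P q then F q else 0.
pose h (t : cellfun) : part * cellfun := (tab_level n la t, tab_cut n t).
pose g (q : part * cellfun) : cellfun := tab_fill n la q.1 q.2.
have FPE nu t : FP (nu, t) = hk (x n.+1) la nu * tabterm n x nu mu t.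
  rewrite /FP /P /F /tabterm /hk /=; case: (hstrip la nu); case: asboolP => h2;
    by rewrite ?mul0r ?mulr0.
have /choice[Bn hBn] : forall nu, exists B, sumlim (tabterm n x nu mu) B.
  by move=> nu; have [] := IH nu mu.
have sFP : sumlim FP (\sum_(nu <- subs la) vnorm (hk (x n.+1) la nu) * Bn nu).
  apply: (sum_bdd_pair (B := fun nu => vnorm (hk (x n.+1) la nu) * Bn nu)).
  - by move=> q; exact: vnorm_ge0.
  - move=> nu; apply: sum_bdd_le (sum_bddZ (vnorm_ge0 _) (hBn nu)) => t.
    by rewrite FPE vnormM.
  move=> s us; rewrite (bigID (fun nu => nu \in subs la)) /= [X in _ + X]big1 ?addr0; last first.
    by move=> nu; rewrite mem_subs => /hk_sub ->; rewrite vnorm0 mul0r.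
  rewrite -big_filter [leRHS](bigID (fun nu => nu \in s)) /= -[leLHS]addr0 lerD//; last first.
    by rewrite sumr_ge0// => nu _; rewrite mulr_ge0 ?vnorm_ge0// (sum_bdd_ge0 (hBn nu)).
  rewrite -[leRHS]big_filter le_eqVlt; apply/orP; left; apply/eqP/perm_big.
  apply: uniq_perm; [exact: filter_uniq|exact: filter_uniq (subs_uniq la)|move=> nu].
  by rewrite [LHS]mem_filter [RHS]mem_filter andbC.
have [S hS] := has_usum_ex sFP.
have hrow nu : has_usum (fun t => FP (nu, t)) (hk (x n.+1) la nu * lk (schurn n x) nu mu).
  by apply: (eq_has_usum (fun t => esym (FPE nu t))); apply: has_usumZ; have [] := IH nu mu.
have ES : S = lk (schurn n.+1 x) la mu.
  rewrite schurnS /=; apply: has_usum_unique (has_usum_pair hrow hS) _.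
  by apply: has_usum_fin (subs_uniq la) _ => nu; rewrite mem_subs => /hk_sub ->; rewrite mul0r.
rewrite ES in hS.
have hQ t : `[< tableau n.+1 la mu t >] -> P (h t) /\ g (h t) = t.
  move=> /asboolP ht; split; last exact: tab_fill_cut ht.
  by apply/andP; split; [exact: tab_level_hstrip ht|apply/asboolP; exact: tab_cut_tableau ht].
have hP q : P q -> `[< tableau n.+1 la mu (g q) >] /\ h (g q) = q.
  move=> /andP[hs /asboolP ht]; split; first by apply/asboolP; exact: tab_fill_tableau hs ht.
  by case: q hs ht => nu t hs ht; rewrite /h /g (tab_level_fill hs ht) (tab_cut_fill _ ht).
have E t : (if `[< tableau n.+1 la mu t >] then F (h t) else 0) = tabterm n.+1 x la mu t.
  rewrite /tabterm; case: ifPn => // ht; have [Pq e] := hQ t ht.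
  by rewrite -{2}e /g; have /andP[hs /asboolP ht'] := Pq; rewrite (tabterm_step _ hs ht').
split; last by apply: eq_has_usum E (has_usum_reindex hQ hP hS).
exists (\sum_(nu <- subs la) vnorm (hk (x n.+1) la nu) * Bn nu) => s us.
rewrite (bigID (fun t => `[< tableau n.+1 la mu t >])) /= [X in _ + X]big1 ?addr0; last first.
  by move=> t /negPf ht; rewrite /tabterm ht vnorm0.
have := sFP [seq h t | t <- s & `[< tableau n.+1 la mu t >]].
rewrite big_map map_inj_in_uniq ?filter_uniq//; last first.
  move=> a b; rewrite !mem_filter => /andP[/hQ[_ ea] _] /andP[/hQ[_ eb] _] e.
  by rewrite -ea -eb e.
move=> /(_ isT); apply: le_trans; rewrite big_filter le_eqVlt; apply/orP; left; apply/eqP.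
by apply: eq_bigr => t ht; rewrite -E ht /FP (hQ t ht).1.
Qed.

End SkewSchur.

Section RealField.
Variable R : realType.

Lemma real_complete (u : nat -> R) :
  (forall eps, 0 < eps -> exists N, forall m n,
     (N <= m)%N -> (N <= n)%N -> `|u m - u n| < eps) ->
  exists l, forall eps, 0 < eps -> \forall n \near \oo, `|u n - l| < eps.
Proof.
move=> hu; have : cvg (u @ \oo : set_system R^o).
  apply: cauchy_cvg; apply: cauchy_exP => e e0; have [N hN] := hu e e0.
  exists (u N); exists N => // n /= Nn.
  by rewrite -ball_normE /=; exact: hN.
move=> /cvg_ex[l /cvgrPdist_lt hl]; exists l => e /hl; apply: filterS => n.
by rewrite distrC.
Qed.

End RealField.

Section Limits.
Variables (R : realType) (K : completeValuedField R).
Implicit Types (la mu nu : part) (x : nat -> K).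
Local Notation cellfun := (nat * nat -> nat).

Definition tabfull x la mu (t : cellfun) : K :=
  if `[< exists n, tableau n la mu t >] then \prod_(c <- skew_cells la mu) x (t c) else 0.

Lemma sum_prod_bdd (C : seq (nat * nat)) (g : nat -> R) S (s : seq cellfun) :
  (forall k, 0 <= g k) -> sum_bdd g S -> uniq s ->
  {in s &, forall t u, {in C, t =1 u} -> t = u} ->
  \sum_(t <- s) \prod_(c <- C) g (t c) <= S ^+ size C.
Proof.
move=> g0 gS us inj.
pose N := (\max_(t <- s) \max_(c <- C) t c)%N.
have tN t c : t \in s -> c \in C -> (t c <= N)%N.
  move=> ts cC; apply: leq_trans (leq_bigmax_seq (F := fun t : cellfun => \max_(c <- C) t c)%N _ ts isT).
  exact: leq_bigmax_seq.
pose f (t : cellfun) : {ffun 'I_(size C) -> 'I_N.+1} := [ffun i => inord (t (nth (0, 0)%N C (nat_of_ord i)))].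
have fE t (i : 'I_(size C)) : t \in s -> f t i = t (nth (0, 0)%N C i) :> nat.
  by move=> ts; rewrite ffunE inordK// ltnS tN// mem_nth.
apply: (@le_trans _ _ (\sum_(h : {ffun 'I_(size C) -> 'I_N.+1}) \prod_i g (h i))).
  apply: (@le_trans _ _ (\sum_(h <- map f s) \prod_i g (h i))).
    rewrite big_map big_seq [leRHS]big_seq ler_sum// => t ts.
    rewrite (big_nth (0, 0)%N) big_mkord le_eqVlt; apply/orP; left; apply/eqP.
    by apply: eq_bigr => i _; rewrite fE.
  have uf : uniq (map f s).
    rewrite map_inj_in_uniq// => t u ts us' /ffunP e; apply: inj => // c cC.
    have ci : (index c C < size C)%N by rewrite index_mem.
    have := congr1 (@nat_of_ord _) (e (Ordinal ci)); rewrite !fE//=.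
    by rewrite nth_index.
  rewrite [leRHS](bigID (fun h => h \in map f s)) /= -[leLHS]addr0 lerD//; last first.
    by rewrite sumr_ge0// => h _; rewrite prodr_ge0.
  rewrite -[leRHS]big_filter le_eqVlt; apply/orP; left; apply/eqP/perm_big.
  apply: uniq_perm => //; first by rewrite filter_uniq// index_enum_uniq.
  by move=> h; rewrite mem_filter mem_index_enum andbT.
rewrite -(bigA_distr_bigA (fun _ (k : 'I_N.+1) => g k)) /=.
rewrite prodr_const card_ord lerXn2r ?nnegrE ?(sum_bdd_ge0 gS)//.
  by rewrite sumr_ge0.
rewrite -(big_mkord xpredT g); apply: gS; exact: iota_uniq.
Qed.

Variables (x : nat -> K) (S : R).
Hypothesis xS : sumlim (fun k => x k.+1) S.

Let g (k : nat) : R := if k is j.+1 then vnorm (x j.+1) else 0.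

Let g0 k : 0 <= g k. Proof. by case: k => //= j; exact: vnorm_ge0. Qed.

Let gS : sum_bdd g S.
Proof.
move=> s us; rewrite (bigID (fun k => 0 < k)%N) /= [X in _ + X]big1 ?addr0; last first.
  by move=> [].
have := xS (s := [seq k.-1 | k <- s & (0 < k)%N]).
rewrite big_map map_inj_in_uniq ?filter_uniq//; last first.
  move=> a b; rewrite !mem_filter => /andP[a0 _] /andP[b0 _] e.
  by rewrite -(prednK a0) -(prednK b0) e.
move=> /(_ isT); apply: le_trans; rewrite big_filter; by apply: ler_sum => -[|k] //= _; exact: lexx.
Qed.

Lemma tabfull_bdd la mu : sumlim (tabfull x la mu) (S ^+ size (skew_cells la mu)).
Proof.
move=> s us; rewrite (bigID (fun t => `[< exists n, tableau n la mu t >])) /=.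
rewrite [X in _ + X]big1 ?addr0; last by move=> t /negPf h; rewrite /tabfull h vnorm0.
rewrite -big_filter; set s' := [seq _ <- _ | _].
apply: le_trans (@sum_prod_bdd (skew_cells la mu) g S s' g0 gS _ _).
- rewrite big_seq [leRHS]big_seq ler_sum// => t; rewrite mem_filter => /andP[h _].
  rewrite /tabfull h vnorm_prod big_seq [leRHS]big_seq ler_prod// => c cs.
  rewrite vnorm_ge0 /=; have /asboolP[n [_ + _ _]] := h.
  by move=> /(_ c); rewrite cs; case: (t c).
- exact: filter_uniq.
move=> t u; rewrite !mem_filter => /andP[/asboolP[n [_ ht _ _]] _] /andP[/asboolP[m [_ hu _ _]] _] tu.
apply/funext => c; case: (boolP (c \in skew_cells la mu)) => cs; first exact: tu.
have := ht c; have := hu c; rewrite (negPf cs).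
by case: (t c) => [|//]; case: (u c).
Qed.

Lemma tabterm_le n la mu t : vnorm (tabterm n x la mu t) <= vnorm (tabfull x la mu t).
Proof.
rewrite /tabterm /tabfull; case: asboolP => h; last by rewrite vnorm0 vnorm_ge0.
by rewrite ifT//; apply/asboolP; exists n.
Qed.

Lemma tabterm_cvg la mu t : kcvg (fun n => tabterm n x la mu t) (tabfull x la mu t).
Proof.
move=> e e0; rewrite /tabfull; case: asboolP => [[N hN]|h].
  exists N => n Nn; rewrite /tabterm ifT ?subrr ?vnorm0//; apply/asboolP.
  by have [h1 h2 h3 h4] := hN; split=> // c; exact: leq_trans (h3 c) Nn.
exists 0%N => n _; rewrite /tabterm ifF ?subrr ?vnorm0//; apply/negP => /asboolP ht.
by apply: h; exists n.
Qed.

Lemma skew_schur_has_usum la mu : subpart mu la ->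
  has_usum (tabfull x la mu) (skew_schur la mu x).
Proof.
move=> sub; have [s hs] := has_usum_ex (tabfull_bdd la mu).
rewrite (_ : skew_schur la mu x = s)// /skew_schur sub; apply: usum_has.
pose h (T : filling la mu) : cellfun := fun c => if insub c is Some d then T d else 0%N.
pose k (t : cellfun) : filling la mu := [ffun c => t (val c)].
have hE T (c : seq_sub (skew_cells la mu)) : h T (val c) = T c by rewrite /h valK.
have prodE (T : filling la mu) : \prod_c x (T c) = \prod_(c <- skew_cells la mu) x (h T c).
  transitivity (\prod_(c <- [seq val c | c <- enum {: seq_sub (skew_cells la mu)}]) x (h T c)).
    by rewrite big_map big_enum; apply: eq_bigr => c _; rewrite hE.
  apply: perm_big; apply: uniq_perm; last first.
  - move=> c; apply/mapP/idP => [[d _ ->]|cs]; first exact: valP.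
    by exists (SeqSub cs) => //; rewrite mem_enum.
  - exact: skew_uniq.
  - by rewrite map_inj_uniq ?enum_uniq//; exact: val_inj.
have hQ T : semistandard T -> `[< exists n, tableau n la mu (h T) >] /\ k (h T) = T.
  move=> /andP[/forallP pos /forallP mon]; split; last first.
    by apply/ffunP => c; rewrite ffunE hE.
  apply/asboolP; exists (\max_c T c)%N; split=> //.
  - move=> c; rewrite /h; case: insubP => [d cs <-|/negPf ->//].
    by rewrite pos; exact: valP.
  - by move=> c; rewrite /h; case: insubP => // d _ _; exact: leq_bigmax.
  move=> c d cs ds; have /forallP/(_ (SeqSub ds))/andP[/implyP h1 /implyP h2] := mon (SeqSub cs).
  have hc : h T c = T (SeqSub cs) := hE T (SeqSub cs).
  have hd : h T d = T (SeqSub ds) := hE T (SeqSub ds).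
  rewrite hc hd; split=> e1 e2.
    by apply: h1; rewrite /= e1 eqxx.
  by apply: h2; rewrite /= e1 eqxx.
have hP t : `[< exists n, tableau n la mu t >] -> semistandard (k t) /\ h (k t) = t.
  move=> /asboolP[n [_ pos _ mon]]; split; last first.
    apply/funext => c; rewrite /h; case: insubP => [d cs dc|cs]; first by rewrite ffunE dc.
    by move: (pos c); rewrite (negPf cs); case: (t c).
  apply/andP; split; first by apply/forallP => c; rewrite ffunE -pos; exact: valP.
  apply/forallP => c; apply/forallP => d; rewrite !ffunE.
  have [h1 h2] := mon _ _ (valP c) (valP d).
  by apply/andP; split; apply/implyP => /andP[/eqP e1 e2]; [exact: h1|exact: h2].
have := has_usum_reindex hQ hP (F := fun t => \prod_(c <- skew_cells la mu) x (t c)) hs.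
by apply: eq_has_usum => T; rewrite prodE.
Qed.

Lemma schurn_cvg la mu : kcvg (fun n => lk (schurn n x) la mu) (skew_schur la mu x).
Proof.
case: (boolP (subpart mu la)) => sub; last first.
  rewrite /skew_schur (negPf sub); apply: eq_kcvg (kcvg_cst 0) => n.
  by rewrite lk_sub.
apply: (has_usum_dominated_cvg (F := fun n => tabterm n x la mu) _ (tabfull_bdd la mu)).
- by move=> t; exact: vnorm_ge0.
- by move=> n t; exact: tabterm_le.
- by move=> t; exact: tabterm_cvg.
- by move=> n; have [] := tabterm_sum x n la mu.
- exact: skew_schur_has_usum.
Qed.

End Limits.

Lemma real_norm_eq0 (R : realType) (x : R) : `|x| = 0 <-> x = 0.
Proof. by split=> [/normr0_eq0//|->]; rewrite normr0. Qed.

(* The real numbers themselves, so that the bounds are skew Schur functions too. *)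
Definition real_valued (R : realType) : completeValuedField R :=
  @CompleteValuedField R R (fun x => `|x|) (@normr_ge0 _ _)
    (@real_norm_eq0 R) (@normrM _) (@ler_normD _ _) (@real_complete R).

Section Alphabets.
Variables (R : realType) (K : completeValuedField R).
Implicit Types (la mu nu : part).
Local Notation RR := (real_valued R).

Record alphabet := Alphabet {
  ax :> nat -> K;
  asum : R;
  ax_bdd : sumlim (fun k => ax k.+1) asum }.
Implicit Types (x y : alphabet) (A B : tker K).

Definition absx (x : nat -> K) : nat -> RR := fun k => vnorm (x k).

Lemma absx_bdd x : sumlim (fun k => absx x k.+1) (asum x).
Proof. by apply: sum_bdd_le (ax_bdd x) => k; rewrite /= ger0_norm ?vnorm_ge0. Qed.

Lemma lb_schurn n (x : nat -> K) la mu : lb (schurn n x) la mu = lk (schurn n (absx x)) la mu.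
Proof.
elim: n la mu => [//|n IH] la mu; rewrite !schurnS /=.
by apply: eq_bigr => nu _; rewrite IH.
Qed.

Definition bschur (x : nat -> K) la mu : R := skew_schur la mu (absx x).

Lemma bschur_cvg x la mu e : 0 < e ->
  exists N, forall n, (N <= n)%N -> `|lb (schurn n x) la mu - bschur x la mu| < e.
Proof.
move=> e0; have [N hN] := schurn_cvg (absx_bdd x) la mu e0.
by exists N => n /hN; rewrite -lb_schurn.
Qed.

Lemma lb_schurn_mono n m (x : nat -> K) la mu : (n <= m)%N ->
  lb (schurn n x) la mu <= lb (schurn m x) la mu.
Proof.
move=> /subnK <-; elim: (m - n)%N => [//|k IH]; rewrite addSn (le_trans IH)// schurnS /=.
rewrite (big_rem la) ?mem_subs ?subpart_refl//= /hk hstrip_refl subnn expr0 mul1r lerDl.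
by rewrite sumr_ge0// => nu _; rewrite mulr_ge0 ?lb_ge0 ?hk_ge0 ?vnorm_ge0.
Qed.

Lemma lb_schurn_le n x la mu : lb (schurn n x) la mu <= bschur x la mu.
Proof.
apply/ler_addgt0Pr => e e0; have [N hN] := bschur_cvg x la mu e0.
have := hN (maxn n N) (leq_maxr _ _); rewrite ltr_norml => /andP[_ h].
apply: le_trans (lb_schurn_mono _ _ _ (leq_maxl n N)) _.
by rewrite -lerBlDl ltW.
Qed.

Lemma bschur_sub x la mu : ~~ subpart mu la -> bschur x la mu = 0.
Proof. by move=> /negPf h; rewrite /bschur /skew_schur h. Qed.

Lemma skew_schur_sub (x : nat -> K) la mu : ~~ subpart mu la -> skew_schur la mu x = 0.
Proof. by move=> /negPf h; rewrite /skew_schur h. Qed.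

Lemma skew_schur_le x la mu : vnorm (skew_schur la mu x) <= bschur x la mu.
Proof.
apply/ler_addgt0Pr => e e0; have [N hN] := schurn_cvg (ax_bdd x) la mu e0.
have := hN N (leqnn _); rewrite vnorm_distC => h.
apply: le_trans (vnorm_le_dist _ (lk (schurn N x) la mu)) _.
by rewrite addrC lerD ?(ltW h)// (le_trans (lk_le _ _ _))// lb_schurn_le.
Qed.

Definition schur x : tker K :=
  TKer (@skew_schur_sub x) (@bschur_sub x) (@skew_schur_le x).

Section Prime.
Variable A : tker K.
Let pk la mu := lk A (transpose la) (transpose mu).
Let pb la mu := lb A (transpose la) (transpose mu).
Let pk_sub la mu : ~~ subpart mu la -> pk la mu = 0.
Proof. by rewrite -subpart_transpose; exact: lk_sub. Qed.
Let pb_sub la mu : ~~ subpart mu la -> pb la mu = 0.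
Proof. by rewrite -subpart_transpose; exact: lb_sub. Qed.
Let pk_le la mu : vnorm (pk la mu) <= pb la mu. Proof. exact: lk_le. Qed.
Definition tprime : tker K := TKer pk_sub pb_sub pk_le.
End Prime.

Lemma sum_subs_transpose (T : nmodType) mu (F : part -> T) :
  \sum_(ka <- subs mu) F (transpose ka) = \sum_(ka <- subs (transpose mu)) F ka.
Proof.
rewrite -(big_map transpose xpredT F); apply: perm_big; apply: uniq_perm => [||ka].
- by rewrite map_inj_uniq ?subs_uniq//; exact: inv_inj transposeK.
- exact: subs_uniq.
rewrite mem_subs -(subpart_transpose ka) transposeK -mem_subs.
by rewrite -{1}(transposeK ka) mem_map//; exact: inv_inj transposeK.
Qed.

Lemma comm_prime A B c cb : comm A B c cb -> comm (tprime A) (tprime B) c cb.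
Proof.
move=> h mu nu; have [h1 h2] := h (transpose mu) (transpose nu).
rewrite -sum_subs_transpose in h1; rewrite -sum_subs_transpose in h2; split=> /=.
  move=> s us; have := h1 (map transpose s); rewrite big_map map_inj_uniq; first exact.
  exact: inv_inj transposeK.
exact: (has_usum_bij transposeK transposeK h2).
Qed.

Lemma tprime_mul A B : keq (tprime (lmul A B)) (lmul (tprime A) (tprime B)).
Proof. by split=> la mu /=; rewrite -sum_subs_transpose. Qed.

Lemma tprime_one : keq (tprime (lone K)) (lone K).
Proof. by split=> la mu /=; rewrite (inj_eq (inv_inj transposeK)). Qed.

Lemma tprime_prod s : keq (tprime (lprod s)) (lprod (map tprime s)).
Proof.
elim: s => [|A s IH] /=; first exact: tprime_one.
by apply: keq_trans (tprime_mul _ _) _; apply: keq_lmul.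
Qed.

(* Kernels for Gamma (eps = false) and Gamma' (eps = true). *)
Definition kern (eps : bool) A := if eps then tprime A else A.

Lemma kern_prod eps s : keq (kern eps (lprod s)) (lprod (map (kern eps) s)).
Proof.
case: eps; first exact: tprime_prod.
have -> : map (kern false) s = s by elim: s => //= A s ->.
by split.
Qed.

Lemma comm_le A B c cb cb' : cb <= cb' -> comm A B c cb -> comm A B c cb'.
Proof.
move=> cc h mu nu; have [h1 h2] := h mu nu; split=> // s us.
apply: (le_trans (h1 s us)); rewrite ler_wpM2r//.
by rewrite sumr_ge0// => ka _; rewrite mulr_ge0 ?lb_ge0.
Qed.

Lemma comm_onek (a b : K) : vnorm a * vnorm b < 1 ->
  comm (onek a) (onek b) (1 - a * b)^-1 (1 - vnorm a * vnorm b)^-1.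
Proof.
by move=> ab mu nu; split; [apply: cauchy_one_bdd; rewrite ?vnorm_ge0|exact: cauchy_one].
Qed.

Lemma comm_onek_dual (a b : K) :
  comm (onek a) (tprime (onek b)) (1 + a * b) (1 + vnorm a * vnorm b).
Proof.
move=> mu nu; pose s := parts_in (size mu).+1 (prow nu 0).+1.
have us : uniq s by exact: undup_uniq.
have hs la : hstrip la mu -> vstrip la nu -> la \in s.
  move=> /hstripP h /vstripP v; apply: mem_parts_in; last by have /andP[] := v 0%N.
  rewrite leqNgt -prow_gt0 -leqNgt; have /andP[h1 _] := h (size mu).
  by rewrite (leq_trans h1)// prow_eq0.
have notin (T : comNzRingType) (u v : T) la : la \notin s -> hk u la mu * vk v la nu = 0 :> T.
  move=> ls; case: (boolP (hstrip la mu)) => h; last by rewrite /hk (negPf h) mul0r.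
  case: (boolP (vstrip la nu)) => v'; last by rewrite vkE (negPf v') mulr0.
  by rewrite (hs _ h v') in ls.
split=> /=; last first.
  have := dual_cauchy_one a b us hs; rewrite /vk => <-.
  by apply: has_usum_fin us _ => la; exact: notin.
have E := dual_cauchy_one (vnorm a) (vnorm b) us hs; rewrite /vk in E; rewrite -E => s' us'.
rewrite (bigID (fun la => la \in s)) /= [X in _ + X]big1 ?addr0; last first.
  by move=> la; exact: notin.
rewrite -big_filter [leRHS](bigID (fun la => la \in s')) /= -[leLHS]addr0 lerD//; last first.
  by rewrite sumr_ge0// => la _; rewrite mulr_ge0 ?hk_ge0 ?vnorm_ge0.
rewrite -[leRHS]big_filter le_eqVlt; apply/orP; left; apply/eqP/perm_big.
apply: uniq_perm; [exact: filter_uniq|exact: filter_uniq us|move=> la].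
by rewrite [LHS]mem_filter [RHS]mem_filter andbC.
Qed.

Definition weight (e : bool) (q : K) : K := if e then (1 - q)^-1 else 1 + q.

Lemma comm_kern_onek (e f : bool) (a b : K) (rho : R) : 0 <= rho < 1 ->
  (e = f -> vnorm (a * b) <= rho) ->
  comm (kern e (onek a)) (kern f (onek b)) (weight (e == f) (a * b))
    (expR (vnorm (a * b) / (1 - rho))).
Proof.
move=> /andP[r0 r1] hr; have r1' : 0 < 1 - rho by rewrite subr_gt0.
have q0 := vnorm_ge0 (a * b).
have dual_le : 1 + vnorm a * vnorm b <= expR (vnorm (a * b) / (1 - rho)).
  rewrite -vnormM (le_trans (expR_ge1Dx _))// ler_expR ler_pdivlMr// ler_piMr//; lra.
have same : e = f -> comm (onek a) (onek b) (1 - a * b)^-1 (expR (vnorm (a * b) / (1 - rho))).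
  move=> /hr h; have q1 : vnorm a * vnorm b < 1 by rewrite -vnormM (le_lt_trans h).
  apply: comm_le (comm_onek q1); rewrite -vnormM in q1 *.
  apply: le_trans (expR_ge1Dx _); rewrite -[leLHS]div1r ler_pdivrMr ?subr_gt0//.
  have : vnorm (a * b) <= vnorm (a * b) / (1 - rho) * (1 - vnorm (a * b)).
    by rewrite mulrAC ler_pdivlMr// ler_wpM2l// lerD2l lerN2.
  lra.
case: e f hr same => [] [] hr same /=.
- by apply: comm_prime; apply: same.
- apply: comm_sym; rewrite {1}(mulrC a b); apply: comm_le (comm_onek_dual b a).
  by rewrite (mulrC (vnorm b)).
- exact: comm_le (comm_onek_dual a b).
- exact: same.
Qed.

Lemma big_rev_iota (T : Type) (idx : T) (op : Monoid.com_law idx) n (F : nat -> T) :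
  \big[op/idx]_(k <- rev (iota 1 n)) F k = \big[op/idx]_(1 <= k < n.+1) F k.
Proof. by rewrite (perm_big (iota 1 n)) ?perm_rev// /index_iota subn1. Qed.

Lemma comm_schurn (e f : bool) n x y (rho : R) : 0 <= rho < 1 ->
  (e = f -> forall k l, (0 < k)%N -> (0 < l)%N -> vnorm (x k * y l) <= rho) ->
  comm (kern e (schurn n x)) (kern f (schurn n y))
    (\prod_(1 <= k < n.+1) \prod_(1 <= l < n.+1) weight (e == f) (x k * y l))
    (expR (asum x * asum y / (1 - rho))).
Proof.
move=> /[dup] r01 /andP[r0 r1] hr; have r1' : 0 < 1 - rho by rewrite subr_gt0.
have := @comm_lprod _ _ _ _ (fun k => kern e (onek (x k))) (fun l => kern f (onek (y l)))
  (rev (iota 1 n)) (rev (iota 1 n)) (fun k l => weight (e == f) (x k * y l))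
  (fun k l => expR (vnorm (x k * y l) / (1 - rho))).
move=> /(_ (fun _ _ => expR_ge0 _)) h.
have {}h : comm (kern e (schurn n x)) (kern f (schurn n y))
   (\prod_(k <- rev (iota 1 n)) \prod_(l <- rev (iota 1 n)) weight (e == f) (x k * y l))
   (\prod_(k <- rev (iota 1 n)) \prod_(l <- rev (iota 1 n)) expR (vnorm (x k * y l) / (1 - rho))).
  apply: keq_comm (h _).
  - by apply: keq_sym; rewrite /schurn; apply: keq_trans (kern_prod _ _) _; rewrite -map_comp; split.
  - by apply: keq_sym; rewrite /schurn; apply: keq_trans (kern_prod _ _) _; rewrite -map_comp; split.
  move=> k l; rewrite !mem_rev !mem_iota => /andP[k0 _] /andP[l0 _].
  by apply: comm_kern_onek => // ef; exact: hr.
have E : \prod_(k <- rev (iota 1 n)) \prod_(l <- rev (iota 1 n)) weight (e == f) (x k * y l) =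
    \prod_(1 <= k < n.+1) \prod_(1 <= l < n.+1) weight (e == f) (x k * y l).
  by rewrite big_rev_iota; apply: eq_bigr => k _; rewrite big_rev_iota.
rewrite E in h.
apply: comm_le h; under eq_bigr do rewrite -expR_sum.
rewrite -expR_sum ler_expR.
under eq_bigr do rewrite -mulr_suml.
rewrite -mulr_suml ler_wpM2r ?invr_ge0 ?(ltW r1')//.
under eq_bigr do under eq_bigr do rewrite vnormM.
under eq_bigr do rewrite -mulr_sumr.
rewrite -mulr_suml.
have sx (z : alphabet) : \sum_(k <- rev (iota 1 n)) vnorm (z k) <= asum z.
  by rewrite big_rev_iota big_add1 /=; apply: (ax_bdd z); exact: iota_uniq.
by rewrite ler_pM ?sx// sumr_ge0// => k _; exact: vnorm_ge0.
Qed.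

Lemma kern_schurn_cvg e x la mu :
  kcvg (fun n => lk (kern e (schurn n x)) la mu) (lk (kern e (schur x)) la mu).
Proof. by case: e => /=; apply: schurn_cvg; exact: ax_bdd. Qed.

Lemma kern_schurn_lb_cvg e x la mu :
  @kcvg R RR (fun n => lb (kern e (schurn n x)) la mu) (lb (kern e (schur x)) la mu).
Proof. by case: e => eps e0 /=; apply: bschur_cvg. Qed.

Lemma kern_schurn_lb_le e n x la mu :
  lb (kern e (schurn n x)) la mu <= lb (kern e (schur x)) la mu.
Proof. by case: e => /=; exact: lb_schurn_le. Qed.

Definition weight_lim (e : bool) x y : K :=
  if e then (Phi (fun k l => x k * y l))^-1 else Phi (fun k l => - (x k * y l)).

Lemma dsummable_mul x y : dsummable (fun k l => x k * y l) (asum x * asum y).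
Proof.
apply: (sum_bdd_pair (B := fun k => vnorm (x k.+1) * asum y)).
- by move=> p; exact: vnorm_ge0.
- move=> k; apply: sum_bdd_le (sum_bddZ (vnorm_ge0 _) (ax_bdd y)) => l.
  by rewrite vnormM.
move=> s us; rewrite -mulr_suml ler_wpM2r//; first exact: sum_bdd_ge0 (ax_bdd y).
exact: (ax_bdd x).
Qed.

Lemma weight_lim_cvg (e : bool) x y :
  (e -> forall k l, (0 < k)%N -> (0 < l)%N -> x k * y l != 1) ->
  kcvg (fun n => \prod_(1 <= k < n.+1) \prod_(1 <= l < n.+1) weight e (x k * y l))
    (weight_lim e x y).
Proof.
have h := dsummable_mul x y; case: e => /= h1.
  apply: eq_kcvg (kcvgV (Phi_neq0 h (h1 isT)) (Phi_cvg h)) => n.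
  by rewrite -prodfV; apply: eq_bigr => k _; rewrite -prodfV.
have hN : dsummable (fun k l => - (x k * y l)) (asum x * asum y).
  by apply: sum_bdd_le h => i; rewrite vnormN.
apply: eq_kcvg (Phi_cvg hN) => n.
by apply: eq_bigr => k _; apply: eq_bigr => l _; rewrite opprK.
Qed.

Lemma comm_schur (e f : bool) x y (rho : R) : 0 <= rho < 1 ->
  (e = f -> forall k l, (0 < k)%N -> (0 < l)%N -> vnorm (x k * y l) <= rho) ->
  comm (kern e (schur x)) (kern f (schur y)) (weight_lim (e == f) x y)
    (expR (asum x * asum y / (1 - rho))).
Proof.
move=> /[dup] r01 /andP[r0 r1] hr mu nu.
have hn n := comm_schurn n r01 hr mu nu.
set cb := expR _ in hn *.
pose Sn n := \sum_(ka <- subs mu) lb (kern f (schurn n y)) mu ka * lb (kern e (schurn n x)) nu ka.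
pose G la := lb (kern e (schur x)) la mu * lb (kern f (schur y)) la nu.
have SnS n : Sn n <= \sum_(ka <- subs mu) lb (kern f (schur y)) mu ka * lb (kern e (schur x)) nu ka.
  by apply: ler_sum => ka _; rewrite ler_pM ?lb_ge0// kern_schurn_lb_le.
have bd : sum_bdd G
    (cb * \sum_(ka <- subs mu) lb (kern f (schur y)) mu ka * lb (kern e (schur x)) nu ka).
  move=> s us; apply/ler_addgt0Pr => eps e0.
  have hc := @kcvg_sum R RR part s xpredT _ _ (fun la _ =>
     kcvgM (kern_schurn_lb_cvg e x la mu) (kern_schurn_lb_cvg f y la nu)).
  have [N hN] := hc _ e0.
  have := hN N (leqnn _); rewrite /= ltr_norml => /andP[h1 _].
  have [h2 _] := hn N; have h3 := h2 s us.
  have h4 : cb * Sn N <= cb * \sum_(ka <- subs mu) lb (kern f (schur y)) mu ka * lb (kern e (schur x)) nu ka.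
    by rewrite ler_wpM2l ?expR_ge0.
  move: h1 h3 h4; rewrite /Sn /G; lra.
split=> //.
have wc : kcvg (fun n => \prod_(1 <= k < n.+1) \prod_(1 <= l < n.+1) weight (e == f) (x k * y l))
    (weight_lim (e == f) x y).
  apply: weight_lim_cvg => /eqP/hr h k l k0 l0; apply/eqP => xy.
  by have := h k l k0 l0; rewrite xy vnorm1 leNgt r1.
apply: (has_usum_dominated (F := fun n la => lk (kern e (schurn n x)) la mu * lk (kern f (schurn n y)) la nu) _ bd).
- by move=> la; rewrite mulr_ge0 ?lb_ge0.
- move=> n la; rewrite vnormM ler_pM ?vnorm_ge0// (le_trans (lk_le _ _ _))//; exact: kern_schurn_lb_le.
- by move=> la; apply: kcvgM; exact: kern_schurn_cvg.
- by move=> n; exact: (hn n).2.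
apply: kcvgM wc _; apply: kcvg_sum => ka _; apply: kcvgM; exact: kern_schurn_cvg.
Qed.

Lemma schurn_diag n (x : nat -> K) mu : lk (schurn n x) mu mu = 1 /\ lb (schurn n x) mu mu = 1.
Proof.
elim: n => [|n [IH1 IH2]]; first by rewrite /= eqxx.
have H (T : comNzRingType) (A : part -> part -> T) (a : T) :
    (forall ka, ~~ subpart mu ka -> A ka mu = 0) -> A mu mu = 1 ->
    \sum_(nu <- subs mu) hk a mu nu * A nu mu = 1.
  move=> A0 A1; rewrite (big_rem mu) ?mem_subs ?subpart_refl//= /hk hstrip_refl subnn expr0 mul1r A1.
  rewrite big_seq big1 ?addr0// => nu; rewrite rem_filter ?subs_uniq// mem_filter mem_subs => /andP[/= nm sn].
  rewrite A0 ?mulr0//; apply: contraNN nm => sm.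
  by rewrite (subpart_anti sn sm).
rewrite schurnS; split => /=; apply: H => //; move=> ka h; [exact: lk_sub|exact: lb_sub].
Qed.

Lemma kern_schur_diag e x mu : lk (kern e (schur x)) mu mu = 1 /\ lb (kern e (schur x)) mu mu = 1.
Proof.
have H nu : lk (schur x) nu nu = 1 /\ lb (schur x) nu nu = 1.
  split.
    apply: (kcvg_unique (schurn_cvg (ax_bdd x) nu nu)).
    by apply: eq_kcvg (kcvg_cst 1) => n; rewrite (schurn_diag n x nu).1.
  apply: (@kcvg_unique R RR (fun n => lb (schurn n x) nu nu)).
    by move=> eps e0; apply: bschur_cvg.
  by apply: eq_kcvg (kcvg_cst (1 : RR)) => n; rewrite (schurn_diag n x nu).2.
by case: e => /=; [exact: H|exact: H].
Qed.

Lemma schurn_scale n q (x : nat -> K) :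
  keq (schurn n (fun k => q * x k)) (lscale q (schurn n x)).
Proof.
elim: n => [|n IH]; first by apply: keq_sym; exact: lscale_one.
rewrite !schurnS; apply: keq_trans _ (keq_sym (lscale_mul _ _ _)).
apply: keq_lmul IH; split=> la mu /=; rewrite /hk ?vnormM; case: ifP => _; rewrite ?mulr0// exprMn//.
Qed.

End Alphabets.

(** * Words in vertex operators *)

Section Words.
Variables (R : realType) (K : completeValuedField R).
Implicit Types (la mu nu : part) (x y : alphabet K) (A B C : tker K) (s t : seq (tker K)).
Implicit Types (X Y : operator K).
Local Notation RR := (real_valued R).

Lemma scale_bdd q x : sumlim (fun k => q * x k.+1) (vnorm q * asum x).
Proof. by apply: sum_bdd_le (sum_bddZ (vnorm_ge0 q) (ax_bdd x)) => k; rewrite vnormM. Qed.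

Definition ascale q x : alphabet K := Alphabet (ax := fun k => q * x k) (scale_bdd q x).

Lemma kern_schur_scale e q x : keq (lscale q (kern e (schur x))) (kern e (schur (ascale q x))).
Proof.
have H la mu : q ^+ (psize la - psize mu) * lk (schur x) la mu = lk (schur (ascale q x)) la mu /\
    vnorm q ^+ (psize la - psize mu) * lb (schur x) la mu = lb (schur (ascale q x)) la mu.
  split.
    apply: (kcvg_unique _ (schurn_cvg (ax_bdd (ascale q x)) la mu)).
    apply: eq_kcvg (kcvgM (kcvg_cst _) (schurn_cvg (ax_bdd x) la mu)) => n.
    by rewrite (schurn_scale n q x).1.
  apply: (@kcvg_unique R RR (fun n => lb (schurn n (ascale q x)) la mu)); last first.
    by move=> eps e0; apply: bschur_cvg.
  apply: (@eq_kcvg _ RR (fun n => vnorm q ^+ (psize la - psize mu) * lb (schurn n x) la mu)).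
    by move=> n; rewrite (schurn_scale n q x).2.
  apply: (@kcvgM _ RR (fun=> _)); first exact: kcvg_cst.
  by move=> eps e0; apply: bschur_cvg.
case: e => /=; last by split=> la mu; have [] := H la mu.
by split=> la mu /=; have [h1 h2] := H (transpose la) (transpose mu);
  rewrite -[psize la]psize_transpose -[psize mu]psize_transpose.
Qed.

Lemma keq_refl A : keq A A. Proof. by split. Qed.

Lemma lmul_assoc A B C : keq (lmul A (lmul B C)) (lmul (lmul A B) C).
Proof.
split=> la mu /=.
  under eq_bigr do rewrite mulr_sumr; under [RHS]eq_bigr do rewrite mulr_suml.
  rewrite [RHS]exchange_big /= [LHS]big_seq [RHS]big_seq; apply: eq_bigr => nu.
  rewrite mem_subs => nl; rewrite (sum_subs_wide nl).
    by apply: eq_bigr => ka _; rewrite mulrA.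
  by move=> s /lk_sub ->; rewrite mul0r mulr0.
under eq_bigr do rewrite mulr_sumr; under [RHS]eq_bigr do rewrite mulr_suml.
rewrite [RHS]exchange_big /= [LHS]big_seq [RHS]big_seq; apply: eq_bigr => nu.
rewrite mem_subs => nl; rewrite (sum_subs_wide nl).
  by apply: eq_bigr => ka _; rewrite mulrA.
by move=> s /lb_sub ->; rewrite mul0r mulr0.
Qed.

Lemma lmul1 A : keq (lmul (lone K) A) A.
Proof.
split=> la mu /=; rewrite (big_rem la) ?mem_subs ?subpart_refl//= eqxx mul1r;
  rewrite big_seq big1 ?addr0// => nu; rewrite rem_filter ?subs_uniq// mem_filter => /andP[/= /negPf h _];
  by rewrite eq_sym h mul0r.
Qed.

Lemma lprod_cat s t : keq (lmul (lprod s) (lprod t)) (lprod (s ++ t)).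
Proof.
elim: s => [|A s IH] /=; first exact: lmul1.
apply: keq_trans (keq_sym (lmul_assoc _ _ _)) _.
by apply: keq_lmul => //; exact: keq_refl.
Qed.

Lemma keq_normal (X : operator K) c A A' B B' :
  keq A A' -> keq B B' -> normal X c A B -> normal X c A' B'.
Proof.
move=> [h1 _] [h2 _] h la mu; rewrite h /lsum; congr (_ * _).
by apply: eq_bigr => ka _; rewrite h1 h2.
Qed.

Definition normalL (X : operator K) c s t := normal X c (lprod s) (lprod t).

Lemma normalL_mul X cX s t Y cY s' t' c cb :
  normalL X cX s t -> normalL Y cY s' t' -> comm (lprod t) (lprod s') c cb ->
  normalL (X ** Y) (c * cX * cY) (s ++ s') (t' ++ t).
Proof.
move=> hX hY h; apply: keq_normal (lprod_cat _ _) (lprod_cat _ _) _.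
exact: normal_mul hX hY h.
Qed.

Lemma lprod1 A : keq A (lprod [:: A]).
Proof.
apply: keq_sym; split=> la mu /=.
  have := lsum_loner A la mu; rewrite /lsum /= => e; rewrite -[RHS]e.
  by apply: eq_bigr => nu _; rewrite eq_sym.
case: (boolP (subpart mu la)) => h; last first.
  rewrite lb_sub// big_seq big1// => ka; rewrite mem_subs.
  by case: eqP => [->|_]; [rewrite (negPf h)|rewrite mulr0].
rewrite (big_rem mu) ?mem_subs//= eqxx mulr1 big_seq big1 ?addr0// => ka.
by rewrite rem_filter ?subs_uniq// mem_filter => /andP[/= /negPf ->]; rewrite mulr0.
Qed.

Lemma normalL_minus A : normalL (lk A) 1 [:: A] [::].
Proof. exact: keq_normal (lprod1 A) (keq_refl _) (normal_minus A). Qed.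

Lemma normalL_plus A : normalL (fun mu la => lk A la mu) 1 [::] [:: A].
Proof. exact: keq_normal (keq_refl _) (lprod1 A) (normal_plus A). Qed.

Lemma lprod_diag (T : Type) (f : T -> tker K) (s : seq T) mu :
  (forall a, lk (f a) mu mu = 1 /\ lb (f a) mu mu = 1) ->
  lk (lprod (map f s)) mu mu = 1 /\ lb (lprod (map f s)) mu mu = 1.
Proof.
move=> h; elim: s => [|a s [IH1 IH2]]; first by rewrite /= eqxx.
have H (U : nzRingType) (A B : part -> part -> U) :
    (forall ka, ~~ subpart mu ka -> B ka mu = 0) -> A mu mu = 1 -> B mu mu = 1 ->
    \sum_(nu <- subs mu) A mu nu * B nu mu = 1.
  move=> B0 A1 B1; rewrite (big_rem mu) ?mem_subs ?subpart_refl//= A1 B1 mulr1.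
  rewrite big_seq big1 ?addr0// => nu; rewrite rem_filter ?subs_uniq// mem_filter mem_subs => /andP[/= nm sn].
  rewrite B0 ?mulr0//; apply: contraNN nm => sm.
  by rewrite (subpart_anti sn sm).
have [h1 h2] := h a.
by split => /=; apply: H => // ka hk; [exact: lk_sub|exact: lb_sub].
Qed.

End Words.

Section Blocks.
Variables (R : realType) (K : completeValuedField R) (r : nat).
(* The alphabets of the annihilation operators (P) and of the creation operators
   (L) in the i-th block; eps = true stands for the primed operators. *)
Variables (P L : 'I_r -> bool -> alphabet K) (rho : R).
Hypothesis rho01 : 0 <= rho < 1.
Local Notation idx := ('I_r * bool)%type.

Definition kP (q : K) (a : idx) : tker K := kern a.2 (schur (ascale q (P a.1 a.2))).
Definition kL (a : idx) : tker K := kern a.2 (schur (L a.1 a.2)).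
Definition omega (q : K) (a b : idx) : K :=
  weight_lim (a.2 == b.2) (ascale q (P a.1 a.2)) (L b.1 b.2).

Definition small (q : K) (i j : 'I_r) := forall e k l, (0 < k)%N -> (0 < l)%N ->
  vnorm (q * (P i e k * L j e l)) <= rho.

Lemma comm_kPL q (a b : idx) : (a.2 = b.2 -> small q a.1 b.1) ->
  comm (kP q a) (kL b) (omega q a b)
    (expR (asum (ascale q (P a.1 a.2)) * asum (L b.1 b.2) / (1 - rho))).
Proof.
move=> h; apply: comm_schur => // ab k l k0 l0 /=.
by rewrite -mulrA; have := h ab a.2 k l k0 l0; rewrite {2}ab.
Qed.

Definition Lidx (i : 'I_r) : seq idx := [:: (i, true); (i, false)].
Definition Pidx (i : 'I_r) : seq idx := [:: (i, false); (i, true)].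

Definition block i : operator K :=
  Gamma'_minus (L i true) ** Gamma'_plus (P i true) **
  Gamma_minus (L i false) ** Gamma_plus (P i false).

Lemma keq_kP1 (a : idx) : keq (kern a.2 (schur (P a.1 a.2))) (kP 1 a).
Proof.
apply: keq_trans (kern_schur_scale _ 1 _); apply: keq_sym.
by split=> la mu /=; rewrite ?vnorm1 expr1n mul1r.
Qed.

Lemma normalL_block i :
  normalL (block i) (omega 1 (i, true) (i, false)) (map kL (Lidx i)) (map (kP 1) (Pidx i)).
Proof.
have plusE e : normalL (fun mu la => lk (kern e (schur (P i e))) la mu) 1 [::] [:: kP 1 (i, e)].
  apply: keq_normal (keq_refl _) _ (normalL_plus (kern e (schur (P i e)))).
  by apply: keq_lmul (keq_refl _); exact: (keq_kP1 (i, e)).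
have minusE e : normalL (lk (kern e (schur (L i e)))) 1 [:: kL (i, e)] [::] := normalL_minus _.
have c00 : comm (lprod [::]) (lprod [::]) (1 : K) 1 := comm_loner _.
have h1 := normalL_mul (minusE true) (plusE true) c00.
have hc : comm (lprod [:: kP 1 (i, true)]) (lprod [:: kL (i, false)])
    (omega 1 (i, true) (i, false)) (expR (asum (ascale 1 (P i true)) * asum (L i false) / (1 - rho))).
  by apply: keq_comm (lprod1 _) (lprod1 _) _; exact: comm_kPL.
have h2 := normalL_mul h1 (minusE false) hc.
have h3 := normalL_mul h2 (plusE false) (comm_loner _).
by move: h3; rewrite /= !mul1r !mulr1.
Qed.

Definition LL (s : seq 'I_r) := flatten [seq Lidx i | i <- s].
Definition PP (s : seq 'I_r) := flatten [seq Pidx i | i <- rev s].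

Lemma comm_lists q (s t : seq idx) :
  (forall a b, a \in s -> b \in t -> a.2 = b.2 -> small q a.1 b.1) ->
  comm (lprod (map (kP q) s)) (lprod (map kL t))
    (\prod_(a <- s) \prod_(b <- t) omega q a b)
    (\prod_(a <- s) \prod_(b <- t)
       expR (asum (ascale q (P a.1 a.2)) * asum (L b.1 b.2) / (1 - rho))).
Proof.
move=> h; apply: (comm_lprod (cb := fun a b => expR (asum (ascale q (P a.1 a.2)) * asum (L b.1 b.2) / (1 - rho)))) => [a b|a b as_ bt].
  exact: expR_ge0.
by apply: comm_kPL; exact: h.
Qed.

Lemma mem_LL s a : (a \in LL s) = (a.1 \in s).
Proof.
apply/flatten_mapP/idP => [[i si]|h]; first by rewrite !inE => /orP[] /eqP ->.
by exists a.1 => //; case: a h => i [] _; rewrite !inE eqxx ?orbT.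
Qed.

Lemma big_LL s (F : idx -> K) :
  \prod_(a <- LL s) F a = \prod_(i <- s) \prod_(e : bool) F (i, e).
Proof.
rewrite big_flatten big_map; apply: eq_bigr => i _.
by rewrite /Lidx big_cons big_seq1 big_bool.
Qed.

Lemma big_PP s (F : idx -> K) :
  \prod_(a <- PP s) F a = \prod_(i <- s) \prod_(e : bool) F (i, e).
Proof.
rewrite big_flatten big_map (perm_big s) ?perm_rev//; apply: eq_bigr => i _.
by rewrite /Pidx big_cons big_seq1 big_bool /= mulrC.
Qed.

Definition Omega q i j := \prod_(e : bool) \prod_(f : bool) omega q (i, e) (j, f).

Lemma big_PP_LL q s t : \prod_(a <- PP s) \prod_(b <- LL t) omega q a b =
  \prod_(i <- s) \prod_(j <- t) Omega q i j.
Proof.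
rewrite big_PP; apply: eq_bigr => i _; rewrite /Omega.
under [LHS]eq_bigr do rewrite big_LL.
by rewrite exchange_big.
Qed.

Hypothesis hsmall : forall i j : 'I_r, (j < i)%N -> small 1 i j.

Lemma normalL_word (s : seq 'I_r) : pairwise (fun i j : 'I_r => j < i)%N s ->
  normalL (\big[@opmul R K/@opid R K]_(i <- s) block i)
    ((\prod_(i <- s) omega 1 (i, true) (i, false)) *
     \prod_(i <- s) \prod_(j <- s | (j < i)%N) Omega 1 i j)
    (map kL (LL s)) (map (kP 1) (PP s)).
Proof.
elim: s => [_|i s IH]; first by rewrite !big_nil mulr1; exact: normal_id.
rewrite pairwise_cons => /andP[is_ ps].
rewrite big_cons.
have hsm a b : a \in Pidx i -> b \in LL s -> a.2 = b.2 -> small 1 a.1 b.1.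
  move=> ha; rewrite mem_LL => /(allP is_) h _.
  have -> : a.1 = i by move: ha; rewrite !inE => /orP[] /eqP ->.
  exact: hsmall h.
have h := normalL_mul (normalL_block i) (IH ps) (comm_lists hsm).
have E1 : map kL (LL (i :: s)) = map kL (Lidx i) ++ map kL (LL s) by rewrite -map_cat.
have E2 : map (kP 1) (PP (i :: s)) = map (kP 1) (PP s) ++ map (kP 1) (Pidx i).
  by rewrite -map_cat /PP rev_cons map_rcons flatten_rcons.
rewrite E1 E2 big_cons.
have -> : \prod_(i' <- i :: s) \prod_(j <- i :: s | (j < i')%N) Omega 1 i' j =
   (\prod_(a <- Pidx i) \prod_(b <- LL s) omega 1 a b) *
   \prod_(i' <- s) \prod_(j <- s | (j < i')%N) Omega 1 i' j.
  rewrite big_cons big_cons ltnn; congr (_ * _).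
    rewrite -[Pidx i]/(PP [:: i]) big_PP_LL.
    rewrite big_seq1 big_mkcond big_seq [RHS]big_seq; apply: eq_bigr => j /(allP is_) /= ->//.
  rewrite big_seq [RHS]big_seq; apply: eq_bigr => i' /(allP is_) /= h'.
  by rewrite big_cons ltnNge (ltnW h').
by congr (normalL _ _ _ _): h; ring.
Qed.

End Blocks.

Section KernelLists.
Variables (R : realType) (K : completeValuedField R).

Lemma keq_lprod_map (T : Type) (f g : T -> tker K) (s : seq T) :
  (forall a, keq (f a) (g a)) -> keq (lprod (map f s)) (lprod (map g s)).
Proof.
by move=> h; elim: s => [|a s IH] /=; [exact: keq_refl|exact: keq_lmul].
Qed.

Lemma keq_lscale q (A B : tker K) : keq A B -> keq (lscale q A) (lscale q B).
Proof. by move=> [h1 h2]; split=> la mu /=; rewrite ?h1 ?h2. Qed.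

End KernelLists.

Section WordTrace.
Variables (R : realType) (K : completeValuedField R) (r : nat).
Variables (P L : 'I_r -> bool -> alphabet K) (rho : R) (p Pinf Ginf : K).
Hypotheses (rho01 : 0 <= rho < 1) (p1 : vnorm p < 1).
Hypothesis hsmall : forall i j : 'I_r, (j < i)%N -> small P L rho 1 i j.
Hypothesis hsmallp : forall i j : 'I_r, small P L rho p i j.
Hypothesis hPinf : kcvg (fun n => \prod_(1 <= N < n.+1) (1 - p ^+ N)) Pinf.
Hypothesis Pinf0 : Pinf != 0.
Hypothesis hGinf : kcvg (fun n => \prod_(1 <= N < n.+1)
  \prod_(i < r) \prod_(j < r) Omega P L (p ^+ N) i j) Ginf.

Let s : seq 'I_r := [seq rev_ord i | i <- index_enum 'I_r].

Let s_desc : pairwise (fun i j : 'I_r => j < i)%N s.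
Proof.
rewrite pairwise_map.
have : pairwise ltn (map val (enum 'I_r)).
  rewrite val_enum_ord -sorted_pairwise; last exact: ltn_trans.
  exact: iota_ltn_sorted.
rewrite pairwise_map /index_enum -enumT; apply: sub_pairwise => i j /= ij.
by apply: ltn_sub2l; [exact: leq_ltn_trans ij (ltn_ord j)|rewrite ltnS].
Qed.

Let big_s (F : 'I_r -> K) : \prod_(i <- s) F i = \prod_(i < r) F i.
Proof.
rewrite big_map; apply/esym; rewrite (reindex_inj rev_ord_inj) /=.
by apply: eq_bigr.
Qed.

Let big_s2 (Q : 'I_r -> bool) (F : 'I_r -> K) :
  \prod_(i <- s | Q i) F i = \prod_(i < r | Q i) F i.
Proof. by rewrite big_mkcond big_s -big_mkcond. Qed.

Let A := lprod (map (kL L) (LL s)).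
Let B := lprod (map (kP P 1) (PP s)).

Let Z : R := \sum_(a <- PP s) \sum_(b <- LL s)
  asum (P a.1 a.2) * asum (L b.1 b.2) / (1 - rho).

Let Z0 : 0 <= Z.
Proof.
have /andP[r0 r1] := rho01.
rewrite sumr_ge0// => a _; rewrite sumr_ge0// => b _.
by rewrite divr_ge0 ?mulr_ge0 ?subr_ge0 ?(ltW r1)// (sum_bdd_ge0 (ax_bdd _)).
Qed.

Let hcomm k : (0 < k)%N -> comm (lscale (p ^+ k) B) A
  (\prod_(i < r) \prod_(j < r) Omega P L (p ^+ k) i j) (expR (vnorm p ^+ k * Z)).
Proof.
move=> k0; have hs i j : small P L rho (p ^+ k) i j.
  move=> e a b a0 b0; have := hsmallp i j e a0 b0; apply: le_trans.
  rewrite -{1}(prednK k0) exprS -mulrA mulrCA [leLHS]vnormM ler_piMl ?vnorm_ge0//.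
  by rewrite vnormX exprn_ile1 ?vnorm_ge0// ltW.
have h := comm_lists rho01 (q := p ^+ k) (s := PP s) (t := LL s) (fun a b _ _ _ => hs a.1 b.1).
rewrite big_PP_LL big_s in h.
have E1 : \prod_(i < r) \prod_(j <- s) Omega P L (p ^+ k) i j =
  \prod_(i < r) \prod_(j < r) Omega P L (p ^+ k) i j.
  by apply: eq_bigr => i _; exact: big_s.
rewrite E1 in h.
have E2 : \prod_(a <- PP s) \prod_(b <- LL s)
   expR (asum (ascale (p ^+ k) (P a.1 a.2)) * asum (L b.1 b.2) / (1 - rho)) =
   expR (vnorm p ^+ k * Z).
  under eq_bigr do rewrite -expR_sum.
  rewrite -expR_sum /Z mulr_sumr; congr expR; apply: eq_bigr => a _.
  by rewrite mulr_sumr; apply: eq_bigr => b _; rewrite /= vnormX !mulrA.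
rewrite E2 in h; apply: keq_comm h; last exact: keq_refl.
apply: keq_sym; apply: keq_trans (lscale_prod _ _) _; rewrite -map_comp.
apply: keq_lprod_map => a /=.
apply: keq_trans (keq_lscale _ (keq_sym (keq_kP1 P a))) _.
exact: kern_schur_scale.
Qed.

Theorem word_trace : optrace (powH p ** opprod (block P L)) =
  (\prod_(i < r) omega P L 1 (i, true) (i, false)) *
  (\prod_(i < r) \prod_(j < r | (j < i)%N) Omega P L 1 i j) * Ginf / Pinf.
Proof.
set c0 := (X in _ = X * _ / _).
have nX : normal (opprod (block P L)) c0 A B.
  have := normalL_word rho01 hsmall s_desc.
  rewrite big_map /c0 !big_s; congr (normal _ (_ * _) _ _).
  by apply: eq_bigr => i _; exact: big_s2.
have hdiagL mu := lprod_diag (f := kL L) (LL s) (mu := mu) (fun a => kern_schur_diag a.2 _ mu).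
have hdiagP mu := lprod_diag (f := kP P 1) (PP s) (mu := mu) (fun a => kern_schur_diag a.2 _ mu).
have cb_bdd n : \prod_(1 <= k < n.+1) expR (vnorm p ^+ k * Z) <= expR ((1 - vnorm p)^-1 * Z).
  rewrite -expR_sum ler_expR -mulr_suml ler_wpM2r//.
  by apply: geometric_bdd; rewrite ?vnorm_ge0 ?iota_uniq.
have := trace_formula p1 (fun mu => (hdiagL mu).1) (fun mu => (hdiagP mu).1)
  (fun mu => (hdiagL mu).2) (fun mu => (hdiagP mu).2) (fun k => expR_ge0 _) cb_bdd
  hcomm hGinf (euler_has_usum p1 hPinf Pinf0).
move=> ht; apply: usum_has; rewrite -mulrA.
apply: eq_has_usum (has_usumZ c0 ht) => mu.
rewrite /opmul; apply/esym/usum_has.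
have := @has_usum1 _ K _ (fun nu => powH p mu nu * opprod (block P L) nu mu) mu.
rewrite {3}/powH eqxx nX [in X in has_usum _ X]mulrCA; apply => nu /negPf h.
by rewrite /powH eq_sym h mul0r.
Qed.

End WordTrace.

(** * Arm and leg lengths *)

Section Walk.
Variables (T : comNzRingType) (h : int -> T) (c d : nat -> nat) (C : nat).
Hypotheses (cd : forall i m, (m < C)%N -> (m < c i)%N = (d m <= i)%N)
  (cC : forall i, (c i <= C)%N) (c_mono : forall i, (c i <= c i.+1)%N).

(* A lattice path leaving level 0, whose down steps number i = 0, 1, ... end
   at level c i - i - 1 and whose up steps number m start at level m - d m.
   Each edge is crossed as often upwards as downwards, up to the edges between
   level 0 and the present level e - n. *)
Let S n e := (\prod_(i < n) h ((c i)%:Z - i.+1%:Z)) * \prod_(x < e - n) h x%:Z =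
  (\prod_(m < e) h (m%:Z - (d m)%:Z)) * \prod_(x < n - e) h (- x.+1%:Z).

Let up n e : (e < C)%N -> d e = n -> S n e -> S n e.+1.
Proof.
move=> eC dn; rewrite /S [in X in _ -> _ = X * _]big_ord_recr /= dn.
case: (leqP n e) => ne.
  have -> : (n - e = 0)%N by lia.
  have -> : (n - e.+1 = 0)%N by lia.
  rewrite !big_ord0 !mulr1 => <-; rewrite subSn// big_ord_recr /= mulrA.
  by congr (_ * h _); lia.
have -> : (e - n = 0)%N by lia.
have -> : (e.+1 - n = 0)%N by lia.
rewrite !big_ord0 !mulr1 => ->; rewrite -[(n - e)%N]prednK ?subn_gt0//.
rewrite big_ord_recr /= subnS mulrA mulrAC; congr (_ * h _ * _).
by lia.
Qed.

Let down n : S n (c n) -> S n.+1 (c n).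
Proof.
rewrite /S [in X in _ -> X * _ = _]big_ord_recr /=.
case: (leqP (c n) n) => ne.
  have -> : (c n - n = 0)%N by lia.
  have -> : (c n - n.+1 = 0)%N by lia.
  rewrite !big_ord0 !mulr1 => ->; rewrite subSn// big_ord_recr /= mulrA.
  by congr (_ * h _); lia.
have -> : (n - c n = 0)%N by lia.
have -> : (n.+1 - c n = 0)%N by lia.
rewrite !big_ord0 !mulr1 => <-; rewrite -[(c n - n)%N]prednK ?subn_gt0//.
rewrite big_ord_recr /= subnS mulrA mulrAC; congr (_ * _ * h _).
by lia.
Qed.

Let climb n e : (e <= c n)%N -> (forall m, (e <= m)%N -> (m < c n)%N -> d m = n) ->
  S n e -> S n (c n).
Proof.
move=> ec hd he; suff H k : (e + k <= c n)%N -> S n (e + k).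
  by rewrite -(subnKC ec); apply: H; rewrite subnKC.
elim: k => [|k IH] hk; first by rewrite addn0.
rewrite addnS; apply: up; last by apply: IH; lia.
  by apply: leq_trans (cC n); lia.
by apply: hd; lia.
Qed.

Let path_inv n : S n (c n).
Proof.
elim: n => [|n IH].
  apply: (climb (leq0n _)) => [m _ mc|]; last by rewrite /S !big_ord0.
  by apply/eqP; rewrite -leqn0 -cd// (leq_trans mc).
apply: climb (c_mono n) _ (down IH) => m m1 m2.
have mC : (m < C)%N := leq_trans m2 (cC _).
apply/eqP; rewrite eqn_leq -cd// m2 /= ltnNge -cd// -leqNgt//.
Qed.

Lemma walk_prod N : (C <= N)%N -> c N = C ->
  \prod_(i < N) h ((c i)%:Z - i.+1%:Z) =
  (\prod_(m < C) h (m%:Z - (d m)%:Z)) * \prod_(x < N - C) h (- x.+1%:Z).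
Proof.
move=> CN cN; have := path_inv N; rewrite /S cN.
have -> : (C - N = 0)%N by lia.
by rewrite big_ord0 mulr1.
Qed.

End Walk.

Section ArmLeg.
Variables (T : comNzRingType) (al be : part) (g : int -> int -> T) (N : nat).
Hypotheses (aN : (size al <= N)%N) (bN : (size be <= N)%N) (rN : (prow al 0 <= N)%N).
Let a i := prow al i.
Let b i := prow be i.
Let a' j := prow (transpose al) j.
Let b' j := prow (transpose be) j.

Let walk_diag w :
  \prod_(i < N) g ((a' (b i + w)%N)%:Z - i.+1%:Z) w%:Z =
  (\prod_(m < a' w) g (m%:Z - (b' (a m - w.+1)%N)%:Z) w%:Z) *
  \prod_(x < N - a' w) g (- x.+1%:Z) w%:Z.
Proof.
apply: (@walk_prod T (fun u => g u w%:Z) (fun i => a' (b i + w)%N)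
  (fun m => b' (a m - w.+1)%N)).
- move=> i m; rewrite /a' !lt_prow_transpose -/(a m) => wm.
  rewrite [RHS]leqNgt /b' lt_prow_transpose -leqNgt -/(b i); lia.
- by move=> i; apply: prow_le; rewrite leq_addl.
- by move=> i; apply: prow_le; rewrite leq_add2r prow_le.
- rewrite leqNgt lt_prow_transpose -leqNgt; by rewrite prow_eq0.
- by rewrite /b prow_eq0.
Qed.

Lemma armleg_prod :
  \prod_(i < N) \prod_(j < b i + N) g ((a' j)%:Z - i.+1%:Z) (j%:Z - (b i)%:Z) =
  (\prod_(i < N) \prod_(j < b i) g ((a' j)%:Z - i.+1%:Z) (j%:Z - (b i)%:Z)) *
  (\prod_(i < N) \prod_(j < a i) g (i%:Z - (b' j)%:Z) ((a i)%:Z - j.+1%:Z)) *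
  \prod_(w < N) \prod_(x < N - a' w) g (- x.+1%:Z) w%:Z.
Proof.
rewrite -mulrA.
have -> : \prod_(i < N) \prod_(j < b i + N) g ((a' j)%:Z - i.+1%:Z) (j%:Z - (b i)%:Z) =
  (\prod_(i < N) \prod_(j < b i) g ((a' j)%:Z - i.+1%:Z) (j%:Z - (b i)%:Z)) *
  \prod_(i < N) \prod_(w < N) g ((a' (b i + w)%N)%:Z - i.+1%:Z) w%:Z.
  rewrite -big_split /=; apply: eq_bigr => i _; rewrite big_split_ord /=.
  by congr (_ * _); apply: eq_bigr => w _; congr g; lia.
congr (_ * _); rewrite exchange_big /=.
under eq_bigr do rewrite walk_diag.
rewrite big_split /=; congr (_ * _).
have aiN i : (a i <= N)%N by apply: leq_trans rN; exact: prow_le.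
have a'N w : (a' w <= N)%N.
  by apply: leq_trans aN; rewrite leqNgt lt_prow_transpose -leqNgt prow_eq0.
transitivity (\prod_(w < N) \prod_(m < N | (w < a m)%N) g (m%:Z - (b' (a m - w.+1)%N)%:Z) w%:Z).
  apply: eq_bigr => w _.
  rewrite (big_ord_widen N (fun m => g (m%:Z - (b' (a m - w.+1)%N)%:Z) w%:Z))//.
  by apply: eq_bigl => m; rewrite lt_prow_transpose.
rewrite (exchange_big_dep xpredT) //=; apply: eq_bigr => i _.
rewrite -(big_ord_widen N (fun w => g (i%:Z - (b' (a i - w.+1)%N)%:Z) w%:Z))//.
rewrite (reindex_inj rev_ord_inj) /=; apply: eq_bigr => j _.
by congr (g (_ - (b' _)%:Z) _); have := ltn_ord j; lia.
Qed.

End ArmLeg.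

Section CellProducts.
Variable T : comNzRingType.

Lemma big_cells (be : part) N (F : nat -> nat -> T) : (size be <= N)%N ->
  \prod_(i < N) \prod_(j < prow be i) F i.+1 j.+1 = \prod_(s <- cells be) F s.1 s.2.
Proof.
move=> bN; rewrite /cells big_allpairs_dep /=.
rewrite -(big_mkord xpredT (fun i => \prod_(j < prow be i) F i.+1 j.+1)).
rewrite (@big_cat_nat _ _ _ (size be))//= [X in _ * X](_ : _ = 1) ?mulr1; last first.
  by rewrite big_nat big1// => i /andP[h _]; rewrite prow_eq0// big_ord0.
rewrite -[iota 1 (size be)]/(iota (1 + 0) (size be)) iotaDl big_map.
rewrite /index_iota subn0; apply: eq_bigr => i _.
rewrite /part_row -/(prow be _) /= -[iota 1 _]/(iota (1 + 0) _) iotaDl big_map.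
by rewrite -(big_mkord xpredT (fun j => F i.+1 j.+1)) /index_iota subn0.
Qed.

End CellProducts.

Section PhiArmLeg.
Variables (R : realType) (K : completeValuedField R).
Variables (al be : part) (t1 t2 X : K) (A A0 : nat -> nat -> K) (BA BA0 : R).
Let a' j := prow (transpose al) j.
Let b i := prow be i.
Hypotheses (AE : forall j i, A j.+1 i.+1 = X * (t1 ^ ((a' j)%:Z - i.+1%:Z) * t2 ^ (j%:Z - (b i)%:Z)))
  (A0E : forall j i, A0 j.+1 i.+1 = X * (t1 ^ (- i.+1%:Z) * t2 ^ j%:Z))
  (hA : dsummable A BA) (hA0 : dsummable A0 BA0).

Let N0 := (size al + size be + prow al 0)%N.

(* Row i of the region for A has length b i + N, row i of the region for A0 is
   shortened accordingly: the truncated products then differ by a product over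
   the cells of al and be, independent of N. *)
Let regA n : seq (nat * nat) :=
  [seq (j, i) | i <- index_iota 0 (n + N0), j <- index_iota 0 (b i + (n + N0))].
Let regA0 n : seq (nat * nat) :=
  [seq (j, i) | j <- index_iota 0 (n + N0), i <- index_iota 0 (n + N0 - a' j)].

Let regA_uniq n : uniq (regA n).
Proof.
apply: allpairs_uniq_dep => [|i _|[x y] [x' y'] _ _ /= [-> ->]//]; exact: iota_uniq.
Qed.

Let regA0_uniq n : uniq (regA0 n).
Proof.
apply: allpairs_uniq_dep => [|i _|[x y] [x' y'] _ _ /= [-> ->]//]; exact: iota_uniq.
Qed.

Let regA_exhausts (p : nat * nat) : exists N, forall n, (N <= n)%N -> p \in regA n.
Proof.
case: p => j i; exists (j + i).+1 => n hn; apply/allpairsPdep.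
by exists i, j; rewrite !mem_index_iota /= ; split => //; lia.
Qed.

Let regA0_exhausts (p : nat * nat) : exists N, forall n, (N <= n)%N -> p \in regA0 n.
Proof.
case: p => j i; exists (j + i + a' j).+1 => n hn; apply/allpairsPdep.
by exists j, i; rewrite !mem_index_iota /=; split => //; lia.
Qed.

Let g (u v : int) : K := 1 - X * (t1 ^ u * t2 ^ v).

Lemma Phi_armleg : Phi A = Phi A0 *
  (\prod_(s <- cells be) (1 - X * (t1 ^ leg al s * t2 ^ (- arm be s - 1))) *
   \prod_(s <- cells al) (1 - X * (t1 ^ (- leg be s - 1) * t2 ^ arm al s))).
Proof.
have h1 := has_uprod_seq (Phi_uprod hA) regA_uniq regA_exhausts.
have h0 := has_uprod_seq (Phi_uprod hA0) regA0_uniq regA0_exhausts.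
apply: (kcvg_unique h1).
apply: eq_kcvg (kcvgM h0 (kcvg_cst _)) => n.
rewrite [\prod_(i <- regA n) _]big_allpairs_dep [\prod_(i <- regA0 n) _]big_allpairs_dep /= [RHS]big_mkord.
have aN : (size al <= n + N0)%N by rewrite /N0; lia.
have bN : (size be <= n + N0)%N by rewrite /N0; lia.
have rN : (prow al 0 <= n + N0)%N by rewrite /N0; lia.
transitivity (\prod_(i < n + N0) \prod_(j < b i + (n + N0))
   g ((a' j)%:Z - i.+1%:Z) (j%:Z - (b i)%:Z)); last first.
  apply: eq_bigr => i _; rewrite big_mkord; apply: eq_bigr => j _.
  by rewrite /g AE.
rewrite (armleg_prod g aN bN rN) mulrC; congr (_ * _); last first.
  rewrite big_mkord; apply: eq_bigr => j _; rewrite big_mkord; apply: eq_bigr => i _.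
  by rewrite /g A0E.
congr (_ * _); symmetry.
  apply: etrans (etrans _ (big_cells (fun i j => 1 - X * (t1 ^ leg al (i, j) * t2 ^ (- arm be (i, j) - 1))) bN)) _.
    apply: eq_bigr => i _; apply: eq_bigr => j _; rewrite /g; congr (1 - X * (t1 ^ _ * t2 ^ _)).
    by rewrite /arm /= /part_row /= -/(prow be i) -/(b i); lia.
  by apply: eq_bigr => -[].
apply: etrans (etrans _ (big_cells (fun i j => 1 - X * (t1 ^ (- leg be (i, j) - 1) * t2 ^ arm al (i, j))) aN)) _.
  apply: eq_bigr => i _; apply: eq_bigr => j _; rewrite /g; congr (1 - X * (t1 ^ _ * t2 ^ _)).
  by rewrite /leg /= /part_row /= -/(prow (transpose be) j); lia.
by apply: eq_bigr => -[].
Qed.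

End PhiArmLeg.

(** * Comparison of the two sides *)

Section ScalarProducts.
Variables (R : realType) (K : completeValuedField R) (p : K).
Hypothesis p1 : vnorm p < 1.

Definition gsc (c : K) : K := iprod (fun N => 1 - p ^+ N * c).

Let gsc_summable c : sumlim (fun N => - (p ^+ N.+1 * c)) (vnorm c * (1 - vnorm p)^-1).
Proof.
have p01 : 0 <= vnorm p < 1 by rewrite vnorm_ge0.
apply: sum_bdd_le (sum_bddZ (vnorm_ge0 c) (geometric_bdd p01)) => N.
rewrite vnormN vnormM vnormX mulrC ler_wpM2l ?vnorm_ge0// exprS.
by rewrite ler_piMl ?exprn_ge0 ?vnorm_ge0// ltW.
Qed.

Let gsc_ex c : exists2 l, has_uprod (fun N => - (p ^+ N.+1 * c)) l &
  kcvg (fun n => \prod_(1 <= N < n.+1) (1 - p ^+ N * c)) l.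
Proof.
have [l hl] := has_uprod_ex (gsc_summable c); exists l => //.
apply: eq_kcvg (has_uprod_seq (s := fun n => index_iota 0 n) hl _ _) => [n|n|n].
- by rewrite big_add1.
- exact: iota_uniq.
- by exists n.+1 => m nm; rewrite mem_index_iota.
Qed.

Lemma gsc_cvg c : kcvg (fun n => \prod_(1 <= N < n.+1) (1 - p ^+ N * c)) (gsc c).
Proof. by have [l _ hl] := gsc_ex c; rewrite /gsc (iprod_has hl). Qed.

Lemma gsc0_cvg c :
  kcvg (fun n => \prod_(1 <= N < n.+1) (1 - p ^+ N.-1 * c)) ((1 - c) * gsc c).
Proof.
apply/kcvg_shift; apply: eq_kcvg (kcvgM (kcvg_cst (1 - c)) (gsc_cvg c)) => n.
rewrite [RHS]big_ltn// [X in _ = _ * X]big_add1 big_add1 /=; congr (_ * _).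
by rewrite expr0 mul1r.
Qed.

Lemma gsc_neq0 c : (forall N, (0 < N)%N -> p ^+ N * c != 1) -> gsc c != 0.
Proof.
move=> h; have [l hu hl] := gsc_ex c; rewrite /gsc (iprod_has hl).
apply: has_uprod_neq0 (gsc_summable c) _ hu => N.
by rewrite subr_eq0 eq_sym h.
Qed.

Lemma Theta_gsc y q : 1 - q != 0 -> gsc q != 0 -> gsc q^-1 != 0 ->
  Theta p y q = (1 - y * q) * gsc (y * q) * gsc (y^-1 * q^-1) / ((1 - q) * gsc q * gsc q^-1).
Proof.
move=> q1 g1 g2; apply: iprod_has.
have h1 := kcvgM (gsc0_cvg (y * q)) (gsc_cvg (y^-1 * q^-1)).
have h2 := kcvgM (gsc0_cvg q) (gsc_cvg q^-1).
have n2 : (1 - q) * gsc q * gsc q^-1 != 0 by rewrite !mulf_neq0.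
apply: eq_kcvg (kcvgM h1 (kcvgV n2 h2)) => n.
rewrite -!big_split /= -prodf_div; apply: eq_bigr => N _.
by congr (_ * _ / _); congr (1 - _); rewrite mulrCA mulrA.
Qed.

End ScalarProducts.

Section Vacuum.
Variables (R : realType) (K : completeValuedField R) (p t1 t2 : K).
Hypotheses (p1 : vnorm p < 1) (ht1 : 1 < vnorm t1) (ht2 : 0 < vnorm t2 < 1).

Definition vac_array (X : K) (k m : nat) : K := X * (t1 ^ (- m%:Z) * t2 ^ k%:Z).

Definition Vac X : K := Phi (vac_array X).

Lemma vac_bdd : exists2 B, 0 <= B & forall X, dsummable (vac_array X) (vnorm X * B).
Proof.
have /andP[t20 t21] := ht2.
have T1 : 0 <= (vnorm t1)^-1 < 1.
  by rewrite invr_ge0 vnorm_ge0 invf_lt1// (lt_trans ltr01).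
have T2 : 0 <= vnorm t2 < 1 by rewrite vnorm_ge0.
have b1 := geometric_bdd T1; have b2 := geometric_bdd T2.
exists ((1 - vnorm t2)^-1 * (1 - (vnorm t1)^-1)^-1) => [|X].
  by rewrite mulr_ge0// ?(sum_bdd_ge0 b2) ?(sum_bdd_ge0 b1).
have hG : sum_bdd (fun q : nat * nat => vnorm t2 ^+ q.1 * (vnorm t1)^-1 ^+ q.2)
    ((1 - vnorm t2)^-1 * (1 - (vnorm t1)^-1)^-1).
  apply: (sum_bdd_pair (B := fun k => vnorm t2 ^+ k * (1 - (vnorm t1)^-1)^-1)).
  - by move=> q; rewrite mulr_ge0 ?exprn_ge0 ?invr_ge0 ?vnorm_ge0.
  - move=> k; apply: sum_bddZ b1; rewrite exprn_ge0//; exact: vnorm_ge0.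
  - by move=> s us; rewrite -mulr_suml ler_wpM2r ?(sum_bdd_ge0 b1)// b2.
apply: sum_bdd_le (sum_bddZ (vnorm_ge0 X) hG) => -[k m] /=.
rewrite /vac_array !vnormM ler_wpM2l ?vnorm_ge0// !vnormXz -exprnN mulrC -exprnP -exprVn.
rewrite ler_pM ?exprn_ge0 ?invr_ge0 ?vnorm_ge0//.
  by rewrite exprS ler_piMl ?exprn_ge0 ?vnorm_ge0// ltW.
have /andP[T0 /ltW T1'] := T1.
by rewrite exprS ler_piMl ?exprn_ge0.
Qed.

Lemma vac_summable X : exists B, dsummable (vac_array X) B.
Proof. by have [B _ hB] := vac_bdd; exists (vnorm X * B). Qed.

Lemma Vac_neq0 X : (forall k m, (0 < k)%N -> (0 < m)%N -> vac_array X k m != 1) -> Vac X != 0.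
Proof. by have [B hB] := vac_summable X; exact: Phi_neq0 hB. Qed.

Lemma M_Vac X : (forall k m, (0 < k)%N -> (0 < m)%N -> vac_array X k m != 1) ->
  M X t1^-1 t2 = (Vac X)^-1.
Proof.
move=> h; have [B hB] := vac_summable X.
apply: vlim_kcvg; apply: eq_kcvg (kcvgV (Vac_neq0 h) (Phi_cvg hB)) => n.
rewrite [RHS]exchange_big /= -prodfV; apply: eq_bigr => k _.
rewrite -prodfV; apply: eq_bigr => m _.
by rewrite /vac_array -exprnN -exprVn -exprnP mulrA.
Qed.

Definition VG X : K := Gam p (vac_array X).

Let vac_scale q X : (fun k m => q * vac_array X k m) = vac_array (q * X).
Proof. by apply/funext => k; apply/funext => m; rewrite /vac_array mulrA. Qed.

Lemma VG_cvg X : kcvg (fun n => \prod_(1 <= N < n.+1) Vac (p ^+ N * X)) (VG X).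
Proof.
have [B hB] := vac_summable X; apply: eq_kcvg (Gam_cvg p1 hB) => n.
by apply: eq_bigr => N _; rewrite vac_scale.
Qed.

Lemma VG0_cvg X : kcvg (fun n => \prod_(1 <= N < n.+1) Vac (p ^+ N.-1 * X)) (Vac X * VG X).
Proof.
have [B hB] := vac_summable X; apply: eq_kcvg (Gam0_cvg p1 hB) => n.
by apply: eq_bigr => N _; rewrite vac_scale.
Qed.

Lemma VG_neq0 X : (forall N k m, (0 < N)%N -> (0 < k)%N -> (0 < m)%N ->
  vac_array (p ^+ N * X) k m != 1) -> VG X != 0.
Proof.
move=> h; have [B hB] := vac_summable X; apply: Gam_neq0 p1 hB _ => N k m N0 k0 m0.
by rewrite /vac_array mulrA; exact: h.
Qed.

End Vacuum.

Section Pairs.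
Variables (R : realType) (K : completeValuedField R) (p t1 t2 E : K) (al be : part).
Hypotheses (p1 : vnorm p < 1) (ht1 : 1 < vnorm t1) (ht2 : 0 < vnorm t2 < 1).

(* The inverses of the weights of the tangent space in e_i / e_j, for E = e_j / e_i. *)
Definition pair_weights : seq K :=
  [seq E * (t1 ^ leg al s * t2 ^ (- arm be s - 1)) | s <- cells be] ++
  [seq E * (t1 ^ (- leg be s - 1) * t2 ^ arm al s) | s <- cells al].

Variables (U : nat -> nat -> K) (BU : R).
Hypotheses (hU : dsummable U BU) (UE : forall k m, U k.+1 m.+1 =
  E * (t1 ^ ((prow (transpose al) k)%:Z - m.+1%:Z) * t2 ^ (k%:Z - (prow be m)%:Z))).

Let t2n0 : t2 != 0. Proof. by rewrite -vnorm_gt0; case/andP: ht2. Qed.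

Lemma Phi_pair c : Phi (fun k m => c * U k m) =
  Vac t1 t2 (c * E / t2) * \prod_(w <- pair_weights) (1 - c * w).
Proof.
have [B hB] := vac_summable ht1 ht2 (c * E / t2).
rewrite (@Phi_armleg _ _ al be t1 t2 (c * E) _ _ _ _ _ _ (dsummableZ c hU) hB).
- rewrite big_cat !big_map; congr (_ * (_ * _)); apply: eq_bigr => s _; by rewrite mulrA.
- by move=> k m; rewrite UE mulrA.
move=> k m; rewrite /vac_array exprSz; field.
by [].
Qed.

Lemma Gam_pair_cvg c :
  kcvg (fun n => \prod_(1 <= N < n.+1) Phi (fun k m => p ^+ N * c * U k m))
    (VG p t1 t2 (c * E / t2) * \prod_(w <- pair_weights) gsc p (c * w)).
Proof.
have hw : kcvg (fun n => \prod_(w <- pair_weights) \prod_(1 <= N < n.+1) (1 - p ^+ N * (c * w)))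
    (\prod_(w <- pair_weights) gsc p (c * w)).
  by apply: kcvg_prod => w _; exact: gsc_cvg.
apply: eq_kcvg (kcvgM (VG_cvg p1 ht1 ht2 _) hw) => n.
rewrite exchange_big /= -big_split /=; apply: eq_bigr => N _.
rewrite Phi_pair !mulrA; congr (_ * _); apply: eq_bigr => w _.
by rewrite !mulrA.
Qed.

End Pairs.

Lemma exchange_lt_ord (K : fieldType) r (f : 'I_r -> 'I_r -> K) :
  \prod_(i < r) \prod_(j < r | (i < j)%N) f i j = \prod_(i < r) \prod_(j < r | (j < i)%N) f j i.
Proof. by rewrite (exchange_big_dep xpredT). Qed.

Lemma prod_pairs (K : fieldType) r (f : 'I_r -> 'I_r -> K) :
  \prod_(i < r) \prod_(j < r) f i j =
  (\prod_(i < r) f i i) * \prod_(i < r) \prod_(j < r | (j < i)%N) (f i j * f j i).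
Proof.
under [X in _ = _ * X]eq_bigr => i _ do rewrite big_split /=.
rewrite big_split /= -(exchange_lt_ord f) -!big_split /=; apply: eq_bigr => i _.
rewrite (bigD1 i)//=; congr (_ * _); rewrite (bigID (fun j : 'I_r => (j < i)%N))/=.
congr (_ * _); apply: eq_bigl => j; rewrite -val_eqE /=; case: ltngtP => //.
Qed.

Lemma prod_collect (K : fieldType) r (a b c d f : 'I_r -> K) (x u v w : 'I_r -> 'I_r -> K) (q : K) :
  q != 0 ->
  (\prod_(i < r) a i) * (\prod_(i < r) \prod_(j < r | (j < i)%N) x i j) *
    (q * ((\prod_(i < r) b i) * \prod_(i < r) \prod_(j < r | (j < i)%N) u i j)) *
    ((\prod_(i < r) c i) * (\prod_(i < r) \prod_(j < r | (j < i)%N) v i j) *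
      ((\prod_(i < r) d i) * \prod_(i < r) \prod_(j < r | (j < i)%N) w i j) / q / \prod_(i < r) f i) =
  (\prod_(i < r) (a i * b i * c i * d i / f i)) *
  \prod_(i < r) \prod_(j < r | (j < i)%N) (x i j * u i j * v i j * w i j).
Proof.
move=> q0; rewrite prodf_div !big_split /=.
under [X in _ = _ * X]eq_bigr => i _ do rewrite !big_split /=.
rewrite !big_split /=.
move: (\prod_i a i) (\prod_i b i) (\prod_i c i) (\prod_i d i) (\prod_i f i)^-1 => A B C D F.
move: (\prod_i _) (\prod_i _) (\prod_i _) (\prod_i _) => X U V W.
by field.
Qed.
Lemma diagonal_cancel (K : fieldType) (s Py Qy P1 Q1 Q' QT V1 W1 Vy Wy WT W' : K) :
  V1 != 0 -> W1 != 0 -> Vy != 0 -> Wy != 0 -> WT != 0 -> W' != 0 ->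
  P1 != 0 -> Q1 != 0 -> QT != 0 ->
  s * (Py * Qy / (P1 * Q1)) * (Q' / QT) =
  s * (V1 * W1 / (Vy * Wy) * (WT / W')) * (Vy * Py) *
    (Wy * Qy * (W' * Q') / (W1 * Q1 * (WT * QT))) / (V1 * P1).
Proof.
move=> *; field.
by apply/and5P; split=> //; apply/and5P.
Qed.

Lemma off_diagonal_cancel (K : fieldType) (s Py P' P1 PT py p1 Qy Q' Q1 QT qy q' q1 qT
    Vy V' V1 VT vy v1 Wy W' W1 WT wy w' w1 wT : K) :
  P' / PT = s * (py / p1) ->
  [/\ P1 != 0, PT != 0, p1 != 0 & Q1 != 0] -> [/\ QT != 0, q1 != 0, qT != 0 & Vy != 0] ->
  [/\ V' != 0, V1 != 0, VT != 0 & vy != 0] -> [/\ v1 != 0, Wy != 0, W' != 0 & W1 != 0] ->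
  [/\ WT != 0, wy != 0, w' != 0, w1 != 0 & wT != 0] ->
  s * ((Py * Qy / (P1 * Q1)) * (Q' / QT) * ((py * qy / (p1 * q1)) * (q' / qT))) =
  VT / V' * (vy / v1) *
  (V1 * W1 / (Vy * Wy) * (WT / W') * (v1 * w1 / (vy * wy) * (wT / w'))) *
  (Vy * Py * (V' * P') / (V1 * P1 * (VT * PT))) *
  (Wy * Qy * (W' * Q') / (W1 * Q1 * (WT * QT)) *
   (wy * qy * (w' * q') / (w1 * q1 * (wT * qT)))).
Proof.
move=> h [? ? ? ?] [? ? ? ?] [? ? ? ?] [? ? ? ?] [? ? ? ? ?].
have -> : P' = s * (py / p1) * PT by rewrite -h divfK.
field.
by do !(apply/andP; split => //).
Qed.

Section Main.
Variables (R : realType) (K : completeValuedField R) (r n : nat) (e : 'I_r -> K).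
Variables (t1 t2 p y : K).
Hypotheses (hr : (1 <= r)%N) (hy : y != 0) (he : forall i, e i != 0)
  (ht1 : 1 < vnorm t1) (ht2 : 0 < vnorm t2 < 1)
  (hconv0 : forall i j : 'I_r, (i < j)%N ->
     vnorm (e i) * vnorm t1 ^+ n < vnorm (e j) * vnorm t2 ^+ n)
  (hconvp : forall i j : 'I_r,
     vnorm p * vnorm (e j) * vnorm t1 ^+ n < vnorm (e i) * vnorm t2 ^+ n)
  (hgen_e : forall (i j : 'I_r) (a b : int), i != j ->
     e i != e j * t1 ^ a * t2 ^ b)
  (hgen_y : forall (i j : 'I_r) (a b c : int),
     y * e i != e j * p ^ a * t1 ^ b * t2 ^ c).
Variable ga : multipart r.
Hypothesis hga : msize ga = n.

Definition ratio (i j : 'I_r) : K := e j / e i.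
Local Notation E := ratio.

Lemma t1_neq0 : t1 != 0. Proof. by rewrite -vnorm_gt0 (lt_trans ltr01). Qed.
Lemma t2_neq0 : t2 != 0. Proof. by rewrite -vnorm_gt0; case/andP: ht2. Qed.

Definition size_bound i j : R := vnorm (E i j) * (vnorm t1 ^+ n * (vnorm t2)^-1 ^+ n).
Local Notation D := size_bound.

Lemma monomial_bound i j (u v : int) : u <= n%:Z -> - n%:Z <= v ->
  vnorm (E i j * (t1 ^ u * t2 ^ v)) <= D i j.
Proof.
move=> un nv; rewrite vnormM ler_wpM2l ?vnorm_ge0// vnormM !vnormXz.
have /andP[t20 t21] := ht2.
rewrite ler_pM ?exprz_ge0 ?vnorm_ge0//.
  by rewrite exprnP; apply: ler_weXz2l => //; exact: ltW.
rewrite -[v]opprK -exprz_inv exprnP; apply: ler_weXz2l.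
  by rewrite invf_ge1// ltW.
by rewrite lerNl.
Qed.

Lemma D_lt1 (i j : 'I_r) : (j < i)%N -> D i j < 1.
Proof.
move=> /hconv0; have /andP[t20 _] := ht2; have ei : 0 < vnorm (e i) by rewrite vnorm_gt0.
rewrite /size_bound /ratio vnormM vnormV exprVn => h.
have -> : vnorm (e j) / vnorm (e i) * (vnorm t1 ^+ n / vnorm t2 ^+ n) =
   (vnorm (e j) * vnorm t1 ^+ n) / (vnorm (e i) * vnorm t2 ^+ n) by field; rewrite expf_neq0 ?gt_eqF.
by rewrite ltr_pdivrMr ?mul1r// mulr_gt0// exprn_gt0.
Qed.

Lemma pD_lt1 i j : vnorm p * D i j < 1.
Proof.
have := hconvp i j; have /andP[t20 _] := ht2; have ei : 0 < vnorm (e i) by rewrite vnorm_gt0.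
rewrite /size_bound /ratio vnormM vnormV exprVn => h.
have -> : vnorm p * (vnorm (e j) / vnorm (e i) * (vnorm t1 ^+ n / vnorm t2 ^+ n)) =
   (vnorm p * vnorm (e j) * vnorm t1 ^+ n) / (vnorm (e i) * vnorm t2 ^+ n) by field; rewrite expf_neq0 ?gt_eqF.
by rewrite ltr_pdivrMr ?mul1r// mulr_gt0// exprn_gt0.
Qed.

Lemma p_lt1 : vnorm p < 1.
Proof.
have i0 : 'I_r by exact: (Ordinal hr).
have h := pD_lt1 i0 i0; apply: le_lt_trans h.
have /andP[t20 t21] := ht2.
rewrite ler_peMr ?vnorm_ge0// /size_bound /ratio divff// vnorm1 mul1r.
by rewrite mulr_ege1// exprn_ege1// ?invf_ge1// ltW.
Qed.

Lemma psize_ga i : (psize (ga i) <= n)%N.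
Proof. by rewrite -hga /msize (bigD1 i)//= leq_addr. Qed.

Lemma prow_ga i k : (prow (ga i) k <= n)%N.
Proof. exact: leq_trans (prow_le_psize _ _) (psize_ga i). Qed.

Lemma prow_tr_ga i k : (prow (transpose (ga i)) k <= n)%N.
Proof. by apply: leq_trans (prow_le_psize _ _) _; rewrite psize_transpose psize_ga. Qed.

Lemma xvec_bdd i : sumlim (fun k => xvec t1 t2 (e i) (ga i) k.+1)
  (vnorm (e i)^-1 * vnorm t1 ^+ n * (1 - vnorm t2)^-1).
Proof.
have /andP[t20 t21] := ht2.
have T2 : 0 <= vnorm t2 < 1 by rewrite vnorm_ge0.
have c0 : 0 <= vnorm (e i)^-1 * vnorm t1 ^+ n by rewrite mulr_ge0 ?exprn_ge0 ?vnorm_ge0.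
apply: sum_bdd_le (sum_bddZ c0 (geometric_bdd T2)) => k.
rewrite /xvec !vnormM !vnormX ler_pM ?mulr_ge0 ?exprn_ge0 ?vnorm_ge0//.
  rewrite ler_wpM2l ?vnorm_ge0// ler_weXn2l ?(ltW ht1)//.
  exact: prow_tr_ga.
by rewrite exprS ler_piMl ?exprn_ge0 ?vnorm_ge0// ltW.
Qed.

Lemma zvec_bdd i : sumlim (fun k => zvec t1 t2 (e i) (ga i) k.+1)
  (vnorm (e i) * (vnorm t2)^-1 ^+ n * (1 - (vnorm t1)^-1)^-1).
Proof.
have /andP[t20 t21] := ht2.
have T1 : 0 <= (vnorm t1)^-1 < 1.
  by rewrite invr_ge0 vnorm_ge0 invf_lt1// (lt_trans ltr01).
have /andP[T0 /ltW T1'] := T1.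
have c0 : 0 <= vnorm (e i) * (vnorm t2)^-1 ^+ n by rewrite mulr_ge0 ?exprn_ge0 ?invr_ge0 ?vnorm_ge0.
apply: sum_bdd_le (sum_bddZ c0 (geometric_bdd T1)) => k.
rewrite /zvec -!exprVn !vnormM !vnormX !vnormV mulrAC ler_pM ?mulr_ge0 ?exprn_ge0 ?invr_ge0 ?vnorm_ge0//.
  rewrite ler_wpM2l ?vnorm_ge0// ler_weXn2l ?invf_ge1 ?(ltW t21)//.
  exact: prow_ga.
by rewrite exprS ler_piMl ?exprn_ge0.
Qed.

Definition xa i : alphabet K := Alphabet (xvec_bdd i).
Definition za i : alphabet K := Alphabet (zvec_bdd i).
Definition P (i : 'I_r) (eps : bool) : alphabet K :=
  ascale (if eps then t2^-1 else - y^-1 * t1) (xa i).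
Definition L (i : 'I_r) (eps : bool) : alphabet K :=
  if eps then za i else ascale (- y) (za i).

Definition U i j (k m : nat) : K := t2^-1 * xa i k * za j m.

Lemma UE i j k m : U i j k.+1 m.+1 = E i j *
  (t1 ^ ((prow (transpose (ga i)) k)%:Z - m.+1%:Z) * t2 ^ (k%:Z - (prow (ga j) m)%:Z)).
Proof.
rewrite /U /= /xvec /zvec /part_row /= -/(prow _ k) -/(prow (ga j) m) /ratio.
rewrite !expfzDr ?t1_neq0 ?t2_neq0// -!exprnN -!exprnP exprS.
by field; rewrite !expf_neq0 ?t1_neq0 ?t2_neq0 ?he.
Qed.

Lemma U_summable i j : exists B, dsummable (U i j) B.
Proof. by exists (asum (P i true) * asum (L j true)); exact: (dsummable_mul (P i true) (L j true)). Qed.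

Lemma U_bound i j k m : (0 < k)%N -> (0 < m)%N -> vnorm (U i j k m) <= D i j.
Proof.
case: k m => [//|k] [//|m] _ _; rewrite UE; apply: monomial_bound.
  have := prow_tr_ga i k; lia.
have := prow_ga j m; lia.
Qed.

Lemma tU_bound i j k m : (0 < k)%N -> (0 < m)%N -> vnorm (t1 * t2 * U i j k m) <= D i j.
Proof.
case: k m => [//|k] [//|m] _ _; rewrite UE.
have -> : t1 * t2 * (E i j * (t1 ^ ((prow (transpose (ga i)) k)%:Z - m.+1%:Z) * t2 ^ (k%:Z - (prow (ga j) m)%:Z))) =
  E i j * (t1 ^ (1 + ((prow (transpose (ga i)) k)%:Z - m.+1%:Z)) * t2 ^ (1 + (k%:Z - (prow (ga j) m)%:Z))).
  rewrite [t1 ^ (1 + _)]expfzDr ?t1_neq0// [t2 ^ (1 + _)]expfzDr ?t2_neq0// !expr1z; ring.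
apply: monomial_bound; first by have := prow_tr_ga i k; lia.
have := prow_ga j m; lia.
Qed.

Definition PhiU i j c : K := Phi (fun k m => c * U i j k m).

Lemma OmegaE q i j : Omega P L q i j =
  PhiU i j (q * y) * PhiU i j (q * (y^-1 * (t1 * t2))) / (PhiU i j q * PhiU i j (q * (t1 * t2))).
Proof.
have t2n := t2_neq0.
rewrite /Omega !big_bool /omega /weight_lim /=.
have -> : Phi (fun k l => q * (t2^-1 * xvec t1 t2 (e i) (ga i) k) * zvec t1 t2 (e j) (ga j) l) = PhiU i j q.
  by congr Phi; apply/funext => k; apply/funext => m; rewrite /U /=; ring.
have -> : Phi (fun k l => - (q * (t2^-1 * xvec t1 t2 (e i) (ga i) k) * (- y * zvec t1 t2 (e j) (ga j) l))) = PhiU i j (q * y).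
  by congr Phi; apply/funext => k; apply/funext => m; rewrite /U /=; ring.
have -> : Phi (fun k l => - (q * (- y^-1 * t1 * xvec t1 t2 (e i) (ga i) k) * zvec t1 t2 (e j) (ga j) l)) = PhiU i j (q * (y^-1 * (t1 * t2))).
  by congr Phi; apply/funext => k; apply/funext => m; rewrite /U /=; field; rewrite ?hy ?t2n.
have -> : Phi (fun k l => q * (- y^-1 * t1 * xvec t1 t2 (e i) (ga i) k) * (- y * zvec t1 t2 (e j) (ga j) l)) = PhiU i j (q * (t1 * t2)).
  by congr Phi; apply/funext => k; apply/funext => m; rewrite /U /=; field; rewrite ?hy ?t2n.
by rewrite invfM; ring.
Qed.

Lemma omega_diag i : omega P L 1 (i, true) (i, false) = PhiU i i y.
Proof.
rewrite /omega /weight_lim /=; congr Phi; apply/funext => k; apply/funext => m.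
by rewrite /U /=; ring.
Qed.

Lemma small_exists : exists rho, [/\ 0 <= rho < 1,
  forall i j : 'I_r, (j < i)%N -> small P L rho 1 i j & forall i j, small P L rho p i j].
Proof.
pose rho := Num.max (\big[Num.max/0]_(q : 'I_r * 'I_r | (q.2 < q.1)%N) D q.1 q.2)
  (\big[Num.max/0]_(q : 'I_r * 'I_r) (vnorm p * D q.1 q.2)).
have r1 (i j : 'I_r) : (j < i)%N -> D i j <= rho.
  by move=> ji; rewrite le_max (le_bigmax_cond _ (j := (i, j))).
have r2 i j : vnorm p * D i j <= rho.
  by rewrite le_max orbC (le_bigmax_cond _ (j := (i, j))).
have hU i j eps k l : (0 < k)%N -> (0 < l)%N -> vnorm (P i eps k * L j eps l) <= D i j.
  move=> k0 l0; case: eps => /=.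
    by have := U_bound i j k0 l0; rewrite /U.
  have := tU_bound i j k0 l0; rewrite /U /=.
  by congr (vnorm _ <= _); field; rewrite hy t2_neq0.
exists rho; split.
- apply/andP; split.
    by rewrite le_max; apply/orP; left; apply: (bigmax_ge_id).
  rewrite gt_max; apply/andP; split; apply: bigmax_lt => // q.
    exact: D_lt1.
  by move=> _; exact: pD_lt1.
- move=> i j ji eps k l k0 l0; rewrite mul1r; apply: le_trans (r1 _ _ ji); exact: hU.
- move=> i j eps k l k0 l0; rewrite vnormM; apply: le_trans (r2 i j).
  by rewrite ler_wpM2l ?vnorm_ge0// hU.
Qed.

Definition ws i j : seq K := pair_weights t1 t2 (E i j) (ga i) (ga j).

Lemma inv_monomial i j (u v : int) :
  (E i j * (t1 ^ u * t2 ^ v))^-1 = E j i * (t1 ^ (- u) * t2 ^ (- v)).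
Proof.
by rewrite invfM invfM !invr_expz; congr (_ * _); rewrite /ratio invf_div.
Qed.

Lemma PhiUE i j c : PhiU i j c =
  Vac t1 t2 (c * E i j / t2) * \prod_(w <- ws i j) (1 - c * w).
Proof.
by have [B hB] := U_summable i j; rewrite /PhiU (Phi_pair ht1 ht2 hB (UE i j)).
Qed.

Lemma GamU_cvg i j c : kcvg (fun N => \prod_(1 <= k < N.+1) PhiU i j (p ^+ k * c))
  (VG p t1 t2 (c * E i j / t2) * \prod_(w <- ws i j) gsc p (c * w)).
Proof.
by have [B hB] := U_summable i j; exact: (Gam_pair_cvg p_lt1 ht1 ht2 hB (UE i j)).
Qed.

Lemma legE i s : leg (ga i) s = (prow (transpose (ga i)) s.2.-1)%:Z - s.1%:Z.
Proof. by []. Qed.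

Lemma armE i s : arm (ga i) s = (prow (ga i) s.1.-1)%:Z - s.2%:Z.
Proof. by []. Qed.

Lemma cell_facts i s : s \in cells (ga i) ->
  [/\ (0 < s.1 <= n)%N, (0 < s.2 <= prow (ga i) s.1.-1)%N &
      (s.1 <= prow (transpose (ga i)) s.2.-1)%N].
Proof.
rewrite mem_cells => /and3P[s1 s2 h]; split; last 2 first.
- by rewrite s2.
- by rewrite -{1}(prednK s1) lt_prow_transpose -ltnS prednK// ltnS.
rewrite s1 /=; have h0 : (0 < prow (ga i) s.1.-1)%N by apply: leq_trans h.
rewrite prow_gt0 prednK// in h0.
by apply: leq_trans h0 _; apply: leq_trans (size_le_psize _) (psize_ga i).
Qed.

Lemma ws_bound i j w : w \in ws i j -> vnorm w <= D i j /\ vnorm w^-1 <= D j i.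
Proof.
rewrite mem_cat => /orP[] /mapP[[a b] sc ->]; have [/andP[h1 h2] /andP[h3 h4] h5] := cell_facts sc;
  rewrite inv_monomial !legE !armE /= in h1 h2 h3 h4 h5 *; clear sc.
  have := prow_tr_ga i b.-1; have := prow_ga j a.-1; move: (prow _ _) (prow _ _) h4 h5 => u v h4 h5 hu hv.
  by split; apply: monomial_bound; lia.
have := prow_tr_ga j b.-1; have := prow_ga i a.-1.
by split; apply: monomial_bound; lia.
Qed.

Lemma ws_neq1 i j w : w \in ws i j -> w != 1.
Proof.
have /andP[t20 t21] := ht2.
case: (eqVneq i j) => [<-|ij] hw; last first.
  have [u [v ->]] : exists u v, w = E i j * (t1 ^ u * t2 ^ v).
    by move: hw; rewrite mem_cat => /orP[] /mapP[s _ ->]; do 2!eexists.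
  apply/eqP => h; have := hgen_e u v ij; apply/negP; rewrite negbK.
  by rewrite -(mulr1 (e i)) -h /ratio; apply/eqP; field.
have Eii : E i i = 1 by rewrite /ratio divff.
suff : vnorm w != 1 by apply: contraNneq => ->; rewrite vnorm1.
move: hw; rewrite mem_cat Eii => /orP[] /mapP[s sc ->]; have [/andP[h1 h2] /andP[h3 h4] h5] := cell_facts sc;
  rewrite mul1r vnormM !vnormXz legE armE.
  rewrite gt_eqF//.
  have a1 : 1 <= vnorm t1 ^ ((prow (transpose (ga i)) s.2.-1)%:Z - s.1%:Z).
    rewrite -(expr0z (vnorm t1)); apply: ler_weXz2l; [exact: ltW|lia].
  have b1 : 1 < vnorm t2 ^ (- ((prow (ga i) s.1.-1)%:Z - s.2%:Z) - 1).
    rewrite -[X in _ ^ X]opprK -exprz_inv -(expr0z (vnorm t2)^-1) ltr_eXz2l ?invf_gt1//; lia.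
  by rewrite (lt_le_trans b1)// ler_peMl// ltW// (lt_trans ltr01).
rewrite lt_eqF//.
have a1 : vnorm t1 ^ (- ((prow (transpose (ga i)) s.2.-1)%:Z - s.1%:Z) - 1) < 1.
  by rewrite -(expr0z (vnorm t1)) ltr_eXz2l//; lia.
have b1 : vnorm t2 ^ ((prow (ga i) s.1.-1)%:Z - s.2%:Z) <= 1.
  rewrite -[X in _ ^ X]opprK -exprz_inv -(expr0z (vnorm t2)^-1); apply: ler_weXz2l.
    by rewrite invf_ge1// ltW.
  lia.
by rewrite (le_lt_trans _ a1)// ler_piMr// exprz_ge0 ?vnorm_ge0.
Qed.

Lemma prod_ws_inv i j (F : K -> K) :
  \prod_(w <- ws j i) F w^-1 = \prod_(w <- ws i j) F (t1 * t2 * w).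
Proof.
have tt u v : t1 * t2 * (E i j * (t1 ^ u * t2 ^ v)) = E i j * (t1 ^ (u + 1) * t2 ^ (v + 1)).
  by rewrite !expfzDr ?t1_neq0 ?t2_neq0// !expr1z; ring.
rewrite !big_cat !big_map [LHS]mulrC; congr (_ * _); apply: eq_bigr => s _; congr F;
  by rewrite inv_monomial tt; congr (_ * (_ ^ _ * _ ^ _)); ring.
Qed.

Lemma prod_tangent (F : K -> K) : \prod_(w <- tangent_weights e t1 t2 ga) F w =
  \prod_(i < r) \prod_(j < r) \prod_(w <- ws i j) F w^-1.
Proof.
rewrite big_flatten big_map big_enum /= exchange_big pair_big /=.
apply: eq_bigr => -[j i] _ /=; rewrite !big_cat !big_map /=; congr (_ * _);
  apply: eq_bigr => s _; congr F; rewrite inv_monomial;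
  by congr (_ * (_ ^ _ * _ ^ _)); ring.
Qed.

Lemma size_ws i j : size (ws i j) = (psize (ga i) + psize (ga j))%N.
Proof. by rewrite size_cat !size_map !size_cells addnC. Qed.

Local Notation T := (t1 * t2).

Definition VP c i j : K := Vac t1 t2 (c * E i j / t2).
Definition VQ c i j : K := VG p t1 t2 (c * E i j / t2).
Definition WP c i j : K := \prod_(w <- ws i j) (1 - c * w).
Definition WQ c i j : K := \prod_(w <- ws i j) gsc p (c * w).

Definition vac_ok X := forall k m, (0 < k)%N -> (0 < m)%N -> vac_array t1 t2 X k m != 1.

Lemma vac_arrayE c i j k m : vac_array t1 t2 (c * E i j / t2) k.+1 m =
  c * (E i j * (t1 ^ (- m%:Z) * t2 ^ k%:Z)).
Proof. by rewrite /vac_array exprSz; field; rewrite t2_neq0. Qed.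

Lemma vac_ok_y N i j : vac_ok (p ^+ N * y * E i j / t2).
Proof.
move=> [//|k] m _ _; rewrite vac_arrayE.
case: (eqVneq (p ^+ N) 0) => [->|pN]; first by rewrite !mul0r eq_sym oner_eq0.
apply/eqP => h; have /eqP := hgen_y j i (- N%:Z) m%:Z (- k%:Z); apply.
have z1 : t1 ^ (- m%:Z) != 0 by rewrite expfz_neq0 ?t1_neq0.
have z2 : t2 ^ k%:Z != 0 by rewrite expfz_neq0 ?t2_neq0.
rewrite -[p ^ _]invr_expz -[t2 ^ _]invr_expz -[X in t1 ^ X]opprK -[t1 ^ _]invr_expz -(exprnP p).
rewrite -[e i]mulr1 -h /ratio; field.
by rewrite z1 z2 pN he.
Qed.

Lemma vac_ok_y' N i j : vac_ok (p ^+ N * (y^-1 * T) * E i j / t2).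
Proof.
move=> [//|k] m _ _; rewrite vac_arrayE.
apply/eqP => h; have /eqP := hgen_y i j N%:Z (1 - m%:Z) (1 + k%:Z); apply.
rewrite !expfzDr ?t1_neq0 ?t2_neq0// !expr1z -(exprnP p).
rewrite -[y * e i]mulr1 -h /ratio; field.
by rewrite he hy.
Qed.

Lemma vnorm_pN N i j (c : K) : (0 < N)%N -> vnorm c <= D i j -> vnorm (p ^+ N * c) < 1.
Proof.
case: N => [//|N] _ h; rewrite vnormM vnormX exprS.
apply: le_lt_trans (pD_lt1 i j); rewrite ler_pM ?mulr_ge0 ?exprn_ge0 ?vnorm_ge0//.
by rewrite ler_piMr ?vnorm_ge0// exprn_ile1 ?vnorm_ge0// ltW// p_lt1.
Qed.

Lemma neq1_vnorm (x : K) : vnorm x < 1 -> x != 1.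
Proof. by apply: contraTneq => ->; rewrite vnorm1 ltxx. Qed.

Lemma neq1_monomial i j u v : i != j -> E i j * (t1 ^ u * t2 ^ v) != 1.
Proof.
move=> ij; apply/eqP => h; have /eqP := hgen_e u v ij; apply.
by rewrite -(mulr1 (e i)) -h /ratio; field.
Qed.

Lemma vac_ok_1 N i j : vac_ok (p ^+ N * 1 * E i j / t2).
Proof.
move=> [//|k] [//|m] _ _; rewrite vac_arrayE mulr1.
case: N => [|N]; last first.
  by apply/neq1_vnorm/(vnorm_pN (i := i) (j := j)) => //; apply: monomial_bound; lia.
rewrite expr0 mul1r; case: (eqVneq i j) => [<-|ij]; last exact: neq1_monomial.
apply: neq1_vnorm; rewrite /ratio divff// mul1r vnormM !vnormXz.
have /andP[t20 t21] := ht2.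
have a1 : vnorm t1 ^ (- m.+1%:Z) < 1 by rewrite -(expr0z (vnorm t1)) ltr_eXz2l.
rewrite (le_lt_trans _ a1)// ler_piMr ?exprz_ge0 ?vnorm_ge0//.
by rewrite -exprnP exprn_ile1 ?vnorm_ge0// ltW.
Qed.

Lemma vac_ok_T N i j : (0 < N)%N || (i != j) -> vac_ok (p ^+ N * T * E i j / t2).
Proof.
move=> h [//|k] [//|m] _ _; rewrite vac_arrayE.
have -> : p ^+ N * T * (E i j * (t1 ^ (- m.+1%:Z) * t2 ^ k%:Z)) =
    p ^+ N * (E i j * (t1 ^ (- m%:Z) * t2 ^ k.+1%:Z)).
  have -> : - m%:Z = 1 + - m.+1%:Z by lia.
  by rewrite [t1 ^ (1 + _)]expfzDr ?t1_neq0// exprSz expr1z; ring.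
case: N h => [|N] h; last first.
  by apply/neq1_vnorm/(vnorm_pN (i := i) (j := j)) => //; apply: monomial_bound; lia.
by rewrite expr0 mul1r neq1_monomial.
Qed.

Lemma VP_1 i j : VP 1 i j != 0.
Proof. by apply: Vac_neq0 => //; have := @vac_ok_1 0 i j; rewrite expr0 mul1r. Qed.
Lemma VP_y i j : VP y i j != 0.
Proof. by apply: Vac_neq0 => //; have := @vac_ok_y 0 i j; rewrite expr0 mul1r. Qed.
Lemma VP_y' i j : VP (y^-1 * T) i j != 0.
Proof. by apply: Vac_neq0 => //; have := @vac_ok_y' 0 i j; rewrite expr0 mul1r. Qed.
Lemma VP_T i j : i != j -> VP T i j != 0.
Proof. by move=> ij; apply: Vac_neq0 => //; have := @vac_ok_T 0 i j; rewrite expr0 mul1r; apply. Qed.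

Lemma VQ_neq0 c i j : (forall N, (0 < N)%N -> vac_ok (p ^+ N * c * E i j / t2)) -> VQ c i j != 0.
Proof.
move=> h; apply: (VG_neq0 p_lt1 ht1 ht2) => N k m N0 k0 m0.
by rewrite [_ * (_ / t2)]mulrA [_ * (c * _)]mulrA; exact: h.
Qed.

Lemma WP_1 i j : WP 1 i j != 0.
Proof.
by rewrite /WP prodf_seq_neq0; apply/allP => w /ws_neq1; rewrite mul1r subr_eq0 eq_sym.
Qed.

Lemma WP_T i j : WP T i j != 0.
Proof.
rewrite /WP -(prod_ws_inv i j (fun x => 1 - x)) prodf_seq_neq0; apply/allP => w /ws_neq1 w1.
by rewrite subr_eq0 eq_sym invr_eq1.
Qed.

Lemma gsc_ws i j w : w \in ws i j -> gsc p w != 0 /\ gsc p w^-1 != 0.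
Proof.
move=> /ws_bound[h1 h2]; split; apply: (gsc_neq0 p_lt1) => N N0; apply: neq1_vnorm.
  exact: vnorm_pN h1.
exact: vnorm_pN h2.
Qed.

Lemma WQ_1 i j : WQ 1 i j != 0.
Proof. by rewrite /WQ prodf_seq_neq0; apply/allP => w /gsc_ws[]; rewrite mul1r. Qed.

Lemma WQ_T i j : WQ T i j != 0.
Proof.
by rewrite /WQ -(prod_ws_inv i j (gsc p)) prodf_seq_neq0; apply/allP => w /gsc_ws[].
Qed.

Lemma WP_y' i j : WP (y^-1 * T) i j / WP T i j = y ^- size (ws j i) * (WP y j i / WP 1 j i).
Proof.
have -> : WP (y^-1 * T) i j = \prod_(w <- ws j i) (1 - y^-1 * w^-1).
  by rewrite (prod_ws_inv i j (fun x => 1 - y^-1 * x)); apply: eq_bigr => w _; congr (1 - _); rewrite [RHS]mulrA.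
have -> : WP T i j = \prod_(w <- ws j i) (1 - w^-1) by rewrite (prod_ws_inv i j (fun x => 1 - x)).
have -> : y ^- size (ws j i) = \prod_(w <- ws j i) y^-1.
  by rewrite big_const_seq count_predT iter_mulr_1 exprVn.
rewrite /WP -!prodf_div -big_split /=; apply: eq_big_seq => w hw.
have w1 := ws_neq1 hw; have w0 : w != 0.
  by move: hw; rewrite mem_cat => /orP[] /mapP[s _ ->];
    rewrite !mulf_neq0 ?expfz_neq0 ?t1_neq0 ?t2_neq0 ?invr_eq0.
have w2 : 1 - w != 0 by rewrite subr_eq0 eq_sym.
have -> : 1 - w^-1 = - (1 - w) / w by field.
by rewrite mul1r; field; rewrite oppr_eq0 hy w0 w2.
Qed.

Lemma Ginf_cvg : kcvg (fun N => \prod_(1 <= k < N.+1) \prod_(i < r) \prod_(j < r) Omega P L (p ^+ k) i j)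
  (\prod_(i < r) \prod_(j < r) (VQ y i j * WQ y i j * (VQ (y^-1 * T) i j * WQ (y^-1 * T) i j) /
     (VQ 1 i j * WQ 1 i j * (VQ T i j * WQ T i j)))).
Proof.
have VW c i j : kcvg (fun N => \prod_(1 <= k < N.+1) PhiU i j (p ^+ k * c)) (VQ c i j * WQ c i j).
  exact: GamU_cvg.
have n0 i j : VQ 1 i j * WQ 1 i j * (VQ T i j * WQ T i j) != 0.
  rewrite !mulf_neq0 ?WQ_1 ?WQ_T ?VQ_neq0// => N N0; first exact: vac_ok_1.
  by apply: vac_ok_T; rewrite N0.
apply: eq_kcvg (kcvg_prod _ (fun i _ => kcvg_prod _ (fun j _ =>
  kcvgM (kcvgM (VW y i j) (VW (y^-1 * T) i j)) (kcvgV (n0 i j) (kcvgM (VW 1 i j) (VW T i j)))))) => N.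
rewrite [RHS]exchange_big /=; apply: eq_bigr => i _.
rewrite [RHS]exchange_big /=; apply: eq_bigr => j _.
rewrite -!big_split -prodf_div /=; apply: eq_bigr => k _.
by rewrite OmegaE mulr1.
Qed.

Lemma M_VP X N c i j : X = p ^+ N * c * E i j / t2 -> vac_ok (p ^+ N * c * E i j / t2) ->
  M X t1^-1 t2 = (Vac t1 t2 (p ^+ N * (c * E i j / t2)))^-1.
Proof.
move=> -> h; rewrite (M_Vac ht1 ht2 h); congr (Vac _ _ _)^-1.
by rewrite [RHS]mulrA [in RHS]mulrA.
Qed.

Lemma vacuum_prefactor :
  \prod_(i < r) \prod_(j < r | (i < j)%N)
     (M (y^-1 * e i * (e j)^-1 * t1) t1^-1 t2 /
      M (e i * (e j)^-1 * t1) t1^-1 t2 *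
      (M (e j * (e i)^-1 * t2^-1) t1^-1 t2 /
       M (y * e j * (e i)^-1 * t2^-1) t1^-1 t2)) =
  \prod_(i < r) \prod_(j < r | (j < i)%N)
     (VP T i j / VP (y^-1 * T) i j * (VP y j i / VP 1 j i)).
Proof.
have t2n := t2_neq0; rewrite exchange_lt_ord; apply: eq_bigr => i _; apply: eq_bigr => j ji.
have ij : i != j by rewrite -val_eqE /= gtn_eqF.
rewrite (@M_VP _ 0 (y^-1 * T) i j _ (@vac_ok_y' 0 i j)); last by rewrite /ratio expr0 mul1r; field; rewrite ?he ?hy ?t2n.
rewrite (@M_VP _ 0 T i j _ (@vac_ok_T 0 i j ij)); last by rewrite /ratio expr0 mul1r; field; rewrite ?he ?t2n.
rewrite (@M_VP _ 0 1 j i _ (@vac_ok_1 0 j i)); last by rewrite /ratio expr0 mul1r; field; rewrite ?he ?t2n.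
rewrite (@M_VP _ 0 y j i _ (@vac_ok_y 0 j i)); last by rewrite /ratio expr0 mul1r; field; rewrite ?he ?t2n.
have hV c a b : Vac t1 t2 (p ^+ 0 * (c * E a b / t2)) = VP c a b by rewrite expr0 mul1r.
by rewrite !hV !invrK; congr (_ * _); rewrite [LHS]mulrC.
Qed.

Lemma loop_prefactor Pinf : kcvg (fun N => \prod_(1 <= k < N.+1) (1 - p ^+ k)) Pinf ->
  iprod (fun N =>
    (1 - p ^+ N) *
    \prod_(i < r) \prod_(j < r)
      (M (p ^+ N.-1 * y * e i * (e j)^-1 * t2^-1) t1^-1 t2 /
       M (p ^+ N.-1 * e i * (e j)^-1 * t2^-1) t1^-1 t2 *
       (M (p ^+ N * y^-1 * e i * (e j)^-1 * t1) t1^-1 t2 /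
        M (p ^+ N * e i * (e j)^-1 * t1) t1^-1 t2))) =
  Pinf * \prod_(i < r) \prod_(j < r)
    (VP 1 i j * VQ 1 i j / (VP y i j * VQ y i j) * (VQ T i j / VQ (y^-1 * T) i j)).
Proof.
move=> hPinf; apply: iprod_has.
have n1 i j : VP y i j * VQ y i j != 0.
  by rewrite mulf_neq0 ?VP_y// VQ_neq0// => N _; exact: vac_ok_y.
have n2 i j : VQ (y^-1 * T) i j != 0 by apply: VQ_neq0 => N _; exact: vac_ok_y'.
have V0 c i j : kcvg (fun N => \prod_(1 <= k < N.+1) Vac t1 t2 (p ^+ k.-1 * (c * E i j / t2))) (VP c i j * VQ c i j).
  exact: VG0_cvg p_lt1 ht1 ht2 _.
have V1 c i j : kcvg (fun N => \prod_(1 <= k < N.+1) Vac t1 t2 (p ^+ k * (c * E i j / t2))) (VQ c i j).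
  exact: VG_cvg p_lt1 ht1 ht2 _.
have t2n := t2_neq0.
apply: eq_kcvg (kcvgM hPinf (kcvg_prod _ (fun i _ => kcvg_prod _ (fun j _ =>
  kcvgM (kcvgM (V0 1 i j) (kcvgV (n1 i j) (V0 y i j)))
    (kcvgM (V1 T i j) (kcvgV (n2 i j) (V1 (y^-1 * T) i j))))))) => N.
rewrite [RHS]big_split /=; congr (_ * _).
rewrite [LHS]exchange_big [RHS]exchange_big /=; apply: eq_bigr => j _.
rewrite [RHS]exchange_big /=; apply: eq_bigr => i _.
rewrite -!prodf_div -big_split /= big_nat [RHS]big_nat; apply: eq_bigr => k /andP[k0 _].
rewrite (@M_VP _ k.-1 y i j _ (@vac_ok_y _ i j)); last by rewrite /ratio; field; rewrite ?he ?t2n.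
rewrite (@M_VP _ k.-1 1 i j _ (@vac_ok_1 _ i j)); last by rewrite /ratio; field; rewrite ?he ?t2n.
rewrite (@M_VP _ k (y^-1 * T) i j _ (@vac_ok_y' _ i j)); last by rewrite /ratio; field; rewrite ?he ?hy ?t2n.
rewrite (@M_VP _ k T i j); [|by rewrite /ratio; field; rewrite ?he ?t2n|by apply: vac_ok_T; rewrite k0].
by rewrite !invrK; congr (_ * _); rewrite [LHS]mulrC.
Qed.

Lemma trace_block Pinf : kcvg (fun N => \prod_(1 <= k < N.+1) (1 - p ^+ k)) Pinf -> Pinf != 0 ->
  optrace (powH p ** opprod (block P L)) =
  (\prod_(i < r) PhiU i i y) * (\prod_(i < r) \prod_(j < r | (j < i)%N)
     (PhiU i j y * PhiU i j (y^-1 * T) / (PhiU i j 1 * PhiU i j T))) *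
  \prod_(i < r) \prod_(j < r) (VQ y i j * WQ y i j * (VQ (y^-1 * T) i j * WQ (y^-1 * T) i j) /
     (VQ 1 i j * WQ 1 i j * (VQ T i j * WQ T i j))) / Pinf.
Proof.
move=> hPinf Pinf0; have [rho [rho01 h1 h2]] := small_exists.
rewrite (word_trace rho01 p_lt1 h1 h2 hPinf Pinf0 Ginf_cvg); congr (_ * _ * _ / _).
  by apply: eq_bigr => i _; rewrite omega_diag.
by apply: eq_bigr => i _; apply: eq_bigr => j _; rewrite OmegaE !mul1r.
Qed.

Lemma fixed_point_term sqrty : sqrty ^+ 2 = y ->
  \prod_(w <- tangent_weights e t1 t2 ga) (sqrty^-1 * Theta p (sqrty ^+ 2) w^-1) =
  \prod_(i < r) \prod_(j < r) (sqrty ^- size (ws i j) * (WP y i j * WQ y i j / (WP 1 i j * WQ 1 i j)) *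
     (WQ (y^-1 * T) i j / WQ T i j)).
Proof.
move=> ->; rewrite (prod_tangent (fun w => sqrty^-1 * Theta p y w^-1)).
transitivity (\prod_(i < r) \prod_(j < r) (sqrty ^- size (ws i j) *
   (WP y i j * WQ y i j / (WP 1 i j * WQ 1 i j))) * \prod_(i < r) \prod_(j < r) (WQ (y^-1 * T) j i / WQ T j i)).
  rewrite -big_split; apply: eq_bigr => i _; rewrite -big_split; apply: eq_bigr => j _ /=.
  have -> : WQ (y^-1 * T) j i = \prod_(w <- ws i j) gsc p (y^-1 * w^-1).
    by rewrite (prod_ws_inv j i (fun x => gsc p (y^-1 * x))); apply: eq_bigr => w _; congr (gsc _ _); rewrite [RHS]mulrA.
  have -> : WQ T j i = \prod_(w <- ws i j) gsc p w^-1 by rewrite (prod_ws_inv j i (gsc p)).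
  have -> : sqrty ^- size (ws i j) = \prod_(w <- ws i j) sqrty^-1.
    by rewrite big_const_seq count_predT iter_mulr_1 exprVn.
  rewrite /WP /WQ -!big_split -!prodf_div -!big_split /=; apply: eq_big_seq => w hw.
  have [g1 g2] := gsc_ws hw; rewrite invrK (Theta_gsc p_lt1 y _ g1 g2); last first.
    by rewrite subr_eq0 eq_sym (ws_neq1 hw).
  by rewrite !mul1r [in LHS]invfM invfM; ring.
by rewrite [X in _ * X]exchange_big -big_split; apply: eq_bigr => i _; rewrite -big_split.
Qed.

Lemma term_identity sqrty Pinf : sqrty ^+ 2 = y ->
  kcvg (fun N => \prod_(1 <= k < N.+1) (1 - p ^+ k)) Pinf -> Pinf != 0 ->
  \prod_(w <- tangent_weights e t1 t2 ga) (sqrty^-1 * Theta p (sqrty ^+ 2) w^-1) =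
  (y ^+ n)^-1 *
  (\prod_(i < r) \prod_(j < r | (j < i)%N) (VP T i j / VP (y^-1 * T) i j * (VP y j i / VP 1 j i))) *
  (Pinf * \prod_(i < r) \prod_(j < r)
    (VP 1 i j * VQ 1 i j / (VP y i j * VQ y i j) * (VQ T i j / VQ (y^-1 * T) i j))) *
  (optrace (powH p ** opprod (block P L)) / \prod_(i < r) PhiU i i 1).
Proof.
move=> hs hPinf Pinf0; rewrite (fixed_point_term hs) (trace_block hPinf Pinf0).
have -> : (y ^+ n)^-1 = \prod_(i < r) y ^- psize (ga i).
  by rewrite -hga /msize prodfV; congr _^-1; rewrite (big_morph (fun k => y ^+ k) (exprD y) (expr0 y)).
have n1 i j N : (0 < N)%N -> vac_ok (p ^+ N * 1 * E i j / t2) by move=> _; exact: vac_ok_1.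
have n2 i j N : (0 < N)%N -> vac_ok (p ^+ N * y * E i j / t2) by move=> _; exact: vac_ok_y.
have n3 i j N : (0 < N)%N -> vac_ok (p ^+ N * (y^-1 * T) * E i j / t2) by move=> _; exact: vac_ok_y'.
have n4 i j N : (0 < N)%N -> vac_ok (p ^+ N * T * E i j / t2) by move=> N0; apply: vac_ok_T; rewrite N0.
have m1 i j := VQ_neq0 (n1 i j); have m2 i j := VQ_neq0 (n2 i j).
have m3 i j := VQ_neq0 (n3 i j); have m4 i j := VQ_neq0 (n4 i j).
have PE c i j : PhiU i j c = VP c i j * WP c i j by exact: PhiUE.
pose F i j := sqrty ^- size (ws i j) * (WP y i j * WQ y i j / (WP 1 i j * WQ 1 i j)) *
  (WQ (y^-1 * T) i j / WQ T i j).
pose G i j := VP 1 i j * VQ 1 i j / (VP y i j * VQ y i j) * (VQ T i j / VQ (y^-1 * T) i j).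
pose H i j := VQ y i j * WQ y i j * (VQ (y^-1 * T) i j * WQ (y^-1 * T) i j) /
  (VQ 1 i j * WQ 1 i j * (VQ T i j * WQ T i j)).
pose X i j := VP T i j / VP (y^-1 * T) i j * (VP y j i / VP 1 j i).
pose O i j := PhiU i j y * PhiU i j (y^-1 * T) / (PhiU i j 1 * PhiU i j T).
rewrite -/(F _ _) [LHS](prod_pairs F) (prod_pairs G) (prod_pairs H).
rewrite (prod_collect _ _ _ _ _ (fun i j => X i j) (fun i j => G i j * G j i) (fun i j => O i j)
  (fun i j => H i j * H j i) Pinf0).
congr (_ * _).
  apply: eq_bigr => i _.
  rewrite /F /G /H !PE size_ws addnn -mul2n exprM hs.
  exact: diagonal_cancel (VP_1 i i) (m1 i i) (VP_y i i) (m2 i i) (m4 i i) (m3 i i)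
    (WP_1 i i) (WQ_1 i i) (WQ_T i i).
apply: eq_bigr => i _; apply: eq_bigr => j ji.
have ij : i != j by rewrite -val_eqE /= gtn_eqF.
have k1 := And4 (WP_1 i j) (WP_T i j) (WP_1 j i) (WQ_1 i j).
have k2 := And4 (WQ_T i j) (WQ_1 j i) (WQ_T j i) (VP_y i j).
have k3 := And4 (VP_y' i j) (VP_1 i j) (VP_T ij) (VP_y j i).
have k4 := And4 (VP_1 j i) (m2 i j) (m3 i j) (m1 i j).
have k5 := And5 (m4 i j) (m2 j i) (m3 j i) (m1 j i) (m4 j i).
rewrite /X /O !PE /F /G /H -(off_diagonal_cancel _ _ _ _ _ (WP_y' i j) k1 k2 k3 k4 k5).
have hsq : y ^- size (ws j i) = sqrty ^- size (ws i j) * sqrty ^- size (ws j i).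
  by rewrite !size_ws [(psize (ga j) + _)%N]addnC -hs -exprM mul2n -addnn exprD invfM.
by rewrite hsq; ring.
Qed.
End Main.

Theorem corollary3p6 (R : realType) (K : completeValuedField R)
    (r n : nat) (e : 'I_r -> K) (t1 t2 p y sqrty : K)
    (hr : (1 <= r)%N)
    (hsqrty : sqrty ^+ 2 = y) (hy : y != 0) (he : forall i, e i != 0)
    (ht1 : 1 < vnorm t1) (ht2 : 0 < vnorm t2 < 1)
    (hconv0 : forall i j : 'I_r, (i < j)%N ->
       vnorm (e i) * vnorm t1 ^+ n < vnorm (e j) * vnorm t2 ^+ n)
    (hconvp : forall i j : 'I_r,
       vnorm p * vnorm (e j) * vnorm t1 ^+ n < vnorm (e i) * vnorm t2 ^+ n)
    (hgen_e : forall (i j : 'I_r) (a b : int), i != j ->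
       e i != e j * t1 ^ a * t2 ^ b)
    (hgen_y : forall (i j : 'I_r) (a b c : int),
       y * e i != e j * p ^ a * t1 ^ b * t2 ^ c) :
  Ell p sqrty n e t1 t2 =
  (y ^+ n)^-1 *
  (\prod_(i < r) \prod_(j < r | (i < j)%N)
     (M (y^-1 * e i * (e j)^-1 * t1) t1^-1 t2 /
      M (e i * (e j)^-1 * t1) t1^-1 t2 *
      (M (e j * (e i)^-1 * t2^-1) t1^-1 t2 /
       M (y * e j * (e i)^-1 * t2^-1) t1^-1 t2))) *
  iprod (fun N =>
    (1 - p ^+ N) *
    \prod_(i < r) \prod_(j < r)
      (M (p ^+ N.-1 * y * e i * (e j)^-1 * t2^-1) t1^-1 t2 /
       M (p ^+ N.-1 * e i * (e j)^-1 * t2^-1) t1^-1 t2 *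
       (M (p ^+ N * y^-1 * e i * (e j)^-1 * t1) t1^-1 t2 /
        M (p ^+ N * e i * (e j)^-1 * t1) t1^-1 t2))) *
  \sum_(ga \in [set ga : multipart r | msize ga = n])
    (let x i := xvec t1 t2 (e i) (ga i) in
     let z i := zvec t1 t2 (e i) (ga i) in
     optrace (powH p ** opprod (fun i =>
       Gamma'_minus (z i) **
       Gamma'_plus (fun k => t2^-1 * x i k) **
       Gamma_minus (fun k => - y * z i k) **
       Gamma_plus (fun k => - y^-1 * t1 * x i k))) /
     \prod_(i < r) iprod2 (fun k m => 1 - t2^-1 * x i k * z i m)).
Proof.
have p1 := p_lt1 hr he ht1 ht2 hconvp.
have [Pinf Pinf0 hPinf] := euler_prod_ex p1.
rewrite /Ell mulr_fsumr; apply: eq_fsbigr => ga /set_mem/= hga.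
rewrite (vacuum_prefactor hr hy he ht1 ht2 hconvp hgen_e hgen_y hga).
rewrite (loop_prefactor hr hy he ht1 ht2 hconvp hgen_e hgen_y hga hPinf).
rewrite (term_identity hr hy he ht1 ht2 hconv0 hconvp hgen_e hgen_y hga hsqrty hPinf Pinf0).
congr (_ * (_ / _)); apply: eq_bigr => i _; congr Phi.
by apply/funext => k; apply/funext => m; rewrite mul1r.
Qed.
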